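(* For every constant $\epsilon>0$ there exists an algorithm for the submodular secretary problem with shortlists under a $p$-matchoid constraint that achieves a competitive ratio of $\frac{1}{p+1}\left(1-\frac{1}{e^{p+1}}-\epsilon\right)$ using a shortlist of size $\tilde{O}\left(\frac{k}{\epsilon}\right)$. The running time of this algorithm is $O(n\kappa^{p})$, where $\kappa=\max_{i\in[q]} rk(\mathcal{M}_i)$.
   Context: A $p$-matchoid constraint is given by matroids $\mathcal{M}_i=(\mathcal{N}_i,\mathcal{I}_i)$, $i\in[q]$, such that every element belongs to at most $p$ of the ground sets $\mathcal{N}_i$; a set $S$ is feasible if $S\cap\mathcal{N}_i\in\mathcal{I}_i$ for every $i\in[q]$ (independence oracles for the matroids are available). $k$ denotes the size of the largest feasible set. Secretary problem with shortlists: a set $\mathcal{U}=\{a_1,\dots,a_n\}$ of items is fixed in advance but unknown; only $n$ is known. Items arrive one at a time in uniformly random order, and on arrival the algorithm irrevocably decides whether to add the item to a shortlist $A$. The objective is a nonnegative monotone submodular function $f$ with value-oracle access. The value is $\mathrm{ALG}=\mathbb{E}[\max_{S\subseteq A,\,S\text{ feasible}} f(S)]$ and $\mathrm{OPT}=\max_{S\subseteq\mathcal{U},\,S\text{ feasible}} f(S)$; competitive ratio $c$ with shortlist size $\eta(k)$ means $|A|\le\eta(k)$ and $\mathrm{ALG}/\mathrm{OPT}\ge c$. The $\tilde{O}$ notation hides polylogarithmic factors in $1/\epsilon$. *)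

(* Defs.v *)
From mathcomp Require Import all_boot all_order all_algebra all_fingroup.
From mathcomp Require Import reals sequences exp.

Set Implicit Arguments.
Unset Strict Implicit.
Unset Printing Implicit Defensive.

Import Order.TTheory GRing.Theory Num.Theory.
Local Open Scope ring_scope.

Record matroid (T : finType) := Matroid {
  ground : {set T};
  indep : {set {set T}};
  indep_ground : forall A, A \in indep -> A \subset ground;
  indep_set0 : set0 \in indep;
  indep_sub : forall A B : {set T}, A \subset B -> B \in indep -> A \in indep;
  indep_augment : forall A B : {set T}, A \in indep -> B \in indep ->
    (#|A| < #|B|)%N -> exists2 x, x \in B :\: A & x |: A \in indep
}.

Definition rk (T : finType) (M : matroid T) : nat := \max_(A in indep M) #|A|.

(* The items a_1, ..., a_n are the elements of 'I_n. *)
Record instance (R : realType) (n : nat) := Instance {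
  nmat : nat;
  mat : 'I_nmat -> matroid 'I_n;
  val_f : {set 'I_n} -> R
}.

Section Instance.
Context {R : realType} {n : nat}.
Implicit Types (I : instance R n) (f : {set 'I_n} -> R) (S A B : {set 'I_n}).

Definition nonnegative f : Prop := forall S, 0 <= f S.

Definition monotone f : Prop := forall A B, A \subset B -> f A <= f B.

Definition submodular f : Prop :=
  forall A B, f (A :|: B) + f (A :&: B) <= f A + f B.

Definition is_matchoid (p : nat) I : Prop :=
  forall x : 'I_n, (#|[set i : 'I_(nmat I) | x \in ground (mat i)]| <= p)%N.

Definition feasible I S : bool :=
  [forall i : 'I_(nmat I), (S :&: ground (mat i)) \in indep (mat i)].

Definition max_feasible_size I : nat := \max_(S | feasible I S) #|S|.

Definition max_rank I : nat := \max_(i < nmat I) rk (mat i).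

(* The default value 0 is harmless: set0 is feasible and val_f is nonnegative
   in all uses. *)
Definition best_within I A : R :=
  \big[Num.max/0]_(S : {set 'I_n} | (S \subset A) && feasible I S) val_f I S.

Definition OPT I : R := best_within I [set: 'I_n].

End Instance.

(* Online algorithms are programs of a unit-cost random access machine.  The
   memory consists of arrays, indexed by naturals, of naturals and of reals;
   expressions and tests have a fixed size in a given program, so evaluating
   one counts as part of the command that contains it.  Items are referred to
   by their arrival time 0, ..., n.-1, and a set of items is passed to an oracle
   as the first l entries of an array of naturals; a reference to an item that
   has not arrived yet is void.  There is no multiplication: at unit cost it
   would allow unreasonably long numbers. *)
Inductive nexpr :=
| NLit of nat
| NCell of nexpr & nexpr
| NAdd of nexpr & nexpr
| NSub of nexpr & nexpr.

Inductive rexpr :=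
| ROfNat of nexpr
| RCell of nexpr & nexpr
| RAdd of rexpr & rexpr
| RSub of rexpr & rexpr.

Inductive test :=
| NLt of nexpr & nexpr
| RLt of rexpr & rexpr.

(* The last two arguments b, j of a command that produces a value are the
   array and the index of the cell receiving it. *)
Inductive cmd :=
| NSet (e b j : nexpr)
| RSet (e : rexpr) (b j : nexpr)
| Draw (m b j : nexpr)       (* uniform in {0, ..., m.-1}; 0 if m = 0 *)
| Next                       (* wait for the next item *)
| Accept                     (* shortlist the item that has just arrived *)
| Value (a l b j : nexpr)    (* val_f of the set in array a *)
| Indep (i a l b j : nexpr)  (* is the set in array a independent in mat i *)
| Incid (h c b j : nexpr)    (* i.+1 for the c-th i such that item h is in the
                                ground set of mat i; 0 if there is none *)
| If (t : test) (then_ else_ : seq cmd)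
| While (t : test) (body : seq cmd).

Definition program := seq cmd.

Record state (R : realType) (n : nat) := State {
  todo : seq cmd;
  nmem : nat -> nat -> nat;
  rmem : nat -> nat -> R;
  seen : nat;                (* number of items that have arrived *)
  shortlist : {set 'I_n}
}.

Definition put (V : Type) (m : nat -> nat -> V) (b j : nat) (v : V) :=
  fun b' j' => if (b' == b) && (j' == j) then v else m b' j'.

Section Machine.
Context {R : realType} {n : nat}.
Implicit Types (I : instance R n) (sigma : 'S_n) (s : state R n).

Fixpoint evaln s (e : nexpr) : nat :=
  match e with
  | NLit c => c
  | NCell a i => nmem s (evaln s a) (evaln s i)
  | NAdd e1 e2 => (evaln s e1 + evaln s e2)%N
  | NSub e1 e2 => (evaln s e1 - evaln s e2)%N
  end.

Fixpoint evalr s (e : rexpr) : R :=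
  match e with
  | ROfNat e => (evaln s e)%:R
  | RCell a i => rmem s (evaln s a) (evaln s i)
  | RAdd e1 e2 => evalr s e1 + evalr s e2
  | RSub e1 e2 => evalr s e1 - evalr s e2
  end.

Definition evalt s (t : test) : bool :=
  match t with
  | NLt e1 e2 => (evaln s e1 < evaln s e2)%N
  | RLt e1 e2 => evalr s e1 < evalr s e2
  end.

(* sigma h is the item that arrives at time h. *)
Definition denoted_set sigma s (a l : nat) : {set 'I_n} :=
  [set sigma h | h : 'I_n &
     (h < seen s)%N && ((h : nat) \in [seq nmem s a j | j <- iota 0 l])].

Definition current_item sigma s : {set 'I_n} :=
  [set sigma h | h : 'I_n & h.+1 == seen s].

Definition matroids_of I sigma s (h : nat) : seq 'I_(nmat I) :=
  [seq i <- enum 'I_(nmat I) | [exists h' : 'I_n,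
     [&& h' == h :> nat, (h' < seen s)%N & sigma h' \in ground (mat i)]]].

Definition is_indep I (i : nat) (A : {set 'I_n}) : bool :=
  [exists i' : 'I_(nmat I), (i' == i :> nat) && (A \in indep (mat i'))].

(* The successors of a state, all equally likely. *)
Definition step I sigma s : seq (state R n) :=
  if todo s is c :: cs then
    let N := evaln s in
    let goto cs' := State cs' (nmem s) (rmem s) (seen s) (shortlist s) in
    let setn b j v :=
      State cs (put (nmem s) (N b) (N j) v) (rmem s) (seen s) (shortlist s) in
    let setr b j v :=
      State cs (nmem s) (put (rmem s) (N b) (N j) v) (seen s) (shortlist s) in
    match c with
    | NSet e b j => [:: setn b j (N e)]
    | RSet e b j => [:: setr b j (evalr s e)]
    | Draw m b j => [seq setn b j v | v <- iota 0 (maxn 1 (N m))]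
    | Next =>
        [:: State cs (nmem s) (rmem s) (minn (seen s).+1 n) (shortlist s)]
    | Accept =>
        [:: State cs (nmem s) (rmem s) (seen s)
              (shortlist s :|: current_item sigma s)]
    | Value a l b j =>
        [:: setr b j (val_f I (denoted_set sigma s (N a) (N l)))]
    | Indep i a l b j =>
        [:: setn b j (is_indep I (N i) (denoted_set sigma s (N a) (N l)) : nat)]
    | Incid h c b j =>
        [:: setn b j (nth 0%N [seq (val i).+1 | i <- matroids_of I sigma s (N h)]
                        (N c))]
    | If t cs1 cs2 => [:: goto ((if evalt s t then cs1 else cs2) ++ cs)]
    | While t body => [:: goto (if evalt s t then body ++ todo s else cs)]
    end
  else [::].

(* Every run from s halts within T steps, in a state satisfying Q. *)
Fixpoint surely I sigma (T : nat) (Q : pred (state R n)) s : bool :=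
  if nilp (todo s) then Q s
  else if T is T'.+1 then all (surely I sigma T' Q) (step I sigma s)
  else false.

(* The expectation, over the draws, of F in the state reached after T steps, or
   in the final state of a run that halts earlier. *)
Fixpoint expect I sigma (T : nat) (F : state R n -> R) s : R :=
  if nilp (todo s) then F s
  else if T is T'.+1 then
    (\sum_(s' <- step I sigma s) expect I sigma T' F s')
      / (size (step I sigma s))%:R
  else F s.

(* The inputs n and k are in cells 0 and 1 of array 0. *)
Definition start (P : program) (k : nat) : state R n :=
  State P (put (put (fun _ _ => 0%N) 0 0 n) 0 1 k) (fun _ _ => 0) 0 set0.

Definition runs_within (P : program) I (T : nat) : Prop :=
  forall sigma,
    surely I sigma T predT (start P (max_feasible_size I)).

Definition shortlist_within (P : program) I (T : nat) (b : R) : Prop :=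
  forall sigma,
    surely I sigma T (fun s => #|shortlist s|%:R <= b)
      (start P (max_feasible_size I)).

(* Meaningful when P runs within T steps on I. *)
Definition ALG (P : program) I (T : nat) : R :=
  (\sum_(sigma : 'S_n)
     expect I sigma T (fun s => best_within I (shortlist s))
       (start P (max_feasible_size I)))
  / (n`!)%:R.

End Machine.

(* Main.v *)
Require Import Defs.
From mathcomp Require Import all_boot all_order all_algebra all_fingroup.
From mathcomp Require Import boolp reals sequences exp.
From mathcomp Require Import ring lra zify.

Set Implicit Arguments.
Unset Strict Implicit.
Unset Printing Implicit Defensive.

Import Order.TTheory GRing.Theory Num.Theory.
Local Open Scope ring_scope.

(* The arrivals are cut into m = (N+1) k windows by drawing for every item a uniform
   window and, inside it, one of N+1 slots; this can be simulated online, since only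
   the numbers of items of slot 0 and of the other slots of each window matter.  A
   feasible solution S is kept.  The gain of e is the change of f when e is added to
   S and, for each matroid that this violates, the lightest conflicting element is
   removed, the weight of an element being its marginal value over the elements that
   were selected before it.  Matroid exchange and submodularity give
     sum_(o in O) gain(o) >= f(O) - (1 + min(p, k)) f(S)   for feasible O.
   In each window, the items of slot 0 only raise a threshold, the other items that
   reach it are shortlisted, and S is updated with the last of them, or else with an
   element drawn from the items selected in earlier windows.  The assignments of
   items to windows and slots that lead to a given sequence of selections form a
   product set, so that, given the past, every item of O has a chance of at least
   1/m to be available, either in the window or as the drawn element.  Solving the
   recurrence for E f(S) gives the ratio.  In a window the shortlisted items are the
   records of a sequence of random slots, whence E (4/3)^X <= (4/3 (N+1))^m for their
   number X; the cap m L with L = O(log (1/eps)) is thus exceeded with probability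
   at most 2^-m. *)

(** * Matroid exchange and marginal values *)

(** An item of [O] that has won a window cannot show up in a later one, so its gain has to be
    collected by other means. This is the role of the drawn element: its index is uniform below [m],
    so every item of the history comes up with chance 1/m, matching the items not yet revealed. Only
    winners in slot 0 are lost for good, since they are never shortlisted; this costs a factor 1 -
    1/(N+1) on f(O), however the losses depend on the run. Conditioning has to leave the items
    independent, which a uniformly random order does not provide. Hence the independent windows and
    slots, and hence the condition on the winner of each window only: it restricts each item
    separately. The bound uses min(p, k) because the shortlist may not grow with p. The overflow
    probability 2^-m is not divided by p + 1; it must be absorbed by an error of order 1/((N+1)
    (min(p, k) + 1)), which m = (N+1) k permits. For p > k one proves the ratio for k, which is the
    larger one. *)

Section Domination.
Context {R : realType} {T U : finType}.

(** Maxima are matched with maxima: the hypothesis at the level of the largest [u] yields a [w] at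
    least as large, and removing both keeps the hypothesis at every lower level. In the exchange
    argument below this takes the place of a matching between two independent sets. *)
Lemma sum_le_of_level_counts (u : T -> R) (w : U -> R) (A : {set T}) (B : {set U}) :
  (forall s, s \in B -> 0 <= w s) ->
  (forall t, (#|[set o in A | (t <= u o)%R]| <= #|[set s in B | (t <= w s)%R]|)%N) ->
  \sum_(o in A) u o <= \sum_(s in B) w s.
Proof.
have [N] := ubnP #|A|; elim: N A B => // N IH A B ltN w0 cnt.
have [->|/set0Pn[o1 o1A]] := eqVneq A set0.
  by rewrite big_set0 sumr_ge0.
pose o0 := [arg max_(o > o1 in A) u o]%O.
have [o0A o0max] : o0 \in A /\ forall o, o \in A -> u o <= u o0.
  by rewrite /o0; case: arg_maxP => // i iA im; split.
have /card_gt0P[s1] : (0 < #|[set s in B | (u o0 <= w s)%R]|)%N.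
  apply: leq_trans (cnt (u o0)); rewrite card_gt0; apply/set0Pn; exists o0.
  by rewrite inE o0A lexx.
rewrite inE => /andP[s1B us1].
pose s0 := [arg max_(s > s1 in B) w s]%O.
have [s0B s0max] : s0 \in B /\ forall s, s \in B -> w s <= w s0.
  by rewrite /s0; case: arg_maxP => // i iA im; split.
have us0 : u o0 <= w s0 by apply: le_trans us1 (s0max _ s1B).
rewrite (big_setD1 o0) //= (big_setD1 s0) //= lerD //.
apply: IH.
- by move: ltN; rewrite (cardsD1 o0 A) o0A.
- by move=> s; rewrite in_setD1 => /andP[_ /w0].
move=> t; have [tu|ut] := lerP t (u o0); last first.
  apply: leq_trans (leq0n _); rewrite leqn0 cards_eq0.
  apply/eqP/setP => o; rewrite !inE; apply/negP => /andP[/andP[_ oA] tuo].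
  by have := o0max _ oA; rewrite leNgt (lt_le_trans ut tuo).
have := cnt t.
rewrite (cardsD1 o0) (cardsD1 s0 [set s in B | _]) !inE o0A s0B tu (le_trans tu us0) /=.
rewrite !add1n ltnS.
congr (_ <= _)%N; apply: eq_card => z; rewrite !inE andbA //.
Qed.

End Domination.

Section MatroidExchange.
Context {T : finType}.
Variable M : matroid T.
Implicit Types (A B C : {set T}).

Lemma indep_extend A B : A \in indep M -> B \in indep M -> (#|A| <= #|B|)%N ->
  exists2 C, C \in indep M & [/\ A \subset C, C \subset A :|: B & #|C| = #|B|].
Proof.
move=> Ai Bi; move En : (#|B| - #|A|)%N => d.
elim: d A Ai En => [|d IH] A Ai En le.
  by exists A => //; split=> //; [apply: subsetUl | lia].
have [|x /setDP[xB xA] xAi] := indep_augment Ai Bi; first by lia.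
have cA : #|x |: A| = #|A|.+1 by rewrite cardsU1 xA.
have [||C Ci [AC CB cC]] := IH _ xAi; try by rewrite cA; lia.
exists C => //; split=> //; first by apply: subset_trans AC; apply: subsetUr.
by apply: subset_trans CB _; rewrite -setUA subUset subxx sub1set inE xB orbT.
Qed.

(** Extending [o |: B] inside [o |: A] to the size of [A] leaves out one element of [A], and it lies
    outside [B]. With [B] the heavy elements of a solution, the exchanged element is a light one. *)
Lemma exchange_within A B o : A \in indep M -> o |: B \in indep M -> B \subset A ->
  o |: A \notin indep M ->
  exists2 d, d \in A :\: B & o |: A :\ d \in indep M.
Proof.
move=> Ai Bi sBA Ao.
have oA : o \notin A by apply: contraNN Ao => oA; rewrite (setUidPr _) // sub1set.
have oB : o \notin B by apply: contraNN oA => /(subsetP sBA).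
have cB : (#|o |: B| <= #|A|)%N.
  rewrite cardsU1 oB add1n ltn_neqAle subset_leq_card // andbT.
  apply: contraNneq Ao => /eqP cE; have -> // : A = B.
  by apply/esym/eqP; rewrite eqEcard sBA (eqP cE) leqnn.
have [C Ci [sC CA cC]] := indep_extend Bi Ai cB.
have oC : o \in C by apply: (subsetP sC); rewrite !inE eqxx.
have CoA : C \subset o |: A.
  by apply: subset_trans CA _; rewrite subUset subsetUr andbT setUS.
have [d|] := pickP [pred d in A | d \notin C].
  move=> /= /andP[dA dC]; exists d.
    rewrite inE dA andbT; apply: contraNN dC => dB.
    by apply: (subsetP sC); rewrite !inE dB orbT.
  suff -> : o |: A :\ d = C by [].
  apply/esym/eqP; rewrite eqEcard; apply/andP; split.
    apply/subsetP => z zC; have := subsetP CoA _ zC; rewrite !inE.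
    by case: eqVneq => //= _ zA; rewrite zA andbT; apply: contraNneq dC => <-.
  by rewrite cardsU1 !inE (negPf oA) andbF cC (cardsD1 d A) dA leqnn.
move=> /= nd; case/negP: Ao; suff -> : o |: A = C by [].
apply/eqP; rewrite eqEsubset CoA andbT subUset sub1set oC /=.
by apply/subsetP => z zA; have := nd z; rewrite /= zA /= => /negbFE.
Qed.

End MatroidExchange.

(** * Submodular functions: random removals and telescoped weights *)

Section Submodular.
Context {R : realType} {n : nat}.
Variable f : {set 'I_n} -> R.
Hypotheses (f0 : nonnegative f) (fm : monotone f) (fs : submodular f).
Implicit Types (A B D O : {set 'I_n}).

Lemma marginal_le A B x : A \subset B -> x \notin B ->
  f (x |: B) - f B <= f (x |: A) - f A.
Proof.
move=> sAB xB; have := fs (x |: A) B.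
have -> : x |: A :|: B = x |: B by rewrite -setUA (setUidPr sAB).
have -> : (x |: A) :&: B = A.
  apply/setP => z; rewrite !inE; case: eqVneq => [->|_] /=.
    by rewrite (negPf xB); apply/esym/negP => /(subsetP sAB); apply/negP.
  by rewrite andbC; case zA: (z \in A); rewrite ?andbF // (subsetP sAB).
lra.
Qed.

Lemma sum_marginal_ge O A :
  f (A :|: O) - f A <= \sum_(o in O) (f (o |: A) - f A).
Proof.
have [N] := ubnP #|O|; elim: N O => // N IH O ltN.
have [->|/set0Pn[o oO]] := eqVneq O set0.
  by rewrite big_set0 setU0 subrr.
rewrite (big_setD1 o) //=.
have {IH} := IH (O :\ o); move: ltN; rewrite (cardsD1 o O) oO => ltN /(_ ltN).
have : f (A :|: O) - f (A :|: O :\ o) <= f (o |: A) - f A; last by lra.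
have := fs (o |: A) (A :|: O :\ o).
have -> : o |: A :|: (A :|: O :\ o) = A :|: O.
  apply/setP => z; rewrite !inE; case: eqVneq => [->|_] /=; first by rewrite oO orbT.
  by rewrite orbA orbb.
have : f A <= f ((o |: A) :&: (A :|: O :\ o)); last by lra.
by apply: fm; rewrite subsetI subsetUr subsetUl.
Qed.

(* Marginals are telescoped along an enumeration of [O]: the element [o] is lost
   for few [x], however correlated the removals are. *)
Lemma sum_random_removal (K : finType) (D : K -> {set 'I_n}) O (d : R) :
  0 <= d -> (forall o, o \in O -> #|[set x | o \in D x]|%:R <= d * #|K|%:R) ->
  #|K|%:R * (1 - d) * f O <= \sum_x f (O :\: D x).
Proof.
move=> d0 dD.
(* The stronger claim charges only the part of [f O] above [f set0], which is what telescopes; it is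
   an equality for empty [O]. *)
suff : #|K|%:R * (f O - d * (f O - f set0)) <= \sum_x f (O :\: D x).
  apply: le_trans; rewrite -mulrA ler_wpM2l ?ler0n //.
  have := mulr_ge0 d0 (f0 set0); lra.
have [N] := ubnP #|O|; elim: N O dD => // N IH O dD ltN.
have [->|/set0Pn[o oO]] := eqVneq O set0.
  rewrite (eq_bigr (fun=> f set0)); last by move=> x _; rewrite set0D.
  by rewrite sumr_const subrr mulr0 subr0 mulr_natl.
have {}IH := IH (O :\ o).
have {IH} IH : #|K|%:R * (f (O :\ o) - d * (f (O :\ o) - f set0)) <=
    \sum_x f (O :\ o :\: D x).
  apply: IH => [o' /setD1P[_ /dD] //|].
  by move: ltN; rewrite (cardsD1 o O) oO.
pose mu := f O - f (O :\ o).
have mu0 : 0 <= mu by rewrite subr_ge0; apply: fm; apply: subsetDl.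
have step x : f (O :\ o :\: D x) + (o \notin D x)%:R * mu <= f (O :\: D x).
  case: (boolP (o \in D x)) => /= oD.
    rewrite mul0r addr0; apply: fm; apply: setSD; exact: subsetDl.
  have -> : O :\: D x = o |: (O :\ o :\: D x).
    apply/setP => z; rewrite !inE; case: eqVneq => [->|_] //=.
    by rewrite oD oO.
  have sub : O :\ o :\: D x \subset O :\ o by apply: subsetDl.
  have nO : o \notin O :\ o by rewrite !inE eqxx.
  have := marginal_le sub nO; rewrite setD1K // -/mu mul1r; lra.
apply: le_trans (ler_sum _ (fun x _ => step x)).
rewrite big_split /= -mulr_suml.
have cN : #|K|%:R * (1 - d) <= \sum_x (o \notin D x)%:R :> R.
  have -> : \sum_x (o \notin D x)%:R = #|K|%:R - #|[set x | o \in D x]|%:R :> R.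
    rewrite -natr_sum -natrB ?max_card //; congr (_%:R).
    have -> : #|K| = \sum_(x : K) 1 by rewrite sum1_card.
    rewrite -sum1dep_card [X in (_ - X)%N]big_mkcond /= -sumnB; last first.
      by move=> x _; case: ifP.
    by apply: eq_bigr => x _; case: ifP.
  have := dD o oO; lra.
have := ler_wpM2r mu0 cN.
have -> : #|K|%:R * (f O - d * (f O - f set0)) =
  #|K|%:R * (f (O :\ o) - d * (f (O :\ o) - f set0)) + #|K|%:R * (1 - d) * mu.
  by rewrite /mu; ring.
by move=> ?; apply: lerD.
Qed.

(* [idx] is an insertion order: the weight of [d] is its marginal value over
   the part of [A] that precedes it. *)
Variable s : seq 'I_n.
Definition weight A d : R :=
  f [set e in A | (index e s <= index d s)%N] -
  f [set e in A | (index e s < index d s)%N].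

Lemma weight_ge0 A d : 0 <= weight A d.
Proof.
rewrite subr_ge0; apply: fm; apply/subsetP => e; rewrite !inE => /andP[-> /= /ltnW].
by [].
Qed.

Let pref A t := [set e in A | (index e s < t)%N].

Let pref_step A t : {subset A <= s} ->
  pref A t.+1 = pref A t \/
  exists d, [/\ d \in A, d \notin pref A t, pref A t.+1 = d |: pref A t
    & weight A d = f (pref A t.+1) - f (pref A t)].
Proof.
move=> sA; have [d /andP[dA /eqP dt]|no] := pickP [pred d in A | index d s == t].
  right; exists d; split=> //.
  - by rewrite inE dA dt ltnn.
  - apply/setP => e; rewrite !inE ltnS leq_eqVlt.
    case: (eqVneq e d) => [->|ne] /=; first by rewrite dA dt eqxx.
    case eA: (e \in A) => //=; case: eqP => //= et; case/eqP: ne.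
    by rewrite -(nth_index e (sA _ eA)) et -dt nth_index ?sA.
  by rewrite /weight /pref dt.
left; apply/setP => e; rewrite !inE ltnS leq_eqVlt.
by have := no e => /=; case: (e \in A) => //= ->.
Qed.

Let prefT A : {subset A <= s} -> pref A (size s) = A.
Proof.
move=> sA; apply/setP => e; rewrite !inE; case eA: (e \in A) => //=.
by rewrite index_mem sA.
Qed.

Let pref0 A : pref A 0 = set0.
Proof. by apply/setP => e; rewrite !inE andbF. Qed.

Lemma sum_weight A : {subset A <= s} -> \sum_(d in A) weight A d = f A - f set0.
Proof.
move=> sA; rewrite -{1 3}(prefT sA).
elim: (size s) => [|t IH]; first by rewrite pref0 big_set0 subrr.
case: (pref_step t sA) => [->//|[d [dA dt]]].
by move=> e wd; rewrite e big_setU1 //= IH wd e; ring.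
Qed.

(** Along the insertion order, the loss caused by deleting [D] from a prefix grows only at elements
    of [D], and there by their weight: at a kept element it cannot grow, the marginal over the full
    prefix being at most the one over the reduced prefix. *)
Lemma removal_le_weight A D : {subset A <= s} ->
  f A - f (A :\: D) <= \sum_(d in A :&: D) weight A d.
Proof.
move=> sA; rewrite -{1 2 3}(prefT sA).
elim: (size s) => [|t IH].
  by rewrite pref0 set0D set0I big_set0 subrr.
case: (pref_step t sA) => [->//|[d [dA dt e wd]]].
case dD: (d \in D).
  have -> : (pref A t.+1) :\: D = pref A t :\: D.
    by rewrite e; apply/setP => z; rewrite !inE; case: eqVneq => [->|_] //=; rewrite dD.
  have -> : pref A t.+1 :&: D = d |: (pref A t :&: D).
    by rewrite e; apply/setP => z; rewrite !inE; case: eqVneq => [->|_] //=; rewrite dD.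
  rewrite big_setU1 /=; last by rewrite inE (negPf dt).
  by rewrite wd; lra.
have -> : pref A t.+1 :&: D = pref A t :&: D.
  by rewrite e; apply/setP => z; rewrite !inE; case: eqVneq => [->|_] //=; rewrite dD andbF.
have -> : (pref A t.+1) :\: D = d |: (pref A t :\: D).
  by rewrite e; apply/setP => z; rewrite !inE; case: eqVneq => [->|_] //=; rewrite dD.
have := marginal_le (subsetDl (pref A t) D) dt; rewrite -e; lra.
Qed.

End Submodular.

(** * Gains of exchanges *)

Section Exchange.
Context {R : realType} {n : nat}.
Variable I : instance R n.
Implicit Types (A O : {set 'I_n}) (st : seq 'I_n * seq 'I_n).

Definition part A (i : 'I_(nmat I)) := A :&: ground (mat i).

(* In a state [(h, S)], [S] is the current solution and [h] lists the items ever
   added to it by order of arrival. *)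
Definition sol st : {set 'I_n} := [set e in st.2].
Definition solval st : R := val_f I (sol st).
(** The order is that of the history, so an item that left the solution and is drawn again resumes
    its old position. *)
Definition wt st (d : 'I_n) : R := weight (val_f I) st.1 (sol st) d.

Definition cands st i e :=
  [seq d <- st.2 | (d \in ground (mat i)) &&
     (e |: part (sol st) i :\ d \in indep (mat i))].

Definition argmin_step (w : 'I_n -> R) (a : 'I_n * R) d :=
  if w d < a.2 then (d, w d) else a.

(* [e] itself when [e] is a loop; [solval st + 1] exceeds all weights. *)
Definition dmin st i e :=
  (foldl (argmin_step (wt st)) (e, solval st + 1) (cands st i e)).1.

Definition dels st e : seq 'I_n :=
  flatten [seq if e |: part (sol st) i \in indep (mat i) then [::]
               else [:: dmin st i e]
          | i <- enum 'I_(nmat I) & e \in ground (mat i)].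

Definition commit st e : seq 'I_n := [seq s <- rcons st.2 e | s \notin dels st e].

Definition gain st e : R := val_f I [set s in commit st e] - solval st.

Record valid st : Prop := Valid {
  valid_hist : uniq st.1;
  valid_sol : uniq st.2;
  valid_sub : {subset st.2 <= st.1};
  valid_feas : feasible I (sol st)
}.

Lemma foldl_argmin w a l :
  let a' := foldl (argmin_step w) a l in
  [/\ a'.2 <= a.2, forall d, d \in l -> a'.2 <= w d
    & a' = a \/ (a'.1 \in l /\ a'.2 = w a'.1)].
Proof.
elim: l a => [|d l IH] a /=; first by split=> //; left.
have [le1 le2 alt] := IH (argmin_step w a d).
have s1 : (argmin_step w a d).2 <= a.2 by rewrite /argmin_step; case: ltP => //= /ltW.
have s2 : (argmin_step w a d).2 <= w d by rewrite /argmin_step; case: ltP.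
split; first exact: le_trans le1 s1.
  by move=> d'; rewrite inE => /predU1P[->|/le2 //]; exact: le_trans le1 s2.
case: alt => [->|[a'l aw]]; last by right; rewrite inE a'l orbT.
rewrite /argmin_step; case: ifP => _; last by left.
by right; rewrite /= inE eqxx.
Qed.

Hypotheses (f0 : nonnegative (val_f I)) (fm : monotone (val_f I))
  (fs : submodular (val_f I)).

Lemma wt_ge0 st d : 0 <= wt st d.
Proof. exact: weight_ge0. Qed.

Lemma sum_wt_le st : valid st -> \sum_(d in sol st) wt st d <= solval st.
Proof.
move=> v; rewrite sum_weight; last by move=> d; rewrite inE; exact: valid_sub.
by have := f0 set0; rewrite /solval; lra.
Qed.

Lemma wt_lt st d : valid st -> d \in sol st -> wt st d < solval st + 1.
Proof.
move=> v dS; have := sum_wt_le v; rewrite (big_setD1 d) //=.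
have : 0 <= \sum_(i in sol st :\ d) wt st i by apply: sumr_ge0 => *; exact: wt_ge0.
lra.
Qed.

Lemma dminP st i e : valid st -> cands st i e != [::] ->
  dmin st i e \in cands st i e /\
  forall d, d \in cands st i e -> wt st (dmin st i e) <= wt st d.
Proof.
move=> v; rewrite /dmin.
have := foldl_argmin (wt st) (e, solval st + 1) (cands st i e) => /=.
set a := foldl _ _ _ => -[_ amin [ea|[al aw]] ne]; last by rewrite -aw.
rewrite ea /= in amin; case ec : (cands st i e) ne amin => [//|d c] _ /(_ d); rewrite inE eqxx /= => /(_ isT).
have : d \in cands st i e by rewrite ec inE eqxx.
rewrite mem_filter => /andP[_ dS].
have := @wt_lt st d v; rewrite inE => /(_ dS); lra.
Qed.

Lemma dmin_loop st i e : cands st i e = [::] -> dmin st i e = e.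
Proof. by rewrite /dmin => ->. Qed.

Lemma mem_dels st e d : d \in dels st e ->
  exists i, [/\ e \in ground (mat i), e |: part (sol st) i \notin indep (mat i)
    & d = dmin st i e].
Proof.
case/flattenP => l /mapP[i]; rewrite mem_filter => /andP[ei _] ->.
by case: ifPn => // dep; rewrite inE => /eqP ->; exists i.
Qed.

Lemma dels_mem st e i : e \in ground (mat i) ->
  e |: part (sol st) i \notin indep (mat i) -> dmin st i e \in dels st e.
Proof.
move=> ei dep; apply/flattenP; exists [:: dmin st i e]; rewrite ?inE //.
apply/mapP; exists i; first by rewrite mem_filter ei mem_enum.
by rewrite (negPf dep).
Qed.

Lemma mem_commit st e d :
  (d \in commit st e) = (d \notin dels st e) && ((d == e) || (d \in st.2)).
Proof. by rewrite mem_filter mem_rcons inE. Qed.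

Lemma commit_uniq st e : valid st -> e \notin st.2 -> uniq (commit st e).
Proof. by move=> v eS; rewrite filter_uniq // rcons_uniq eS valid_sol. Qed.

(** In each matroid violated by [e], either some exchange is possible and [dmin] performs one, or
    [dmin] is [e] itself, which then stays out. *)
Lemma commit_feasible st e : valid st -> feasible I [set d in commit st e].
Proof.
move=> v; apply/forallP => i; have Ai := forallP (valid_feas v) i.
have sub : [set d in commit st e] :&: ground (mat i) \subset e |: part (sol st) i.
  apply/subsetP => d; rewrite !inE mem_commit => /andP[/andP[_ /orP[->//|dS]] di].
  by rewrite dS di orbT.
have [ei|ei] := boolP (e \in ground (mat i)); last first.
  apply: indep_sub Ai; apply/subsetP => d dc; move: (subsetP sub _ dc).
  rewrite inE in_set1 => /orP[/eqP de|//].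
  by move: dc; rewrite inE de (negPf ei) andbF.
have [ind|dep] := boolP (e |: part (sol st) i \in indep (mat i)).
  exact: indep_sub sub ind.
have dD := dels_mem ei dep.
have nD : dmin st i e \notin [set d in commit st e] :&: ground (mat i).
  by rewrite !inE mem_commit dD.
have [c0|cN] := eqVneq (cands st i e) [::].
  apply: indep_sub Ai; apply/subsetP => d dc; move: (subsetP sub _ dc).
  rewrite inE in_set1 => /orP[/eqP de|//].
  by case/negP: nD; rewrite (dmin_loop c0) -{1}de.
have [] := dminP v cN; rewrite mem_filter => /andP[/andP[_ ind] _] _.
apply: indep_sub ind; apply/subsetP => d dc.
have dd : d != dmin st i e by apply: contraNneq nD => <-.
have := subsetP sub _ dc; rewrite !inE dd.
by case: (d == e).
Qed.

Lemma dels_sub st e : valid st -> (forall i : 'I_(nmat I), e \in ground (mat i) ->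
  [set e] \in indep (mat i)) -> {subset dels st e <= st.2}.
Proof.
move=> v nl d /mem_dels[i [ei dep ->]].
have Ai := forallP (valid_feas v) i.
have e0 : e |: set0 \in indep (mat i) by rewrite setU0 nl.
have [d' d'A ind] := exchange_within Ai e0 (sub0set _) dep.
have cN : cands st i e != [::].
  apply/eqP => c0; have : d' \in cands st i e; last by rewrite c0.
  by rewrite mem_filter ind andbT; move: d'A; rewrite !inE => /and3P[_ -> ->].
by have [] := dminP v cN; rewrite mem_filter => /andP[].
Qed.

(** Applied to [dels], where an element removed on behalf of several matroids is repeated and so
    charged once for each of them. *)
Lemma sum_set_le_seq (w : 'I_n -> R) A l : (forall d, 0 <= w d) ->
  \sum_(d in A :&: [set d in l]) w d <= \sum_(d <- l) w d.
Proof.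
move=> w0; elim: l => [|d l IH].
  by rewrite big_nil big1 // => d; rewrite !inE andbF.
rewrite big_cons; apply: le_trans (_ : w d + \sum_(d in A :&: [set d in l]) w d <= _);
  last by rewrite lerD2l.
rewrite (bigID (pred1 d)) /= lerD //.
  have [dA|dA] := boolP (d \in A).
    by rewrite (big_pred1 d) // => z /=; rewrite !inE; case: eqVneq => [->|]; rewrite ?dA ?andbF.
  rewrite big_pred0 // => z; rewrite !inE; case: eqVneq => [->|]; rewrite ?(negPf dA) ?andbF //.
rewrite big_mkcond [leRHS]big_mkcond /=; apply: ler_sum => z _; rewrite !inE.
by case: (z \in A); case: (z == d); case: (z \in l) => //=.
Qed.

Lemma gain_ge st o : valid st -> (forall i : 'I_(nmat I), o \in ground (mat i) ->
  [set o] \in indep (mat i)) ->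
  val_f I (o |: sol st) - solval st - \sum_(d in sol st :&: [set d in dels st o]) wt st d
    <= gain st o.
Proof.
move=> v nl; have Dsub := dels_sub v nl.
have [oS|oS] := boolP (o \in sol st).
  have nD : dels st o = [::].
    case eD : (dels st o) => [//|d l].
    have /mem_dels[i [oi /negP[]]] : d \in dels st o by rewrite eD inE eqxx.
    have -> : o |: part (sol st) i = part (sol st) i.
      by apply/setUidPr; rewrite sub1set inE oS.
    exact: (forallP (valid_feas v) i).
  rewrite /gain (setUidPr _) ?sub1set // nD.
  have -> : [set s in commit st o] = sol st.
    apply/setP => d; rewrite !inE mem_commit nD /=; case: eqVneq => //= ->.
    by move: oS; rewrite inE => ->.
  by rewrite big1 ?subrr ?subr0 // => d; rewrite !inE andbF.
have oD : o \notin dels st o by apply: contraNN oS => /Dsub; rewrite inE.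
have -> : gain st o = val_f I (o |: (sol st :\: [set d in dels st o])) - solval st.
  rewrite /gain; congr (val_f I _ - _); apply/setP => d; rewrite !inE mem_commit.
  by case: eqVneq => [->|_] //=; rewrite oD.
have sD : {subset sol st <= st.1} by move=> d; rewrite inE; exact: valid_sub.
have := removal_le_weight fs [set d in dels st o] sD.
have := marginal_le fs (subsetDl (sol st) [set d in dels st o]) oS.
rewrite /solval /wt; lra.
Qed.

(** Compare level sets. If more items of [O] had removal weight at least [t] than there are solution
    elements of weight at least [t], one of these items would augment those heavy elements;
    [exchange_within] then exchanges it against an element lighter than [t], contradicting the
    choice of [dmin]. *)
Lemma sum_dmin_le st i O : valid st -> O :&: ground (mat i) \in indep (mat i) ->
  \sum_(o in O | (o \in ground (mat i)) && (o |: part (sol st) i \notin indep (mat i)))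
     wt st (dmin st i o) <= \sum_(s in part (sol st) i) wt st s.
Proof.
move=> v Oi; have Ai := forallP (valid_feas v) i.
pose O' := [set o in O | (o \in ground (mat i)) &&
  (o |: part (sol st) i \notin indep (mat i))].
rewrite (eq_bigl (mem O')); last by move=> o; rewrite !inE.
apply: sum_le_of_level_counts => [s _|t]; first exact: wt_ge0.
set Ot := [set o in O' | _]; set St := [set s in _ | _].
rewrite leqNgt; apply/negP => lt.
have StA : St \subset part (sol st) i by apply/subsetP => s; rewrite inE => /andP[].
have Sti : St \in indep (mat i) by apply: indep_sub Ai.
have Oti : Ot \in indep (mat i).
  by apply: indep_sub Oi; apply/subsetP => o; rewrite !inE => /andP[/and3P[-> ->]].
have [o /setDP[]] := indep_augment Sti Oti lt.
rewrite !inE => /andP[/and3P[oO oi dep] to] _ ind.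
have [d dA ex] := exchange_within Ai ind StA dep.
have dc : d \in cands st i o.
  by rewrite mem_filter ex andbT; move: dA; rewrite !inE => /and3P[_ -> ->].
have cN : cands st i o != [::] by apply: contraTneq dc => ->.
have [_ /(_ d dc) le] := dminP v cN.
move: dA; rewrite !inE => /and3P[+ dS di]; rewrite dS di /= -ltNge => lt2.
by have := lt_le_trans lt2 (le_trans to le); rewrite ltxx.
Qed.

(** The total weight [X] removed is bounded in two ways. A single item removes distinct elements of
    the solution, so at most [solval st]. The removals due to one matroid weigh at most the part of
    the solution in its ground set, and an element lies in at most [p] ground sets. *)
Lemma sum_gain_ge p st O : is_matchoid p I -> valid st -> feasible I O ->
  val_f I O - (minn p #|O|).+1%:R * solval st <= \sum_(o in O) gain st o.
Proof.
move=> mp v Of.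
have nl o (i : 'I_(nmat I)) : o \in O -> o \in ground (mat i) -> [set o] \in indep (mat i).
  move=> oO oi; apply: indep_sub (forallP Of i).
  by rewrite sub1set inE oO.
have v0 : 0 <= solval st by exact: f0.
pose X := \sum_(o in O) \sum_(d in sol st :&: [set d in dels st o]) wt st d.
have X1 : X <= #|O|%:R * solval st.
  rewrite mulr_natl -sumr_const; apply: ler_sum => o _.
  apply: le_trans (sum_wt_le v); rewrite [leRHS](bigID (mem [set d in dels st o])) /=.
  rewrite (eq_bigl (fun d => (d \in sol st) && (d \in [set d in dels st o]))); last first.
    by move=> d; rewrite in_setI.
  by rewrite lerDl; apply: sumr_ge0 => *; exact: wt_ge0.
have X2 : X <= p%:R * solval st.
  apply: le_trans (_ : \sum_i \sum_(s in part (sol st) i) wt st s <= _).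
    apply: le_trans (_ : \sum_i \sum_(o in O | (o \in ground (mat i)) &&
      (o |: part (sol st) i \notin indep (mat i))) wt st (dmin st i o) <= _);
      last by apply: ler_sum => i _; apply: sum_dmin_le => //; exact: (forallP Of i).
    rewrite (exchange_big_dep (mem O)) /=; last by move=> i o _ /andP[].
    apply: ler_sum => o oO; apply: le_trans (sum_set_le_seq _ _ _) _.
      by move=> d; exact: wt_ge0.
    rewrite big_flatten big_map big_filter big_enum_cond /= big_mkcond /=.
    rewrite [leRHS]big_mkcond /= le_eqVlt; apply/orP; left; apply/eqP.
    apply: eq_bigr => i _; rewrite oO /=; case: (o \in ground _) => //=.
    by case: ifP => _; rewrite ?big_nil ?big_seq1.
  rewrite (eq_bigr (fun i => \sum_(s in sol st | s \in ground (mat i)) wt st s)); last first.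
    by move=> i _; apply: eq_bigl => s; rewrite inE.
  rewrite (exchange_big_dep (mem (sol st))) /=; last by move=> i o _ /andP[].
  apply: le_trans (_ : \sum_(s in sol st) p%:R * wt st s <= _); last first.
    by rewrite -mulr_sumr ler_wpM2l ?ler0n // sum_wt_le.
  apply: ler_sum => s sS; rewrite (eq_bigl (fun i => i \in [set i | s \in ground (mat i)])).
    by rewrite sumr_const -[leLHS]mulr_natl ler_wpM2r ?wt_ge0 // ler_nat mp.
  by move=> i; rewrite inE sS.
have X3 : X <= (minn p #|O|)%:R * solval st by rewrite /minn; case: ifP.
have Y : \sum_(o in O) (val_f I (o |: sol st) - solval st) - X <= \sum_(o in O) gain st o.
  rewrite /X -sumrB; apply: ler_sum => o oO.
  by apply: gain_ge => // i; exact: nl.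
have Z := sum_marginal_ge fm fs O (sol st).
have W : val_f I O <= val_f I (sol st :|: O) by apply: fm; exact: subsetUr.
rewrite -natr1 mulrDl mul1r; move: Y Z W X3; rewrite /solval; lra.
Qed.

End Exchange.

(** * Selection in windows *)

Section Scan.
Context {R : realType} {T : eqType}.
Implicit Types (g : T -> R) (l : seq T) (a : R * seq T).

(* [a.1] is the current threshold and [a.2] the items taken, latest first; only
   the first item taken may tie with the threshold. *)
Definition scan_step g (post : bool) a e : R * seq T :=
  if a.1 < g e then (g e, if post then e :: a.2 else a.2)
  else if [&& post, nilp a.2 & a.1 <= g e] then (g e, e :: a.2)
  else a.

Definition scan g b l0 l1 :=
  foldl (scan_step g true) (foldl (scan_step g false) (b, [::]) l0) l1.

Lemma scan_initP g b l0 : let a := foldl (scan_step g false) (b, [::]) l0 in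
  [/\ a.2 = [::], b <= a.1, forall e, e \in l0 -> g e <= a.1
    & a.1 = b \/ exists2 e, e \in l0 & a.1 = g e].
Proof.
elim/last_ind: l0 => [|l e IH] /=; first by split=> //; left.
rewrite foldl_rcons; move: IH; set a := foldl _ _ _ => -[a2 ba ga ex].
rewrite /scan_step; case: ltP => ae /=; split=> //.
- exact: le_trans ba (ltW ae).
- move=> e'; rewrite mem_rcons inE => /predU1P[->//|/ga le].
  exact: le_trans le (ltW ae).
- by right; exists e; rewrite ?mem_rcons ?inE ?eqxx.
- by move=> e'; rewrite mem_rcons inE => /predU1P[->//|/ga].
- by case: ex => [->|[e' e'l ->]]; [left|right; exists e'; rewrite // mem_rcons inE e'l orbT].
Qed.

(** The third clause identifies the last item taken with the winner of the window. The fourth makes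
    every item taken, with at most one exception [s0], a record in the order of arrival; this bounds
    the number of items taken. *)
Lemma scanP g b l0 l1 (t : T -> nat) :
  pairwise (fun e e' => (t e < t e')%N) l1 ->
  let thr := (foldl (scan_step g false) (b, [::]) l0).1 in
  let a := scan g b l0 l1 in
  [/\ uniq a.2, {subset a.2 <= l1},
      if a.2 is s :: _ then
        [/\ thr <= g s, a.1 = g s & forall e, e \in l1 -> e != s ->
            g e < g s \/ (g e = g s /\ (t s < t e)%N)]
      else a.1 = thr /\ forall e, e \in l1 -> g e < thr
    & exists s0, forall s, s \in a.2 -> Some s != s0 ->
        (forall e, e \in l0 -> g e < g s) /\
        forall e, e \in l1 -> e != s -> g s <= g e -> (t s < t e)%N].
Proof.
rewrite /scan; case: (scan_initP g b l0); set a0 := foldl _ _ l0.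
move=> a02 _ l0_le _; elim/last_ind: l1 => [|l e IH] /=.
  by rewrite a02 => _; split=> //; exists None.
rewrite pairwise_rcons => /andP[/allP lt /IH].
rewrite foldl_rcons; set a := foldl _ a0 l => -[ua sa wa [s0 ta]].
have el : e \notin l by apply/negP => /lt; rewrite ltnn.
have lt1 d : d \in rcons l e -> d != e -> d \in l.
  by rewrite mem_rcons inE => /predU1P[->|//]; rewrite eqxx.
have sub : {subset a.2 <= rcons l e}.
  by move=> d /sa dl; rewrite mem_rcons inE dl orbT.
have thr_le : a0.1 <= a.1.
  by case: (a.2) wa => [|s c] [] => [-> _|le -> _].
have max_le d : d \in l -> g d <= a.1.
  move=> dl; case: (a.2) wa => [|s c] [] => [-> /(_ _ dl) /ltW //|_ -> /(_ _ dl)].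
  by case: eqVneq => [->//|_] /(_ isT) [/ltW //|[-> _]].
have old s : s \in a.2 -> Some s != s0 ->
    (forall e, e \in l0 -> g e < g s) /\
    forall d, d \in rcons l e -> d != s -> g s <= g d -> (t s < t d)%N.
  move=> sr ss0; have [thrs ts] := ta s sr ss0; split=> // d.
  by rewrite mem_rcons inE => /predU1P[-> es _|]; [apply: lt; apply: sa|exact: ts].
rewrite /scan_step; case: ltP => ae /=.
  have big d : d \in l -> g d < g e by move=> /max_le le; exact: le_lt_trans le ae.
  split=> /=.
  - by rewrite ua andbT; apply: contraNN el => /sa.
  - by move=> d; rewrite inE => /predU1P[->|/sub //]; rewrite mem_rcons inE eqxx.
  - split=> //; first exact: le_trans thr_le (ltW ae).
    by move=> d dl de; left; apply: big; apply: lt1.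
  exists s0 => s; rewrite inE => /predU1P[-> _|]; last exact: old.
  split=> [d /l0_le le|d dl de]; first exact: le_lt_trans (le_trans le thr_le) ae.
  by rewrite leNgt big // lt1.
case: ifP => [/andP[/nilP an ae']|ntk].
  have ge : g e = a.1 by apply/eqP; rewrite eq_le ae ae'.
  rewrite an in wa *; case: wa => wa1 wa2; split=> //=.
  - by move=> d; rewrite inE => /eqP->; rewrite mem_rcons inE eqxx.
  - split=> //; first by rewrite ge wa1.
    by move=> d dl de; left; rewrite ge wa1; apply: wa2; apply: lt1.
  by exists (Some e) => s; rewrite inE => /eqP ->; rewrite eqxx.
split=> //; last by exists s0.
case E: (a.2) wa => [|s c] /= [] => [a1 wa2|le e1 wa2]; split=> //.
  move=> d; rewrite mem_rcons inE => /predU1P[->|]; last exact: wa2.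
  by move: ntk; rewrite E /= => /negbT; rewrite -ltNge a1.
move=> d; rewrite mem_rcons inE => /predU1P[->|]; last exact: wa2.
move=> es; move: ae; rewrite e1 le_eqVlt => /predU1P[->|]; last by left.
by right; split=> //; apply: lt; apply: sa; rewrite E inE eqxx.
Qed.

End Scan.

(** * The run of the algorithm for given windows and draws *)

Section Run.
Context {R : realType} {n : nat}.
Variable I : instance R n.
Implicit Types (st : seq 'I_n * seq 'I_n) (l : nat -> seq 'I_n) (r : nat -> nat).

Definition rpick st j : option 'I_n :=
  if onth st.1 j is Some e then if 0 < gain I st e then Some e else None else None.

Definition base st j : R := if rpick st j is Some e then gain I st e else 0.

Definition next_state st j (taken : option 'I_n) :=
  if taken is Some e then (rcons st.1 e, commit I st e)
  else if rpick st j is Some e then (st.1, commit I st e) else st.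

Definition takes st j (l0 l1 : seq 'I_n) : seq 'I_n := (scan (gain I st) (base st j) l0 l1).2.

Fixpoint run l0 l1 r w :=
  if w is w'.+1 then
    let st := run l0 l1 r w' in
    next_state st (r w') (ohead (takes st (r w') (l0 w') (l1 w')))
  else ([::], [::]).

Definition takes_at l0 l1 r w := takes (run l0 l1 r w) (r w) (l0 w) (l1 w).

Lemma eq_run l0 l1 r l0' l1' r' w :
  (forall v, (v < w)%N -> [/\ l0 v = l0' v, l1 v = l1' v & r v = r' v]) ->
  run l0 l1 r w = run l0' l1' r' w.
Proof.
elim: w => //= w IH e; have [-> -> ->] := e w (ltnSn _).
by rewrite IH // => v vw; apply: e; rewrite ltnW.
Qed.

Lemma rpickP st j e : rpick st j = Some e -> e \in st.1 /\ 0 < gain I st e.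
Proof.
rewrite /rpick; case E: (onth _ _) => [d|//]; case: ifP => // g0 [<-]; split=> //.
by apply/onthP; exists j.
Qed.

Lemma base_ge0 st j : 0 <= base st j.
Proof. by rewrite /base; case E: (rpick _ _) => [e|//]; have [_ /ltW] := rpickP E. Qed.

Lemma base_ge st j e : onth st.1 j = Some e -> gain I st e <= base st j.
Proof. by rewrite /base /rpick => ->; case: ifP => // /negbT; rewrite -leNgt. Qed.

Lemma val_next st j tk : solval I (next_state st j tk) =
  solval I st + (if tk is Some e then gain I st e else base st j).
Proof.
rewrite /next_state /base; case: tk => [e|]; first by rewrite /gain /solval /sol addrC subrK.
by case: rpick => [e|]; rewrite ?addr0 // /gain /solval /sol addrC subrK.
Qed.

Lemma valid0 : valid I ([::], [::]).
Proof.
split=> //; apply/forallP => i; have -> : sol ([::], [::]) = set0 :> {set 'I_n}.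
  by apply/setP => e; rewrite !inE.
by rewrite set0I indep_set0.
Qed.

Lemma gain_eq0 st e : valid I st -> e \in st.2 -> gain I st e = 0.
Proof.
move=> v eS; have nD : dels I st e = [::].
  case eD : (dels I st e) => [//|d l].
  have /mem_dels[i [ei /negP[]]] : d \in dels I st e by rewrite eD inE eqxx.
  have -> : e |: part (sol st) i = part (sol st) i.
    by apply/setUidPr; rewrite sub1set !inE eS.
  exact: (forallP (valid_feas v) i).
rewrite /gain /solval; have -> : [set s in commit I st e] = sol st; last by rewrite subrr.
by apply/setP => d; rewrite !inE mem_commit nD /=; case: eqVneq => // ->; rewrite eS.
Qed.

Hypotheses (f0 : nonnegative (val_f I)) (fm : monotone (val_f I)).

Lemma valid_next st j tk : valid I st -> (forall e, tk = Some e -> e \notin st.1) ->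
  valid I (next_state st j tk).
Proof.
move=> v ntk; rewrite /next_state; case: tk ntk => [e /(_ e erefl) ne|_].
  have nS : e \notin st.2 by apply: contraNN ne => /(valid_sub v).
  split=> /=; first by rewrite rcons_uniq ne (valid_hist v).
  - exact: commit_uniq v _.
  - move=> d; rewrite mem_commit mem_rcons inE => /andP[_ /orP[->//|/(valid_sub v) ->]].
    by rewrite orbT.
  - by have := commit_feasible f0 fm e v; rewrite /sol /=.
case E: rpick => [e|//]; have [eR ge] := rpickP E.
have nS : e \notin st.2 by apply/negP => /(gain_eq0 v) e0; rewrite e0 ltxx in ge.
split=> /=; first exact: (valid_hist v).
- exact: commit_uniq v _.
- by move=> d; rewrite mem_commit => /andP[_ /orP[/eqP->//|/(valid_sub v)]].
- by have := commit_feasible f0 fm e v; rewrite /sol /=.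
Qed.

Lemma mem_hist_next st j tk : (next_state st j tk).1 =
  if tk is Some e then rcons st.1 e else st.1.
Proof. by case: tk => //; rewrite /next_state; case: rpick. Qed.

End Run.

Section BestWithin.
Context {R : realType} {n : nat}.
Variable I : instance R n.
Hypothesis f0 : nonnegative (val_f I).
Implicit Types (A B S O : {set 'I_n}).

Lemma best_within_ge A S : S \subset A -> feasible I S -> val_f I S <= best_within I A.
Proof. by move=> sSA Sf; rewrite /best_within (bigD1 S) ?sSA //= le_max lexx. Qed.

Lemma best_within_ge0 A : 0 <= best_within I A.
Proof. by rewrite /best_within; elim/big_rec: _ => // S x _ x0; rewrite le_max x0 orbT. Qed.

Lemma feasible0 : feasible I set0.
Proof. by apply/forallP => i; rewrite set0I indep_set0. Qed.

Lemma OPT_attained : exists2 O, feasible I O & val_f I O = OPT I.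
Proof.
have [O Of Omax] : exists2 O, feasible I O & forall S, feasible I S -> val_f I S <= val_f I O.
  have := @arg_maxP _ _ _ set0 (feasible I) (val_f I) feasible0.
  by case=> O Of Om; exists O.
exists O => //; apply/eqP; rewrite eq_le best_within_ge ?subsetT //= /OPT /best_within.
elim/big_rec: _ => // S x /andP[_ Sf] xO.
by rewrite ge_max xO Omax.
Qed.

Lemma feasible_sub A B : A \subset B -> feasible I B -> feasible I A.
Proof.
move=> sAB /forallP Bf; apply/forallP => i; apply: indep_sub (Bf i).
exact: setSI.
Qed.

Lemma feasible_card S : feasible I S -> (#|S| <= max_feasible_size I)%N.
Proof. by move=> Sf; apply: leq_bigmax_cond. Qed.

End BestWithin.

(** * Classes of histories *)

Section Coordinates.
Context {T K : finType}.
Implicit Types (y : {ffun T -> K}) (A : T -> {set K}).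

Definition upd y e a : {ffun T -> K} := [ffun z => if z == e then a else y z].

Lemma updE y e a z : upd y e a z = if z == e then a else y z.
Proof. by rewrite ffunE. Qed.

Lemma upd_upd y e a b : upd (upd y e a) e b = upd y e b.
Proof. by apply/ffunP => z; rewrite !ffunE; case: eqP. Qed.

Lemma upd_id y e : upd y e (y e) = y.
Proof. by apply/ffunP => z; rewrite !ffunE; case: eqP => // ->. Qed.

Definition fam A : {set {ffun T -> K}} :=
  [set y : {ffun T -> K} | [forall e, y e \in A e]].

Lemma famP A y : reflect (forall e, y e \in A e) (y \in fam A).
Proof. by rewrite inE; exact: forallP. Qed.

(** Swapping the coordinate at [e] with the extra value [a] is an involution: on a product set one
    coordinate can be resampled. *)
Lemma sum_fam_swap (V : nmodType) A e (F : {ffun T -> K} -> K -> V) :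
  \sum_(y in fam A) \sum_(a in A e) F y a =
  \sum_(y in fam A) \sum_(a in A e) F (upd y e a) (y e).
Proof.
rewrite !pair_big /=.
pose h (p : {ffun T -> K} * K) := (upd p.1 e p.2, p.1 e).
have hK : involutive h by case=> y a; rewrite /h /= upd_upd upd_id updE eqxx.
rewrite (reindex_inj (inv_inj hK)) /=; apply: eq_bigl => -[y a] /=.
apply/andP/andP => -[/famP yA aA]; split=> //.
- by apply/famP => z; have := yA z; rewrite updE; case: eqVneq => // ->.
- by have := yA e; rewrite updE eqxx.
- by apply/famP => z; rewrite updE; case: eqVneq => // ->.
Qed.

Lemma sum_swap (V : nmodType) e (F : {ffun T -> K} -> K -> V) :
  \sum_y \sum_a F y a = \sum_y \sum_a F (upd y e a) (y e).
Proof.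
have := sum_fam_swap (fun=> setT) e F.
have E G : \sum_(y in fam (fun _ : T => [set: K])) \sum_(a in [set: K]) G y a =
    \sum_y \sum_a G y a :> V.
  apply: eq_big => [y|y _]; first by apply/famP => z; rewrite inE.
  by apply: eq_bigl => a; rewrite inE.
by rewrite (E F) (E (fun y a => F (upd y e a) (y e))).
Qed.

End Coordinates.

(** * The best item present in a window *)

Section FirstPresent.
Context {R : realType} {T K : finType}.
Variables (g : T -> R) (b : R) (Wp W0 : {set K}) (O : {pred T}) (N m : nat).
Hypotheses (b0 : 0 <= b) (N0 : (0 < N)%N) (m0 : (0 < m)%N).
Hypotheses (dW : [disjoint Wp & W0]) (cWp : #|Wp| = N.-1) (cW0 : #|W0| = 1%N).
Implicit Types (l : seq T) (y : {ffun T -> K}).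

(* The value obtained when the best item present in the window is selected, with
   nothing granted if it falls into the observation slot [W0]. *)
Fixpoint first_present l y : R :=
  if l is e :: l' then
    if y e \in Wp then Num.max (g e) b
    else if y e \in W0 then 0 else first_present l' y
  else b.

Let q : R := m%:R^-1.
Let pos (e : T) : R := Num.max (g e) 0.
(** The leading factor is the chance that no item of [O] is present if each is so independently with
    chance [q]; as a whole this is a lower bound shaped so as to survive the recursion on [l]. *)
Definition fp_bound l : R :=
  (1 - q) ^+ count O l * (b + q * \sum_(e <- l | e \in O) pos e).

Lemma first_present_upd e a l y : e \notin l ->
  first_present l (upd y e a) = first_present l y.
Proof.
elim: l => //= e' l IH; rewrite inE negb_or => /andP[ne /IH ->].
by rewrite updE eq_sym (negPf ne).
Qed.

Let q0 : 0 <= q. Proof. by rewrite invr_ge0 ler0n. Qed.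
Let q1 : q <= 1. Proof. by rewrite invf_le1 ?ltr0n // ler1n. Qed.

Let bern c : (1 - q) ^+ c * (1 + q * c%:R) <= 1.
Proof.
elim: c => [|c IH]; first by rewrite mulr0 addr0 mulr1.
apply: le_trans IH; rewrite exprSr -mulrA ler_wpM2l //.
  by apply: exprn_ge0; rewrite subr_ge0.
rewrite -natr1; have := mulr_ge0 (mulr_ge0 q0 q0) (ler0n R c).
have := mulr_ge0 q0 q0; nra.
Qed.

(** By [bern], the leading factor keeps the bound below the largest value on offer, so finding a
    better item present never hurts. *)
Let fp_bound_le e l : (forall d, d \in l -> g d <= g e) ->
  fp_bound l <= Num.max (g e) b.
Proof.
move=> le; set h := Num.max _ _.
have bh : b <= h by rewrite le_max lexx orbT.
have gh d : d \in l -> pos d <= h.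
  by move=> /le le'; rewrite ge_max (le_trans b0 bh) le_max le'.
have h0 : 0 <= h := le_trans b0 bh.
apply: le_trans (_ : (1 - q) ^+ count O l * ((1 + q * (count O l)%:R) * h) <= _).
  rewrite ler_wpM2l //; first by apply: exprn_ge0; rewrite subr_ge0.
  rewrite mulrDl mul1r lerD // -mulrA ler_wpM2l // -sum1_count natr_sum mulr_suml.
  rewrite big_seq_cond [leRHS]big_seq_cond; apply: ler_sum => d /andP[dl _].
  by rewrite mul1r gh.
by rewrite mulrA -[leRHS]mul1r ler_wpM2r // bern.
Qed.

(** The place of the first item is independent of the others, so averaging over it gives a convex
    combination of [Num.max (g e) b] and the value of the rest, less the share 1/N lost to [W0]. An
    item outside [O] can only raise the bound. For an item of [O] the first weight is at least 1/m:
    [N] of its at most [m * N] places are in the window. *)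
Lemma sum_first_present l (A : T -> {set K}) :
  uniq l -> sorted (fun e d => g d <= g e) l ->
  (forall e, e \in l -> Wp :|: W0 \subset A e /\ (#|A e| <= m * N)%N) ->
  #|fam A|%:R * ((1 - N%:R^-1) * fp_bound l) <= \sum_(y in fam A) first_present l y.
Proof.
elim: l => [|e l IH] /=.
  move=> _ _ _; rewrite sumr_const /fp_bound big_nil mulr0 addr0 mul1r.
  rewrite -[leRHS]mulr_natl ler_wpM2l ?ler0n // -[leRHS]mul1r ler_wpM2r //.
  by rewrite lerBlDr lerDl invr_ge0 ler0n.
case/andP=> el ul pl Al.
have gl d : d \in l -> g d <= g e.
  move: pl; rewrite path_sortedE; first by case/andP => /allP h _ /h.
  by move=> x z t; move=> h1 h2; exact: le_trans h2 h1.
have {IH} IH := IH ul (path_sorted pl) (fun d dl => Al d (@mem_behead _ (e :: l) _ dl)).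
have [sW cA] := Al e (mem_head _ _).
set h := Num.max (g e) b.
have bh : b <= h by rewrite le_max lexx orbT.
have h0 : 0 <= h := le_trans b0 bh.
have cW : #|Wp :|: W0| = N.
  move: dW; rewrite -setI_eq0 => /eqP dW0.
  by rewrite cardsU dW0 cards0 cWp cW0 subn0 addn1 prednK.
have A0 : (0 < #|A e|)%N by apply: leq_trans (subset_leq_card sW); rewrite cW.
have inner y : \sum_(a in A e) first_present (e :: l) (upd y e a) =
    (N.-1)%:R * h + (#|A e|%:R - N%:R) * first_present l y.
  rewrite (bigID (mem (Wp :|: W0))) /= (eq_bigl (mem (Wp :|: W0))); last first.
    by move=> a /=; case E: (a \in _ :|: _); rewrite ?andbF // (subsetP sW).
  congr (_ + _).
    rewrite (big_setID Wp) /= (setIidPr (subsetUl _ _)).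
    rewrite (eq_bigr (fun=> h)); last by move=> a aW; rewrite updE eqxx aW.
    rewrite sumr_const cWp mulr_natl big1 ?addr0 // => a; rewrite !inE updE eqxx.
    by case/andP => /negPf -> /= ->.
  rewrite (eq_bigr (fun=> first_present l y)); last first.
    move=> a; rewrite updE eqxx inE negb_or => /and3P[_ /negPf-> /negPf->].
    by rewrite first_present_upd.
  rewrite (eq_bigl (mem (A e :\: (Wp :|: W0)))); last by move=> a; rewrite !inE andbC.
  rewrite sumr_const cardsD (setIidPr sW) cW -[LHS]mulr_natl natrB //.
  by rewrite -cW subset_leq_card.
have eqA : #|A e|%:R * \sum_(y in fam A) first_present (e :: l) y =
    #|fam A|%:R * ((N.-1)%:R * h) +
    (#|A e|%:R - N%:R) * \sum_(y in fam A) first_present l y.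
  transitivity (\sum_(y in fam A) \sum_(a in A e) first_present (e :: l) y).
    by rewrite mulr_sumr; apply: eq_bigr => y _; rewrite sumr_const mulr_natl.
  rewrite sum_fam_swap (eq_bigr _ (fun y _ => inner y)) big_split /=.
  by rewrite sumr_const -[X in X + _]mulr_natl mulr_sumr.
rewrite -(ler_pM2l (_ : 0 < #|A e|%:R)) ?ltr0n // eqA.
set F := #|fam A|%:R in IH *; have F0 : 0 <= F by rewrite ler0n.
set a := #|A e|%:R in eqA *; set S := \sum_(y in fam A) first_present l y in IH *.
have aN : 0 <= a - N%:R by rewrite subr_ge0 ler_nat -cW subset_leq_card.
have amN : a * q <= N%:R.
  by rewrite /a /q ler_pdivrMr ?ltr0n // -natrM ler_nat mulnC.
have eN : (N.-1)%:R = (1 - N%:R^-1) * N%:R :> R.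
  by rewrite mulrBl mul1r mulVf ?pnatr_eq0 -?lt0n // -subn1 natrB.
have d0 : 0 <= 1 - N%:R^-1 :> R by rewrite subr_ge0 invf_le1 ?ltr0n // ler1n.
apply: le_trans (lerD (lexx _) (ler_wpM2l aN IH)).
rewrite eN; set d := 1 - N%:R^-1 in d0 *.
suff key : a * fp_bound (e :: l) <= N%:R * h + (a - N%:R) * fp_bound l.
  have := ler_wpM2l (mulr_ge0 F0 d0) key; lra.
have hN := fp_bound_le gl; rewrite -/h in hN.
have c0 : 0 <= (1 - q) ^+ count O l by apply: exprn_ge0; rewrite subr_ge0.
have [eO|eO] := boolP (e \in O); last first.
  have -> : fp_bound (e :: l) = fp_bound l.
    by rewrite /fp_bound /= big_cons (negPf eO) (_ : O e = false) //; apply/negbTE.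
  have : 0 <= N%:R * (h - fp_bound l) by rewrite mulr_ge0 ?ler0n // subr_ge0.
  lra.
have E : fp_bound (e :: l) <= (1 - q) * fp_bound l + q * h.
  rewrite /fp_bound /= big_cons eO (_ : O e = true) // add1n exprS.
  have ph : pos e <= h by rewrite ge_max h0 le_max lexx.
  have p0 : 0 <= pos e by rewrite le_max lexx orbT.
  have c1 : (1 - q) ^+ (count O l).+1 <= 1.
    by apply: exprn_ile1; rewrite ?subr_ge0 // lerBlDr lerDl.
  have : (1 - q) ^+ (count O l).+1 * (q * pos e) <= 1 * (q * h).
    apply: ler_pM => //; first by apply: exprn_ge0; rewrite subr_ge0.
    - exact: mulr_ge0.
    - exact: ler_wpM2l.
  rewrite exprS; lra.
have a0 : 0 <= a by rewrite ler0n.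
have := ler_wpM2l a0 E.
have : 0 <= (N%:R - a * q) * (h - fp_bound l) by rewrite mulr_ge0 ?subr_ge0.
lra.
Qed.

End FirstPresent.

(** * Random windows and slots, and the recurrence for the value *)

Section Slots.
Context {R : realType} {n m N : nat}.
Variable tau : 'S_n.
Notation place := ('I_m * 'I_N.+1)%type.
Implicit Types (x y : {ffun 'I_n -> place}) (e s : 'I_n) (g : 'I_n -> R) (b : R)
  (a c : place) (v : nat).

Definition win x e : nat := (x e).1.
Definition slot x e : nat := (x e).2.

(** Ties within a slot are broken by [tau]. The number is used only to compare items of the same
    window. *)
Definition arrival x e : nat := (slot x e * n + tau e)%N.

Definition early x v : seq 'I_n := sort (relpre (arrival x) leq)
  [seq e <- enum 'I_n | (win x e == v) && (slot x e == 0%N)].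
Definition late x v : seq 'I_n := sort (relpre (arrival x) leq)
  [seq e <- enum 'I_n | (win x e == v) && (0 < slot x e)%N].

(* Among items of equal gain the earliest one outside slot 0 wins. *)
Definition rank_in e a : nat := ((if a.2 == 0%N :> nat then N.+1 else a.2) * n + tau e)%N.

Definition lower g e a s c : bool :=
  (g e < g s) || ((g e == g s) && (rank_in s c < rank_in e a)%N).

Definition top g b x v s : bool :=
  [&& win x s == v, b <= g s &
      [forall e, (e != s) && (win x e == v) ==> lower g e (x e) s (x s)]].

(** The winner may lie in slot 0. Nothing is then taken, but its place becomes known, so it must be
    part of the condition. *)
Definition best g b x v : option 'I_n := [pick s | top g b x v s].

Lemma topP g b x v s : reflect
  [/\ win x s = v, b <= g s &
      forall e, e != s -> win x e = v -> lower g e (x e) s (x s)] (top g b x v s).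
Proof.
apply: (iffP and3P) => -[h1 h2 h3]; split=> //; try exact/eqP.
  by move=> e ne we; apply: (implyP (forallP h3 e)); rewrite ne we eqxx.
by apply/forallP => e; apply/implyP => /andP[ne /eqP]; exact: h3.
Qed.

Lemma top_best g b x v s : top g b x v s -> best g b x v = Some s.
Proof.
move=> ts; rewrite /best; case: pickP => [s' ts'|/(_ s)]; last by rewrite ts.
case: (eqVneq s' s) => [->//|ne].
have /topP[w1 _ h1] := ts; have /topP[w2 _ h2] := ts'.
have := h1 s' ne w2; rewrite eq_sym in ne; have := h2 s ne w1; rewrite /lower.
case: (ltgtP (g s) (g s')) => //= _.
by move=> l1 l2; have := ltn_trans l1 l2; rewrite ltnn.
Qed.

Lemma best_top g b x v s : best g b x v = Some s -> top g b x v s.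
Proof. by rewrite /best; case: pickP => // s' ts' [<-]. Qed.

Lemma rank_in_inj x e s : rank_in e (x e) = rank_in s (x s) -> e = s.
Proof.
rewrite /rank_in => /(congr1 (modn^~ n)); rewrite !modnMDl !modn_small //.
by move=> h; apply: (@perm_inj _ tau); apply: val_inj.
Qed.

Lemma best_exists g b x v e : win x e = v -> b <= g e ->
  exists2 s, best g b x v = Some s & g e <= g s.
Proof.
move=> we be.
have [s0 ws0 gs0] : exists2 s, win x s = v & forall d, win x d = v -> g d <= g s.
  have := @arg_maxP _ _ _ e (fun d => win x d == v) g (introT eqP we).
  by case=> s /eqP ws h; exists s => // d /eqP /h.
have P0 : (win x s0 == v) && (g s0 == g s0) by rewrite ws0 !eqxx.
case: (@arg_minnP _ s0 (fun d => (win x d == v) && (g d == g s0))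
  (fun d => rank_in d (x d)) P0) => s /andP[/eqP ws /eqP gs] smin.
exists s; last by rewrite gs gs0.
apply: top_best; apply/topP; split=> //; first by rewrite gs (le_trans be) // gs0.
move=> d ds wd; rewrite /lower gs.
case: (ltgtP (g d) (g s0)) (gs0 d wd) => //= gd _.
rewrite ltn_neqAle smin ?wd ?gd ?eqxx // andbT.
by apply: contraNneq ds => /rank_in_inj ->.
Qed.

Lemma mem_early x v e : (e \in early x v) = (win x e == v) && (slot x e == 0%N).
Proof. by rewrite mem_sort mem_filter mem_enum andbT. Qed.

Lemma mem_late x v e : (e \in late x v) = (win x e == v) && (0 < slot x e)%N.
Proof. by rewrite mem_sort mem_filter mem_enum andbT. Qed.

Lemma arrival_inj x e s : arrival x e = arrival x s -> e = s.
Proof.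
rewrite /arrival => /(congr1 (modn^~ n)); rewrite !modnMDl !modn_small //.
by move=> h; apply: (@perm_inj _ tau); apply: val_inj.
Qed.

Lemma sorted_arrival x (l : seq 'I_n) : uniq l ->
  pairwise (fun e s => arrival x e < arrival x s)%N (sort (relpre (arrival x) leq) l).
Proof.
move=> ul; rewrite -(sort_uniq (relpre (arrival x) leq)) in ul.
have tot : total (relpre (arrival x) leq) by move=> ? ?; exact: leq_total.
have tr : transitive (relpre (arrival x) leq) by move=> ? ? ?; exact: leq_trans.
have := sort_sorted tot l; rewrite sorted_pairwise // => pw.
move: pw ul; elim: (sort _ l) => //= d k IH /andP[/allP ad pk] /andP[dk uk].
rewrite IH // andbT; apply/allP => z zk; have := ad z zk; rewrite /= ltn_neqAle => ->; rewrite andbT.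
by apply: contraNneq dk => /arrival_inj ->.
Qed.

Lemma late_pairwise x v : pairwise (fun e s => arrival x e < arrival x s)%N (late x v).
Proof. by apply: sorted_arrival; rewrite filter_uniq ?enum_uniq. Qed.

Lemma early_pairwise x v : pairwise (fun e s => arrival x e < arrival x s)%N (early x v).
Proof. by apply: sorted_arrival; rewrite filter_uniq ?enum_uniq. Qed.

(** If the winner is in slot 0, no later item reaches the threshold it sets, since an item with the
    same gain outside slot 0 would rank above it. Otherwise the scan ends with the winner as its
    last item. *)
Lemma ohead_scan g b x v : ohead (scan g b (early x v) (late x v)).2 =
  if best g b x v is Some s then if (0 < slot x s)%N then Some s else None else None.
Proof.
have [_ sub hd _] := scanP g b (early x v) (late_pairwise x v).
have [_ b_le l0_le thrE] := scan_initP g b (early x v).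
set thr := (foldl _ _ _).1 in hd b_le l0_le thrE.
case E: (scan _ _ _ _).2 sub hd => [|s k] sub /=.
  case=> _ lt; case B: (best g b x v) => [s|//]; case: ifP => // s0.
  have /topP[ws bs low] := best_top B.
  have := lt s; rewrite mem_late ws eqxx s0 => /(_ isT).
  case: thrE => [->|[e]]; first by rewrite ltNge bs.
  rewrite mem_early => /andP[/eqP we /eqP e0] ->.
  have es : e != s by apply: contraTneq s0 => <-; rewrite e0.
  by have := low e es we; rewrite /lower; case: ltgtP.
case=> thrs _ low; have := sub s; rewrite mem_head mem_late => /(_ isT) /andP[/eqP ws s0].
rewrite (@top_best g b x v s) ?s0 //; apply/topP; split=> //.
  exact: le_trans b_le thrs.
move=> e es we; rewrite /lower.
have rs : rank_in s (x s) = arrival x s.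
  by rewrite /rank_in /arrival; case: eqP s0 => //; rewrite /slot => ->.
have [e0|e0] := posnP (slot x e).
  have : g e <= thr by apply: l0_le; rewrite mem_early we e0 !eqxx.
  move=> /le_trans /(_ thrs); rewrite le_eqVlt => /orP[/eqP ->|->//].
  rewrite eqxx orbC /= rs /rank_in /arrival.
  have -> : (x e).2 == 0%N :> nat by apply/eqP.
  apply/orP; left; apply: ltn_addr; apply: leq_trans (_ : (slot x s).+1 * n <= _)%N.
    by rewrite mulSn addnC ltn_add2r.
  by rewrite leq_mul2r ltn_ord orbT.
have re : rank_in e (x e) = arrival x e.
  by rewrite /rank_in /arrival; case: eqP e0 => //; rewrite /slot => ->.
rewrite rs re; have := low e; rewrite mem_late we eqxx e0 => /(_ isT es).
by case=> [->//|[-> ->]]; rewrite eqxx orbT.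
Qed.

Variable I : instance R n.
Hypotheses (f0 : nonnegative (val_f I)) (fm : monotone (val_f I)).
Implicit Types (r : nat -> nat).

Definition xrun x r w := run I (early x) (late x) r w.
Definition xbest x r v := best (gain I (xrun x r v)) (base I (xrun x r v) (r v)) x v.

Lemma xrunS x r w : xrun x r w.+1 = next_state I (xrun x r w) (r w)
  (if xbest x r w is Some s then if (0 < slot x s)%N then Some s else None else None).
Proof. by rewrite {1}/xrun /= /takes ohead_scan. Qed.

Lemma xbest_win x r v s : xbest x r v = Some s -> win x s = v.
Proof. by move=> /best_top /topP[]. Qed.

Lemma mem_hist x r w e : (e \in (xrun x r w).1) =
  has (fun v => (xbest x r v == Some e) && (0 < slot x e)%N) (iota 0 w).
Proof.
elim: w => [|w IH] //; rewrite xrunS mem_hist_next -[w.+1]addn1 iotaD has_cat -IH /= orbF add0n.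
case E: (xbest x r w) => [s|] /=; last by rewrite orbF.
case: ifP => s0; last first.
  by case: eqP => [[<-]|] /=; rewrite ?s0 ?orbF.
rewrite mem_rcons inE orbC; congr (_ || _); apply/eqP/andP => [->|[/eqP[->]]//].
by rewrite eqxx.
Qed.

Lemma hist_win x r w e : e \in (xrun x r w).1 -> (win x e < w)%N.
Proof.
rewrite mem_hist => /hasP[v]; rewrite mem_iota add0n => /andP[_ vw] /andP[/eqP b _].
by rewrite (xbest_win b).
Qed.

Lemma xrun_valid x r w : valid I (xrun x r w).
Proof.
elim: w => [|w IH]; first exact: valid0.
rewrite xrunS; apply: valid_next => // e; case E: xbest => [s|//].
case: ifP => // _ [<-]; apply/negP => /hist_win.
by rewrite (xbest_win E) ltnn.
Qed.

Lemma size_hist x r w : (size (xrun x r w).1 <= w)%N.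
Proof.
elim: w => // w IH; rewrite xrunS mem_hist_next.
by case: xbest => [s|]; [case: ifP => _|]; rewrite ?size_rcons // ltnW.
Qed.

(* Whether place [a] for [e] is consistent with the winner of window [v]. *)
Definition consistent x r v e a : bool :=
  if xbest x r v is Some s then
    if e == s then a == x s
    else (a.1 == v :> nat) ==> lower (gain I (xrun x r v)) e a s (x s)
  else (a.1 == v :> nat) ==> (gain I (xrun x r v) e < base I (xrun x r v) (r v)).

(** Each condition concerns the place of a single item, so the assignments with the same winners in
    the same places form the product set [fam (hclass x r w)]. *)
Definition hclass x r w e : {set place} :=
  [set a | all (fun v => consistent x r v e a) (iota 0 w)].

Lemma consistent_self x r v e : consistent x r v e (x e).
Proof.
rewrite /consistent; case E: xbest => [s|].
  have /topP[ws _ low] := best_top E.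
  by case: eqVneq => [->//|es]; apply/implyP => /eqP; exact: low.
apply/implyP => /eqP we; rewrite ltNge; apply/negP => be.
by have [s] := best_exists we be; rewrite -/(xbest x r v) E.
Qed.

Lemma hclass_self x r w : x \in fam (hclass x r w).
Proof. by apply/famP => e; rewrite inE; apply/allP => v _; exact: consistent_self. Qed.

(** Equal runs before a window give equal gains in it, and the conditions for that window then force
    the same winner. *)
Lemma hclass_run x y r w : y \in fam (hclass x r w) ->
  xrun y r w = xrun x r w /\
  forall v, (v < w)%N -> [/\ xrun y r v = xrun x r v, xbest y r v = xbest x r v
    & forall s, xbest x r v = Some s -> y s = x s].
Proof.
elim: w => [|w IH] yc; first by split.
have {IH} [rw prev] : xrun y r w = xrun x r w /\
  forall v, (v < w)%N -> [/\ xrun y r v = xrun x r v, xbest y r v = xbest x r v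
    & forall s, xbest x r v = Some s -> y s = x s].
  apply: IH; apply/famP => e; have /famP /(_ e) := yc.
  by rewrite !inE -[w.+1]addn1 iotaD all_cat => /andP[].
have cw e : consistent x r w e (y e).
  have /famP /(_ e) := yc.
  by rewrite inE -[w.+1]addn1 iotaD all_cat /= add0n andbT => /andP[].
have [bw sw] : xbest y r w = xbest x r w /\ forall s, xbest x r w = Some s -> y s = x s.
  case E: (xbest x r w) => [s|]; last first.
    split=> //; rewrite /xbest rw; case B: best => [s|//].
    have /topP[ws bs _] := best_top B.
    have := cw s; rewrite /consistent E => /implyP; rewrite -/(win y s) ws eqxx => /(_ isT).
    by rewrite ltNge bs.
  have ys : y s = x s by have := cw s; rewrite /consistent E eqxx => /eqP.
  split=> [|s' [<-] //]; rewrite /xbest rw; apply: top_best.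
  have /topP[ws bs low] := best_top E; apply/topP; split=> //.
    by rewrite /win ys.
  move=> e es we; have := cw e; rewrite /consistent E (negPf es) ys => /implyP; apply.
  exact/eqP.
split.
  rewrite !xrunS rw bw; case E: xbest => [s|//].
  by rewrite /slot (sw s E).
by move=> v; rewrite ltnS leq_eqVlt => /orP[/eqP->|/prev//]; split.
Qed.

Lemma hclass_eq x y r w : y \in fam (hclass x r w) -> hclass y r w =1 hclass x r w.
Proof.
move=> yc e; have [_ prev] := hclass_run yc; apply/setP => a; rewrite !inE.
apply: eq_in_all => v; rewrite mem_iota add0n => /andP[_ vw].
have [e1 e2 e3] := prev v vw; rewrite /consistent e1 e2.
by case E: xbest => [s|//]; rewrite (e3 s E).
Qed.

(** Lying in the class of each other is an equivalence relation, so every [y] is counted as often as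
    its class has members, with the inverse weight. *)
Lemma sum_hclass r w (F : {ffun 'I_n -> place} -> R) :
  \sum_x F x = \sum_x #|fam (hclass x r w)|%:R^-1 * \sum_(y in fam (hclass x r w)) F y.
Proof.
pose C x := fam (hclass x r w).
have Csym x y : (y \in C x) = (x \in C y).
  have sub z t : t \in C z -> z \in C t.
    move=> tz; apply/famP => e; rewrite (hclass_eq tz).
    by have /famP := hclass_self z r w.
  by apply/idP/idP; exact: sub.
have Ceq x y : y \in C x -> C y = C x.
  move=> yx; apply/setP => z; rewrite !inE; apply: eq_forallb => e.
  by rewrite (hclass_eq yx).
rewrite [RHS](eq_bigr (fun x => \sum_(y in C x) #|C x|%:R^-1 * F y)); last first.
  by move=> x _; rewrite mulr_sumr.
rewrite [RHS](exchange_big_dep predT) //=; apply: eq_bigr => y _.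
rewrite (eq_bigl (mem (C y))); last by move=> x; rewrite Csym.
rewrite (eq_bigr (fun=> #|C y|%:R^-1 * F y)); last by move=> x /Ceq ->.
rewrite sumr_const -[RHS]mulr_natl mulrA divff ?mul1r // pnatr_eq0 -lt0n.
by apply/card_gt0P; exists y; exact: hclass_self.
Qed.

Definition revealed x r w e := has (fun v => xbest x r v == Some e) (iota 0 w).

(** An item that never won is only barred from places inside the past windows. *)
Lemma unrevealed_class x r w e a : ~~ revealed x r w e -> (w <= a.1)%N ->
  a \in hclass x r w e.
Proof.
move=> /hasPn nr wa; rewrite inE; apply/allP => v vw; have := nr v vw.
move: vw; rewrite mem_iota add0n => /andP[_ vw].
have av : (a.1 == v :> nat) = false by rewrite gtn_eqF // (leq_trans vw).
rewrite /consistent av; case: xbest => [s|//] /=.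
by case: (eqVneq e s) => // ->; rewrite eqxx.
Qed.

Lemma revealed_hist x r w e : revealed x r w e -> slot x e != 0%N ->
  e \in (xrun x r w).1.
Proof. by rewrite -lt0n mem_hist /revealed => h s0; apply: sub_has h => v ->. Qed.

Definition post_places w : {set place} :=
  [set a : place | (a.1 == w :> nat) && (0 < a.2)%N].
Definition init_places w : {set place} :=
  [set a : place | (a.1 == w :> nat) && (a.2 == 0%N :> nat)].

Lemma card_post w : (w < m)%N -> #|post_places w| = N.
Proof.
move=> wm; have -> : post_places w = setX [set Ordinal wm] [set j | j != ord0].
  by apply/setP => -[i j]; rewrite !inE /= lt0n.
rewrite cardsX cards1 mul1n; have := cardsC [set (ord0 : 'I_N.+1)].
rewrite cards1 card_ord add1n => /eqP; rewrite eqSS => /eqP cN; rewrite -[RHS]cN.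
by apply: eq_card => j; rewrite !inE.
Qed.

Lemma card_init w : (w < m)%N -> #|init_places w| = 1%N.
Proof.
move=> wm; have -> : init_places w = [set (Ordinal wm, ord0)].
  by apply/setP => -[i j]; rewrite !inE /= xpair_eqE.
exact: cards1.
Qed.

Lemma post_init_disj w : [disjoint post_places w & init_places w].
Proof.
rewrite -setI_eq0; apply/eqP/setP => a; rewrite !inE lt0n.
by case: (a.1 == w :> nat); case: (a.2 == 0%N :> nat).
Qed.

Lemma first_presentP g b w l y : sorted (fun e d => g d <= g e) l ->
  let W := post_places w :|: init_places w in
  let F := first_present g b (post_places w) (init_places w) l y in
  ((forall e, e \in l -> y e \notin W) /\ F = b) \/
  exists e, [/\ e \in l, y e \in W, forall d, d \in l -> y d \in W -> g d <= g e
    & F = if y e \in post_places w then Num.max (g e) b else 0].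
Proof.
have tr : transitive (fun e d => g d <= g e) by move=> ? ? ? h1 h2; exact: le_trans h2 h1.
elim: l => [|e l IH] /= pl; first by left.
move: (pl); rewrite path_sortedE // => /andP[/allP el /IH sl].
rewrite /= in sl; case: (boolP (y e \in post_places w)) => [yp|ynp].
  right; exists e; rewrite mem_head inE yp; split=> //.
  by move=> d; rewrite inE => /predU1P[->|/el].
case: ifP => [yi|yni].
  right; exists e; rewrite mem_head inE yi orbT (negPf ynp); split=> //.
  by move=> d; rewrite inE => /predU1P[->|/el].
have yW : y e \notin post_places w :|: init_places w by rewrite inE (negPf ynp) yni.
case: sl => [[none ->]|[d [dl dW dm ->]]]; [left|right].
  by split=> // d; rewrite inE => /predU1P[->|/none].
exists d; rewrite inE dl orbT; split=> // c; rewrite inE => /predU1P[->|]; last exact: dm.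
by rewrite (negPf yW).
Qed.

Definition fresh_items x r w : seq 'I_n :=
  sort (fun e d => gain I (xrun x r w) d <= gain I (xrun x r w) e)
    [seq e <- enum 'I_n | ~~ revealed x r w e].

(** Every item placed in window [w] is unrevealed, so the first one present has the largest gain
    there. If it lies outside slot 0 then so does the winner, even after a tie, because [rank_in]
    puts slot 0 last. *)
Lemma first_present_le x y r w : y \in fam (hclass x r w) ->
  first_present (gain I (xrun x r w)) (base I (xrun x r w) (r w))
    (post_places w) (init_places w) (fresh_items x r w) y
  <= solval I (xrun y r w.+1) - solval I (xrun y r w).
Proof.
move=> yc; have [yr prev] := hclass_run yc.
rewrite xrunS val_next addrAC subrr add0r yr; set g := gain I _; set b := base I _ _.
have b0 : 0 <= b by exact: base_ge0.
set l := fresh_items x r w.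
have sl : sorted (fun e d => g d <= g e) l by apply: sort_sorted => ? ?; exact: le_total.
have winW e : (y e \in post_places w :|: init_places w) = (win y e == w).
  by rewrite !inE /win; case: ((y e).1 == w :> nat) => //=; rewrite lt0n orNb.
have fresh e : win y e = w -> e \in l.
  move=> we; rewrite mem_sort mem_filter mem_enum andbT; apply/hasPn => v.
  rewrite mem_iota add0n => /andP[_ vw]; have [_ _ ys] := prev v vw.
  apply/negP => /eqP be; have := xbest_win be; rewrite /win -(ys _ be) -/(win y e) we.
  by move=> wv; move: vw; rewrite wv ltnn.
have xb : xbest y r w = best g b y w by rewrite /xbest yr.
rewrite xb; case: (first_presentP b w y sl) => /= [[none ->]|[e [el eW em ->]]].
  case B: best => [s|//]; have /topP[ws _ _] := best_top B.
  by have := none s (fresh s ws); rewrite winW ws eqxx.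
move: eW; rewrite winW => /eqP we.
have real0 : 0 <= (match (if best g b y w is Some s then
    if (0 < slot y s)%N then Some s else None else None) with
    | Some s => g s | None => b end).
  case B: best => [s|//]; case: ifP => // _; have /topP[_ bs _] := best_top B.
  exact: le_trans b0 bs.
case: ifP => // yp.
have [be|be] := lerP b (g e); last first.
  case B: best => [s|] //; have /topP[ws bs _] := best_top B.
  have := em s (fresh s ws); rewrite winW ws eqxx => /(_ isT) se.
  by have := lt_le_trans be (le_trans bs se); rewrite ltxx.
have [s B es] := best_exists we be; rewrite B.
have /topP[ws bs low] := best_top B.
have se : g s <= g e by apply: em; [exact: fresh | rewrite winW ws].
have ges : g e = g s by apply/eqP; rewrite eq_le se es.
suff -> : (0 < slot y s)%N by rewrite ges.
case: (eqVneq e s) => [<-|ns]; first by move: yp; rewrite inE => /andP[].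
rewrite lt0n; apply/negP => /eqP s0.
have := low e ns we; rewrite /lower ges ltxx eqxx /= /rank_in.
have -> : (y s).2 == 0%N :> nat by apply/eqP.
move: yp; rewrite inE lt0n => /andP[_ /negPf ->]; rewrite ltnNge => /negP; apply.
apply: leq_trans (leq_addr _ _); apply: leq_trans (_ : ((y e).2.+1 * n) <= _)%N.
  by rewrite mulSn addnC leq_add2r ltnW.
by rewrite leq_mul2r ltnS -ltnS ltn_ord orbT.
Qed.

Variables (O : {set 'I_n}) (k : nat).
Hypothesis Ok : (#|O| <= k)%N.
Let q : R := m%:R^-1.
Let d : R := (N.+1)%:R^-1.
Let coef : R := (1 - d) * (1 - q) ^+ k.

Lemma sum_fresh x r w (F : 'I_n -> R) :
  \sum_(e <- fresh_items x r w | e \in O) F e = \sum_(o in O | ~~ revealed x r w o) F o.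
Proof.
rewrite (perm_big [seq e <- enum 'I_n | ~~ revealed x r w e]) ?perm_sort //=.
by rewrite big_filter_cond big_enum_cond /=; apply: eq_bigl => e; rewrite andbC.
Qed.

Lemma window_gain_fixed r w : (w < m)%N ->
  \sum_x coef * (base I (xrun x r w) (r w) +
     q * \sum_(o in O | ~~ revealed x r w o) Num.max (gain I (xrun x r w) o) 0)
  <= \sum_x (solval I (xrun x r w.+1) - solval I (xrun x r w)).
Proof.
move=> wm; have m0 : (0 < m)%N := leq_ltn_trans (leq0n _) wm.
rewrite [leRHS](sum_hclass r w); apply: ler_sum => x _.
set C := fam _; have C0 : (0 < #|C|)%N by apply/card_gt0P; exists x; exact: hclass_self.
have q0 : 0 <= q by rewrite invr_ge0 ler0n.
have q1 : q <= 1 by rewrite invf_le1 ?ltr0n // ler1n.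
have d1 : 0 <= 1 - d by rewrite subr_ge0 invf_le1 ?ltr0n // ler1n.
rewrite ler_pdivlMl ?ltr0n //.
apply: le_trans (ler_sum _ (fun y yC => first_present_le yC)).
set b := base I _ _; have b0 : 0 <= b by exact: base_ge0.
set g := gain I _.
have ul : uniq (fresh_items x r w) by rewrite sort_uniq filter_uniq // enum_uniq.
have sl : sorted (fun e d => g d <= g e) (fresh_items x r w).
  by apply: sort_sorted => ? ?; exact: le_total.
have Al e : e \in fresh_items x r w ->
    post_places w :|: init_places w \subset hclass x r w e /\
    (#|hclass x r w e| <= m * N.+1)%N.
  rewrite mem_sort mem_filter => /andP[nr _]; split.
    apply/subsetP => a aW; apply: unrevealed_class => //.
    by move: aW; rewrite !inE => /orP[] /andP[/eqP->].
  by have := max_card (mem (hclass x r w e)); rewrite card_prod !card_ord.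
(* The lemma counts all slots of a window, the observation slot included; this number is [N.+1]
   here. *)
have := @sum_first_present R _ _ g b (post_places w) (init_places w) (mem O) N.+1 m
  b0 (ltn0Sn _) m0 (post_init_disj w) (card_post wm) (card_init wm) _ (hclass x r w) ul sl Al.
apply: le_trans; rewrite ler_wpM2l ?ler0n // /coef -mulrA ler_wpM2l // /fp_bound sum_fresh.
rewrite ler_wpM2r //.
  rewrite addr_ge0 // mulr_ge0 //; apply: sumr_ge0 => o _; by rewrite le_max lexx orbT.
rewrite ler_wiXn2l ?subr_ge0 //; first by rewrite lerBlDr lerDl.
apply: leq_trans Ok; rewrite -size_filter; apply: leq_trans (_ : #|[seq e <- fresh_items x r w | e \in O]| <= _)%N.
  by rewrite (card_uniqP _) // filter_uniq.
by apply: subset_leq_card; apply/subsetP => e; rewrite mem_filter => /andP[].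
Qed.

(** The default 0 is out of reach of the first [m] windows. *)
Definition tape (r : {ffun 'I_m -> 'I_m}) v : nat := if insub v is Some i then r i else 0%N.

Lemma tapeE (r : {ffun 'I_m -> 'I_m}) (i : 'I_m) : tape r i = r i.
Proof. by rewrite /tape valK. Qed.

Lemma xrun_upd x (r : {ffun 'I_m -> 'I_m}) (w a : 'I_m) : xrun x (tape (upd r w a)) w = xrun x (tape r) w.
Proof.
apply: eq_run => v vw; split=> //; rewrite /tape.
case: insubP => // u _ uv; rewrite updE; case: eqP => // uw.
by move: vw; rewrite -uv uw ltnn.
Qed.

Lemma revealed_upd x (r : {ffun 'I_m -> 'I_m}) (w a : 'I_m) e :
  revealed x (tape (upd r w a)) w e = revealed x (tape r) w e.
Proof.
apply: eq_in_has => v; rewrite mem_iota add0n => /andP[_ vw].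
have E u : (u < w)%N -> tape (upd r w a) u = tape r u.
  move=> uw; rewrite /tape; case: insubP => // z _ zu; rewrite updE; case: eqP => // zw.
  by move: uw; rewrite -zu zw ltnn.
have Erun : xrun x (tape (upd r w a)) v = xrun x (tape r) v.
  by apply: eq_run => u uv; split=> //; apply: E; exact: ltn_trans uv vw.
by rewrite /xbest Erun E.
Qed.

(** An item of slot 0 may win its window without entering the history, and is then available neither
    in a later window nor as the drawn element. *)
Definition visible x : {set 'I_n} := O :\: [set e | slot x e == 0%N].

(** Each entry of the history is hit by exactly one index below [m], and every other index
    contributes a nonnegative term. *)
Lemma sum_base_ge st : uniq st.1 -> (size st.1 <= m)%N ->
  \sum_(o in O | o \in st.1) Num.max (gain I st o) 0 <= \sum_(a < m) base I st a.
Proof.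
move=> us sm.
have pos0 e : 0 <= Num.max (gain I st e) 0 by rewrite le_max lexx orbT.
have le : \sum_(e <- st.1) Num.max (gain I st e) 0 <= \sum_(a < m) base I st a.
  rewrite -(big_mkord xpredT (base I st)) (big_cat_nat (leq0n _) sm) /=.
  apply: le_trans (_ : \sum_(0 <= a < size st.1) base I st a <= _); last first.
    by rewrite lerDl; apply: sumr_ge0 => *; exact: base_ge0.
  case E: st.1 => [|e0 l]; first by rewrite big_nil big_geq.
  rewrite (big_nth e0) -E big_nat_cond [leRHS]big_nat_cond; apply: ler_sum => a /andP[/andP[_ as_] _].
  rewrite ge_max base_ge0 andbT; apply: base_ge.
  by rewrite onthE (nth_map e0).
apply: le_trans le; rewrite [leRHS]big_uniq //= big_mkcond [leRHS]big_mkcond /=.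
by apply: ler_sum => e _; case: (e \in O); case: (e \in st.1) => //=.
Qed.

(** The draw of window [w] is resampled, since the run so far does not read it. An item of
    [visible x] is either unrevealed, and paid for by the window term, or in the history, and paid
    for by the draw; both payments have weight 1/m. *)
Lemma window_gain (w : 'I_m) :
  coef * (\sum_(r : {ffun 'I_m -> 'I_m}) \sum_x
      \sum_(o in visible x) gain I (xrun x (tape r) w) o)
  <= m%:R * \sum_(r : {ffun 'I_m -> 'I_m}) \sum_x
       (solval I (xrun x (tape r) w.+1) - solval I (xrun x (tape r) w)).
Proof.
have m0 : (0 < m)%N := leq_ltn_trans (leq0n _) (ltn_ord w).
have q0 : 0 <= q by rewrite invr_ge0 ler0n.
have q1 : q <= 1 by rewrite invf_le1 ?ltr0n // ler1n.
have c0 : 0 <= coef.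
  by rewrite mulr_ge0 // ?exprn_ge0 ?subr_ge0 // invf_le1 ?ltr0n // ler1n.
pose D := fun r : {ffun 'I_m -> 'I_m} =>
  \sum_x (solval I (xrun x (tape r) w.+1) - solval I (xrun x (tape r) w)).
rewrite -[X in _ <= _ * X]/(\sum_r D r).
rewrite mulr_natl -[X in _ *+ X]card_ord -sumr_const.
have -> : \sum_(i in 'I_m) \sum_r D r = \sum_r \sum_(a : 'I_m) D r by exact: exchange_big.
rewrite (sum_swap w) mulr_sumr; apply: ler_sum => r _.
rewrite /D mulr_sumr.
apply: le_trans (_ : \sum_(a : 'I_m) \sum_x coef * (base I (xrun x (tape r) w) a +
     q * \sum_(o in O | ~~ revealed x (tape r) w o) Num.max (gain I (xrun x (tape r) w) o) 0) <= _).
  rewrite exchange_big /=; apply: ler_sum => x _; rewrite -mulr_sumr ler_wpM2l //.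
  rewrite [leRHS]big_split /= big_const_ord iter_addr_0 -[X in _ + X]mulr_natl mulrA divff ?mul1r;
    last by rewrite pnatr_eq0 -lt0n.
  set st := xrun x (tape r) w.
  have hu : uniq st.1 := valid_hist (xrun_valid x (tape r) w).
  have hs : (size st.1 <= m)%N := leq_trans (size_hist x (tape r) w) (ltnW (ltn_ord w)).
  apply: le_trans (lerD (sum_base_ge hu hs) (lexx _)).
  rewrite [X in _ <= X + _]big_mkcond [X in _ <= _ + X]big_mkcond -big_split /=.
  rewrite [leLHS]big_mkcond /=.
  apply: ler_sum => e _; rewrite /visible !inE.
  have pos0 : 0 <= Num.max (gain I st e) 0 by rewrite le_max lexx orbT.
  have le : gain I st e <= Num.max (gain I st e) 0 by rewrite le_max lexx.
  case: (e \in O) => /=; rewrite ?andbF ?andbT ?addr0 //.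
  case: (boolP (revealed _ _ _ _)) => [rv|nrv] /=; last first.
    by move: pos0 le; set z := Num.max _ _; case: ifP => _; case: ifP => _; lra.
  case: (boolP (slot x e == 0%N)) => /= s0; first by case: ifP => _; rewrite addr0.
  by rewrite (revealed_hist rv s0) addr0.
apply: ler_sum => a _.
have := window_gain_fixed (tape (upd r w a)) (ltn_ord w).
rewrite tapeE updE eqxx; apply: le_trans.
rewrite le_eqVlt; apply/orP; left; apply/eqP; apply: eq_bigr => x _.
rewrite xrun_upd; congr (_ * (_ + _ * _)); apply: eq_bigl => o.
by rewrite revealed_upd.
Qed.

Hypotheses (fs : submodular (val_f I)) (Of : feasible I O).
Variable p : nat.
Hypothesis mp : is_matchoid p I.
Let yy : R := (minn p k).+1%:R.

Lemma sum_visible : (0 < m)%N -> #|{ffun 'I_n -> place}|%:R * (1 - d) * val_f I O <=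
  \sum_x val_f I (visible x).
Proof.
move=> m0; apply: sum_random_removal => //; first by rewrite invr_ge0 ler0n.
move=> o _.
have := @sum_swap _ _ R o
  (fun (x : {ffun 'I_n -> place}) (a : place) => (slot x o == 0%N)%:R).
rewrite [X in _ = X](eq_bigr (fun=> \sum_(a : place) (a.2 == 0%N :> nat)%:R)); last first.
  by move=> x _; apply: eq_bigr => a _; rewrite /slot updE eqxx.
have -> : \sum_(a : place) (a.2 == 0%N :> nat)%:R = m%:R :> R.
  rewrite -(pair_bigA _ (fun (i : 'I_m) (j : 'I_N.+1) => (j == 0%N :> nat)%:R)) /=.
  rewrite (eq_bigr (fun=> 1)) ?big_const_ord ?iter_addr_0 // => i _.
  by rewrite (bigD1 ord0) //= big1 ?addr0 // => j; case: j => -[].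
rewrite (eq_bigr (fun x : {ffun 'I_n -> place} => (slot x o == 0%N)%:R *+ #|{: place}|));
  last by move=> x _; rewrite sumr_const.
rewrite sumr_const sumrMnl card_prod !card_ord.
have -> : \sum_(x : {ffun 'I_n -> place}) (slot x o == 0%N)%:R =
    #|[set x : {ffun 'I_n -> place} | o \in [set e | slot x e == 0%N]]|%:R :> R.
  rewrite -natr_sum -sum1dep_card; congr (_%:R); rewrite [RHS]big_mkcond.
  by apply: eq_bigr => x _; rewrite inE; case: eqP.
rewrite -!mulrnA => /eqP; rewrite eqr_nat => /eqP E.
rewrite mulrC ler_pdivlMr ?ltr0n // -natrM ler_nat -(leq_pmul2l m0).
by move: E; set X := #|_|; set Y := #|_|; lia.
Qed.

Definition total_value w : R :=
  \sum_(r : {ffun 'I_m -> 'I_m}) \sum_x solval I (xrun x (tape r) w).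

Let size_space : R := #|{ffun 'I_m -> 'I_m}|%:R * #|{ffun 'I_n -> place}|%:R.

Lemma total_value_step (w : 'I_m) :
  coef * (size_space * (1 - d) * val_f I O - yy * total_value w)
  <= m%:R * (total_value w.+1 - total_value w).
Proof.
have m0 : (0 < m)%N := leq_ltn_trans (leq0n _) (ltn_ord w).
have q1 : q <= 1 by rewrite invf_le1 ?ltr0n // ler1n.
have c0 : 0 <= coef.
  by rewrite mulr_ge0 // ?exprn_ge0 ?subr_ge0 // invf_le1 ?ltr0n // ler1n.
have := window_gain w.
have -> : \sum_r \sum_x (solval I (xrun x (tape r) w.+1) - solval I (xrun x (tape r) w)) =
    total_value w.+1 - total_value w.
  by rewrite /total_value -sumrB; apply: eq_bigr => r _; rewrite sumrB.
apply: le_trans; rewrite ler_wpM2l //.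
apply: le_trans (_ : \sum_(r : {ffun 'I_m -> 'I_m}) \sum_x
  (val_f I (visible x) - yy * solval I (xrun x (tape r) w)) <= _); last first.
  apply: ler_sum => r _; apply: ler_sum => x _.
  have vO : visible x \subset O by exact: subsetDl.
  have := sum_gain_ge f0 fm fs mp (xrun_valid x (tape r) w) (feasible_sub vO Of).
  apply: le_trans; rewrite lerD2l lerN2 ler_wpM2r ?f0 // ler_nat ltnS.
  by rewrite leq_min geq_minl (leq_trans (geq_minr _ _)) // (leq_trans (subset_leq_card vO)).
under eq_bigr do rewrite sumrB -mulr_sumr.
rewrite sumrB -mulr_sumr -/(total_value w) lerD2r sumr_const -[leRHS]mulr_natl.
by rewrite /size_space -!mulrA ler_wpM2l ?ler0n // mulrA sum_visible.
Qed.

Lemma total_value_ge : (k < m)%N ->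
  size_space * ((1 - d) * (1 - expR (- (coef * yy)))) * val_f I O <= yy * total_value m.
Proof.
move=> km; have m0 : (0 < m)%N by apply: leq_ltn_trans km.
have mR : 0 < m%:R :> R by rewrite ltr0n.
have q0 : 0 <= q by rewrite invr_ge0 ler0n.
have q1 : q <= 1 by rewrite invf_le1 ?ltr0n // ler1n.
have d0 : 0 <= d by rewrite invr_ge0 ler0n.
have d1 : d <= 1 by rewrite invf_le1 ?ltr0n // ler1n.
have c0 : 0 <= coef by rewrite mulr_ge0 // ?exprn_ge0 ?subr_ge0.
have c1 : coef <= 1.
  by rewrite mulr_ile1 ?exprn_ge0 ?subr_ge0 ?exprn_ile1 ?subr_ge0 // lerBlDr lerDl.
have y0 : 0 <= yy by rewrite ler0n.
have ym : yy <= m%:R by rewrite ler_nat (leq_trans _ km) // ltnS geq_minr.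
pose G := size_space * (1 - d) * val_f I O.
have G0 : 0 <= G by rewrite !mulr_ge0 ?ler0n ?subr_ge0 // f0.
(* One window shrinks the gap between [G] and [yy] times the value by the factor [a]. Iterating
   needs [a] nonnegative, which follows from [yy <= k.+1 <= m]. *)
pose a := 1 - coef * yy / m%:R.
have a0 : 0 <= a.
  rewrite subr_ge0 ler_pdivrMr // mul1r; apply: le_trans ym.
  by rewrite ler_piMl.
have step w : (w <= m)%N -> G - yy * total_value w <= a ^+ w * G.
  elim: w => [_|w IH wm].
    rewrite expr0 mul1r gerBl mulr_ge0 //.
    by apply: sumr_ge0 => r _; apply: sumr_ge0 => x _; exact: f0.
  have := total_value_step (Ordinal wm); rewrite -/G /= => st.
  apply: le_trans (_ : a * (G - yy * total_value w) <= _); last first.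
    by rewrite exprS -mulrA ler_wpM2l // IH // ltnW.
  have : coef * (G - yy * total_value w) / m%:R <= total_value w.+1 - total_value w.
    by rewrite ler_pdivrMr // mulrC [leRHS]mulrC mulrC.
  move=> /(ler_wpM2l y0); rewrite /a.
  set D := G - _; have -> : G - yy * total_value w.+1 =
    D - yy * (total_value w.+1 - total_value w) by rewrite /D; ring.
  have -> : (1 - coef * yy / m%:R) * D = D - yy * (coef * D / m%:R) by ring.
  by move=> h; rewrite lerD2l lerN2.
have := step m (leqnn _).
have am : a ^+ m <= expR (- (coef * yy)).
  have -> : - (coef * yy) = - (coef * yy / m%:R) * m%:R by rewrite mulNr divfK // gt_eqF.
  by rewrite expRM_natr; apply: lerXn2r; rewrite ?nnegrE ?expR_ge0 // expR_ge1Dx.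
move=> h; have := ler_wpM2r G0 am; rewrite /G in h *; lra.
Qed.

End Slots.

(** * The number of shortlisted items *)

Section RunningMinima.
Context {R : realType} {T : finType} {N : nat}.
Implicit Types (t : T -> nat) (l : seq T) (c : nat).

(* The number of weak running minima other than 0, starting below [c]. *)
Fixpoint minima c l t : nat :=
  if l is e :: l' then ((0 < t e <= c) + minima (minn c (t e)) l' t)%N else 0%N.

Lemma eq_minima c l t t' : {in l, t =1 t'} -> minima c l t = minima c l t'.
Proof.
elim: l c => //= e l IH c E; rewrite E ?mem_head // IH // => d dl.
by rewrite E // inE dl orbT.
Qed.

(** An item whose slot is at most the slot of each item of at least its gain is a running minimum
    when slots are read by decreasing gain. Minima are weak because several items may share a
    slot. *)
Lemma count_le_minima (g : T -> R) (P : pred T) c l t :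
  sorted (fun e d => g d <= g e) l -> {in l, forall e, P e -> (0 < t e <= c)%N} ->
  {in l &, forall e d, P e -> g e <= g d -> (t e <= t d)%N} ->
  (count P l <= minima c l t)%N.
Proof.
have tr : transitive (fun e d => g d <= g e).
  by move=> ? ? ? h1 h2; exact: le_trans h2 h1.
elim: l c => //= e l IH c; rewrite path_sortedE // => /andP[/allP le sl] Pc Pl.
have Pe : (P e <= (0 < t e <= c))%N.
  by case: (boolP (P e)) => // pe; rewrite Pc ?mem_head.
apply: leq_add Pe (IH _ sl _ _) => [d dl pd|d d' dl dl'].
  have dl' : d \in e :: l by rewrite inE dl orbT.
  by have /andP[-> dc] := Pc d dl' pd; rewrite leq_min dc Pl ?mem_head //; exact: le.
by apply: Pl; rewrite inE ?dl ?dl' orbT.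
Qed.

Let z : R := 4%:R / 3%:R.

(** The potential [c.+1], with a factor 4/3 for each minimum, does not grow on average. For this
    factor the terms with a <= c add up to (c+1)^2 - c^2/3, and the other N - c terms are c+1
    each. *)
Let sum_minima_step c : (c <= N)%N ->
  \sum_(a < N.+1) z ^+ (0 < a <= c) * (minn c a).+1%:R <= N.+1%:R * c.+1%:R :> R.
Proof.
move=> cN; rewrite -(big_mkord xpredT (fun a => z ^+ (0 < a <= c)%N * (minn c a).+1%:R)).
rewrite (big_cat_nat (leq0n c.+1)) ?ltnS //=.
have -> : \sum_(c.+1 <= a < N.+1) z ^+ (0 < a <= c)%N * (minn c a).+1%:R =
    (N - c)%:R * c.+1%:R :> R.
  rewrite big_nat_cond (eq_bigr (fun=> c.+1%:R)); last first.
    by move=> a /andP[/andP[ca _] _]; rewrite [(a <= c)%N]leqNgt ca andbF mul1r (minn_idPl (ltnW ca)).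
  by rewrite -big_nat_cond sumr_const_nat subSS mulr_natl.
have -> : \sum_(0 <= a < c.+1) z ^+ (0 < a <= c)%N * (minn c a).+1%:R =
    \sum_(0 <= a < c.+1) z ^+ (0 < a)%N * a.+1%:R :> R.
  rewrite big_nat_cond [RHS]big_nat_cond; apply: eq_bigr => a /andP[/andP[_ ca] _].
  have ac : (a <= c)%N by [].
  by rewrite ac andbT (minn_idPr ac).
have -> : \sum_(0 <= a < c.+1) z ^+ (0 < a)%N * a.+1%:R =
    1 + 2%:R / 3%:R * (c%:R ^+ 2 + 3%:R * c%:R) :> R.
  elim: (c) => [|c' IH]; first by rewrite big_nat1 /= mul1r; lra.
  by rewrite big_nat_recr //= IH /z expr1 -[c'.+2]addn1 -[c'.+1]addn1 !natrD; field.
rewrite natrB // -[c.+1]addn1 -[N.+1]addn1 !natrD.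
have := sqr_ge0 (c%:R : R); set u : R := c%:R; set w : R := N%:R; rewrite expr2; lra.
Qed.

(** The rest of the list depends on the past through the current minimum only, so the slots are
    resampled one at a time against the potential. *)
Lemma sum_minima c l : uniq l -> (c <= N)%N ->
  \sum_(t : {ffun T -> 'I_N.+1}) z ^+ minima c l (fun e => t e)
  <= #|{ffun T -> 'I_N.+1}|%:R * c.+1%:R.
Proof.
elim: l c => [|e l IH] c /= => [_ cN|/andP[el ul] cN].
  rewrite sumr_const -[leLHS]mulr_natl ler_wpM2l ?ler0n // ler1n.
  by [].
rewrite -(ler_pM2l (_ : 0 < N.+1%:R)) ?ltr0n //.
pose F (t : {ffun T -> 'I_N.+1}) (a : 'I_N.+1) : R := z ^+ minima c (e :: l) (fun e => t e).
have -> : N.+1%:R * \sum_(t : {ffun T -> 'I_N.+1})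
    z ^+ ((0 < t e <= c) + minima (minn c (t e)) l (fun e => t e))%N = \sum_t \sum_a F t a.
  by rewrite mulr_sumr; apply: eq_bigr => t _; rewrite /F /= big_const_ord iter_addr_0 mulr_natl.
rewrite (sum_swap e) exchange_big /=.
apply: le_trans (_ : \sum_(a < N.+1) z ^+ (0 < a <= c) *
   (#|{ffun T -> 'I_N.+1}|%:R * (minn c a).+1%:R) <= _).
  apply: ler_sum => a _; apply: le_trans (_ : z ^+ (0 < a <= c)%N *
     \sum_(t : {ffun T -> 'I_N.+1}) z ^+ minima (minn c a) l (fun e => t e) <= _).
    rewrite mulr_sumr; apply: ler_sum => t _; rewrite /F /= updE eqxx exprD.
    rewrite le_eqVlt; apply/orP; left; apply/eqP; congr (_ * z ^+ _).
    by apply: eq_minima => d dl; rewrite updE; case: eqVneq dl el => // -> ->.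
  rewrite ler_wpM2l ?exprn_ge0 ?divr_ge0 ?ler0n // IH //.
  by rewrite (leq_trans (geq_minl _ _)).
have -> : \sum_(a < N.+1) z ^+ (0 < a <= c)%N * (#|{ffun T -> 'I_N.+1}|%:R * (minn c a).+1%:R) =
   #|{ffun T -> 'I_N.+1}|%:R * \sum_(a < N.+1) z ^+ (0 < a <= c) * (minn c a).+1%:R.
  by rewrite mulr_sumr; apply: eq_bigr => a _; ring.
rewrite mulrCA ler_wpM2l ?ler0n // sum_minima_step //.
Qed.

End RunningMinima.

Section TakeCount.
Context {R : realType} {n m N : nat}.
Variable tau : 'S_n.
Notation place := ('I_m * 'I_N.+1)%type.
Variable I : instance R n.
Implicit Types (x : {ffun 'I_n -> place}) (t : {ffun 'I_n -> 'I_N.+1}) (r : nat -> nat).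

Definition xtakes x r v := takes_at I (early tau x) (late tau x) r v.
Definition ntakes x r w := (\sum_(v < w) size (xtakes x r v))%N.

Definition window_items x r v : seq 'I_n :=
  sort (fun e d => gain I (xrun tau I x r v) d <= gain I (xrun tau I x r v) e)
    [seq e <- enum 'I_n | win x e == v].

Lemma mem_window x r v e : (e \in window_items x r v) = (win x e == v).
Proof. by rewrite mem_sort mem_filter mem_enum andbT. Qed.

Lemma slot_le_arrival x e s : (arrival tau x s < arrival tau x e)%N ->
  (slot x s <= slot x e)%N.
Proof.
rewrite /arrival => lt; rewrite leqNgt; apply/negP => es.
have : (slot x e * n + tau e < slot x s * n)%N.
  apply: leq_trans (_ : (slot x e).+1 * n <= _)%N; first by rewrite mulSn addnC ltn_add2r.
  by rewrite leq_mul2r es orbT.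
by move/(ltn_trans lt); rewrite ltnNge leq_addr.
Qed.

(** The successor pays for the one item that may tie with the threshold and need not be a record. *)
Lemma size_xtakes x r v :
  (size (xtakes x r v) <= (minima N (window_items x r v) (slot x)).+1)%N.
Proof.
set st := xrun tau I x r v; set g := gain I st; set b := base I st (r v).
have [ut st_late _ [s0 ts]] := scanP g b (early tau x v) (late_pairwise tau x v).
pose P e := (0 < slot x e)%N && all (fun d => (g e <= g d) ==> (slot x e <= slot x d)%N)
  (window_items x r v).
have Ptake s : s \in xtakes x r v -> Some s != s0 -> P s.
  move=> sx ss0; have [te tl] := ts s sx ss0.
  have := st_late s sx; rewrite mem_late => /andP[/eqP ws s_pos].
  rewrite /P s_pos; apply/allP => d; rewrite mem_window => /eqP wd; apply/implyP => gd.
  case: (eqVneq d s) => [->//|ds].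
  have [d0|d0] := posnP (slot x d).
    have : g d < g s by apply: te; rewrite mem_early wd d0 !eqxx.
    by rewrite ltNge gd.
  by apply: slot_le_arrival; apply: tl; rewrite // mem_late wd d0 eqxx.
have wu : uniq (window_items x r v) by rewrite sort_uniq filter_uniq ?enum_uniq.
apply: (@leq_trans (count P (window_items x r v)).+1); last first.
  rewrite ltnS; apply: (count_le_minima (g := g)).
  - by apply: sort_sorted => ? ?; exact: le_total.
  - by move=> e _ /andP[-> _]; rewrite -ltnS ltn_ord.
  - move=> e d _ dW /andP[_ /allP /(_ d dW) /implyP]; exact.
rewrite -(count_predC (fun s => Some s == s0)) addnC -addn1; apply: leq_add.
  rewrite -size_filter -[leqRHS]size_filter; apply: uniq_leq_size.
    by rewrite filter_uniq.
  move=> s; rewrite !mem_filter /= mem_window => /andP[ss0 sx]; rewrite Ptake //=.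
  by have := st_late s sx; rewrite mem_late => /andP[].
case: s0 {ts Ptake} => [s0|]; last by rewrite (@eq_count _ _ pred0) // count_pred0.
have -> : count (fun s => Some s == Some s0) (xtakes x r v) = count_mem s0 (xtakes x r v).
  by apply: eq_count => s.
by rewrite count_uniq_mem // leq_b1.
Qed.

(** Only the slots inside window [v] are redrawn. The run before [v], hence the gains and their
    order in [v], are unchanged, while the slots in [v] become uniform. *)
Definition resample v x t : {ffun 'I_n -> place} :=
  [ffun e => if win x e == v then ((x e).1, t e) else x e].

Lemma win_resample v x t e : win (resample v x t) e = win x e.
Proof. by rewrite /win ffunE; case: ifP. Qed.

Lemma slot_resample v x t e :
  slot (resample v x t) e = if win x e == v then nat_of_ord (t e) else slot x e.
Proof. by rewrite /slot ffunE; case: ifP. Qed.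

Lemma sum_resample v (V : nmodType) (F : {ffun 'I_n -> place} -> V) :
  \sum_x \sum_(t : {ffun 'I_n -> 'I_N.+1}) F (resample v x t) =
  \sum_x \sum_(t : {ffun 'I_n -> 'I_N.+1}) F x.
Proof.
rewrite !pair_big /=.
pose h (q : {ffun 'I_n -> place} * {ffun 'I_n -> 'I_N.+1}) :=
  (resample v q.1 q.2, [ffun e => if win q.1 e == v then (q.1 e).2 else q.2 e]).
have hK : involutive h.
  case=> x t; rewrite /h /=; congr pair; apply/ffunP => e; rewrite !ffunE win_resample.
    by case: (win x e == v) => //=; case: (x e).
  by case: (win x e == v).
rewrite [RHS](reindex_inj (inv_inj hK)); exact: eq_bigr.
Qed.

Lemma eq_sort_arrival x (y : {ffun 'I_n -> place}) (l : seq 'I_n) : uniq l ->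
  {in l, arrival tau x =1 arrival tau y} ->
  sort (relpre (arrival tau x) leq) l = sort (relpre (arrival tau y) leq) l.
Proof.
move=> ul E.
have tr : transitive (fun e s => (arrival tau y e < arrival tau y s)%N).
  by move=> ? ? ?; exact: ltn_trans.
apply: (irr_sorted_eq tr) => [?|||e]; rewrite ?ltnn ?sorted_pairwise ?sorted_arrival //.
  have := sorted_arrival tau x ul.
  have : {subset sort (relpre (arrival tau x) leq) l <= l} by move=> e; rewrite mem_sort.
  elim: (sort _ l) => //= e k IH sub /andP[/allP a b]; rewrite IH ?andbT //; last first.
    by move=> d dk; apply: sub; rewrite inE dk orbT.
  by apply/allP => d dk; rewrite -!E ?a // sub // inE ?eqxx // dk orbT.
by rewrite !mem_sort.
Qed.

Lemma early_resample v x t u : u != v -> early tau (resample v x t) u = early tau x u.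
Proof.
move=> uv; rewrite /early.
have -> : [seq e <- enum 'I_n | (win (resample v x t) e == u) && (slot (resample v x t) e == 0%N)] =
    [seq e <- enum 'I_n | (win x e == u) && (slot x e == 0%N)].
  apply: eq_filter => e; rewrite win_resample slot_resample.
  by case: (eqVneq (win x e) u) => //= ->; rewrite (negPf uv).
apply: eq_sort_arrival => [|e]; first by rewrite filter_uniq ?enum_uniq.
rewrite mem_filter => /andP[/andP[/eqP we _] _].
by rewrite /arrival slot_resample we (negPf uv).
Qed.

Lemma late_resample v x t u : u != v -> late tau (resample v x t) u = late tau x u.
Proof.
move=> uv; rewrite /late.
have -> : [seq e <- enum 'I_n | (win (resample v x t) e == u) && (0 < slot (resample v x t) e)%N] =
    [seq e <- enum 'I_n | (win x e == u) && (0 < slot x e)%N].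
  apply: eq_filter => e; rewrite win_resample slot_resample.
  by case: (eqVneq (win x e) u) => //= ->; rewrite (negPf uv).
apply: eq_sort_arrival => [|e]; first by rewrite filter_uniq ?enum_uniq.
rewrite mem_filter => /andP[/andP[/eqP we _] _].
by rewrite /arrival slot_resample we (negPf uv).
Qed.

Lemma xrun_resample v x t r w : (w <= v)%N ->
  xrun tau I (resample v x t) r w = xrun tau I x r w.
Proof.
move=> wv; apply: eq_run => u uw; have uv : u != v by rewrite ltn_eqF // (leq_trans uw).
by rewrite early_resample // late_resample.
Qed.

Lemma ntakes_resample v x t r : ntakes (resample v x t) r v = ntakes x r v.
Proof.
apply: eq_bigr => u _; have uv : u != v :> nat by rewrite neq_ltn ltn_ord.
rewrite /xtakes /takes_at early_resample // late_resample //.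
by have := xrun_resample x t r (ltnW (ltn_ord u)); rewrite /xrun => ->.
Qed.

Let z : R := 4%:R / 3%:R.

(** Each window multiplies the mean by at most [z * N.+1]: the potential starts at [N.+1], and the
    extra item of [size_xtakes] costs a factor [z]. *)
Lemma sum_ntakes r w : \sum_x z ^+ ntakes x r w <=
  (z * N.+1%:R) ^+ w * #|{ffun 'I_n -> place}|%:R.
Proof.
have z0 : 0 <= z by rewrite divr_ge0 ?ler0n.
have z1 : 1 <= z by rewrite /z; lra.
elim: w => [|w IH].
  rewrite (eq_bigr (fun=> 1)); last by move=> x _; rewrite /ntakes big_ord0.
  by rewrite sumr_const mul1r.
rewrite exprS -mulrA; apply: le_trans (ler_wpM2l _ IH); last by rewrite mulr_ge0 ?ler0n.
pose T : finType := {ffun 'I_n -> 'I_N.+1}.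
have T0 : (0 < #|T|)%N by apply/card_gt0P; exists [ffun=> ord0].
rewrite -(ler_pM2l (_ : 0 < #|T|%:R)) ?ltr0n //.
have -> : #|T|%:R * \sum_x z ^+ ntakes x r w.+1 =
    \sum_x \sum_(t : T) z ^+ ntakes (resample w x t) r w.+1.
  rewrite (sum_resample w (fun x => z ^+ ntakes x r w.+1)) mulr_sumr.
  by apply: eq_bigr => x _; rewrite sumr_const mulr_natl.
rewrite !mulr_sumr; apply: ler_sum => x _.
apply: le_trans (_ : z ^+ ntakes x r w * (z * \sum_(t : T)
   z ^+ minima N (window_items x r w) (fun e => t e)) <= _).
  rewrite !mulr_sumr; apply: ler_sum => t _.
  rewrite /ntakes big_ord_recr /= exprD -/(ntakes _ r w) ntakes_resample.
  rewrite ler_wpM2l ?exprn_ge0 // -exprS ler_weXn2l //.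
  apply: leq_trans (size_xtakes _ _ _) _.
  have -> : window_items (resample w x t) r w = window_items x r w.
    rewrite /window_items xrun_resample //; congr (sort _ _).
    by apply: eq_filter => e; rewrite win_resample.
  rewrite (@eq_minima _ _ _ _ (fun e => t e)) // => e; rewrite mem_window => we.
  by rewrite slot_resample we.
have uw : uniq (window_items x r w) by rewrite sort_uniq filter_uniq ?enum_uniq.
have h := @sum_minima R _ N N _ uw (leqnn N).
have ac (a b c e : R) : a * (b * c * e) = e * (b * (a * c)) by ring.
rewrite [leRHS]ac.
by rewrite ler_wpM2l ?exprn_ge0 // ler_wpM2l.
Qed.

End TakeCount.

(** * Random order and random windows *)

Section Arrivals.
Context {n : nat}.
Implicit Types (sigma : 'S_n) (c : nat -> nat).

Definition arrivals sigma : seq 'I_n := [seq sigma h | h <- enum 'I_n].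

Definition window_start c0 c1 v := (\sum_(u < v) (c0 u + c1 u))%N.

Definition early_of sigma c0 c1 v : seq 'I_n :=
  take (c0 v) (drop (window_start c0 c1 v) (arrivals sigma)).
Definition late_of sigma c0 c1 v : seq 'I_n :=
  take (c1 v) (drop (window_start c0 c1 v + c0 v) (arrivals sigma)).

End Arrivals.

Section Equidistribution.
Context {n m N : nat}.
Notation place := ('I_m * 'I_N.+1)%type.
Implicit Types (x : {ffun 'I_n -> place}) (tau rho sigma : 'S_n).

Definition early_count x v := #|[set e | (win x e == v) && (slot x e == 0%N)]|.
Definition late_count x v := #|[set e | (win x e == v) && (0 < slot x e)%N]|.

Definition order tau x : seq 'I_n :=
  flatten [seq early tau x v ++ late tau x v | v <- iota 0 m].

Lemma size_early tau x v : size (early tau x v) = early_count x v.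
Proof.
rewrite size_sort -(card_uniqP _); last by rewrite filter_uniq // enum_uniq.
by apply: eq_card => e; rewrite mem_filter mem_enum inE andbT.
Qed.

Lemma size_late tau x v : size (late tau x v) = late_count x v.
Proof.
rewrite size_sort -(card_uniqP _); last by rewrite filter_uniq // enum_uniq.
by apply: eq_card => e; rewrite mem_filter mem_enum inE andbT.
Qed.

Lemma window_uniq tau x v : uniq (early tau x v ++ late tau x v).
Proof.
have uf P : uniq [seq e <- enum 'I_n | P e] by rewrite filter_uniq // enum_uniq.
rewrite cat_uniq !sort_uniq !uf andbT /=; apply/hasPn => e.
by rewrite mem_late mem_early => /andP[_]; rewrite lt0n => /negPf ->; rewrite andbF.
Qed.

Lemma mem_window_cat tau x v e : (e \in early tau x v ++ late tau x v) = (win x e == v).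
Proof.
by rewrite mem_cat mem_early mem_late -andb_orr lt0n orbN andbT.
Qed.

Lemma order_uniq tau x : uniq (order tau x).
Proof.
rewrite /order; elim: (iota 0 m) (iota_uniq 0 m) => //= v l IH /andP[vl ul].
rewrite cat_uniq window_uniq IH // andbT /=; apply/hasPn => e.
case/flattenP => k /mapP[u ul' ->]; rewrite mem_window_cat => /eqP we.
by rewrite mem_window_cat we; apply: contraNneq vl => <-.
Qed.

Lemma mem_order tau x e : e \in order tau x.
Proof.
apply/flattenP; exists (early tau x (win x e) ++ late tau x (win x e)).
  by apply/mapP; exists (win x e); rewrite // mem_iota /= add0n /win.
by rewrite mem_window_cat.
Qed.

Lemma size_order tau x : size (order tau x) = n.
Proof.
have /card_uniqP <- := order_uniq tau x.
rewrite -[RHS]card_ord; apply: eq_card => e; by rewrite mem_order.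
Qed.

Lemma order_inj tau x : injective (fun h : 'I_n => nth h (order tau x) h).
Proof.
move=> h h' /= e; apply/val_inj/eqP.
rewrite -(nth_uniq h (s := order tau x)) ?size_order ?order_uniq ?ltn_ord //.
by rewrite e (set_nth_default h) ?size_order ?ltn_ord.
Qed.

(** The arrival order that realises the windows and slots of [x] with the tie-breaking of [tau]. *)
Definition arrange tau x : 'S_n := perm (@order_inj tau x).

Lemma arrivals_arrange tau x : arrivals (arrange tau x) = order tau x.
Proof.
have sa : size (arrivals (arrange tau x)) = n by rewrite size_map size_enum_ord.
have [n0|n0] := posnP n.
  by rewrite (size0nil (etrans sa n0)) (size0nil (etrans (size_order tau x) n0)).
have h0 : 'I_n by exact: Ordinal n0.
apply: (@eq_from_nth _ h0); rewrite sa ?size_order // => i i_n.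
rewrite (nth_map h0) ?size_enum_ord // permE /=.
by rewrite (nth_enum_ord h0 i_n) (set_nth_default h0) ?size_order.
Qed.

Lemma window_start_order tau x v : (v <= m)%N ->
  window_start (early_count x) (late_count x) v =
  size (flatten [seq early tau x u ++ late tau x u | u <- iota 0 v]).
Proof.
rewrite /window_start; elim: v => [|v IH] vm; first by rewrite big_ord0.
rewrite -[in RHS](addn1 v) iotaD map_cat flatten_cat size_cat add0n -IH 1?ltnW //.
by rewrite /= cats0 size_cat size_early size_late big_ord_recr.
Qed.

Lemma order_split tau x v : (v < m)%N -> exists l,
  drop (window_start (early_count x) (late_count x) v) (order tau x) =
  early tau x v ++ late tau x v ++ l.
Proof.
move=> vm; rewrite (window_start_order tau x (ltnW vm)) /order.
have -> : iota 0 m = iota 0 v ++ v :: iota v.+1 (m - v.+1).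
  by rewrite -[v :: _]/(iota v (m - v.+1).+1) -subSn // subSS -{1}(subnKC (ltnW vm)) iotaD add0n.
rewrite map_cat flatten_cat drop_size_cat //= -catA.
by eexists.
Qed.

Lemma early_of_arrange tau x v : (v < m)%N ->
  early_of (arrange tau x) (early_count x) (late_count x) v = early tau x v.
Proof.
move=> vm; rewrite /early_of arrivals_arrange; have [l ->] := order_split tau x vm.
by rewrite -(size_early tau) take_size_cat.
Qed.

Lemma late_of_arrange tau x v : (v < m)%N ->
  late_of (arrange tau x) (early_count x) (late_count x) v = late tau x v.
Proof.
move=> vm; rewrite /late_of arrivals_arrange addnC -drop_drop; have [l ->] := order_split tau x vm.
by rewrite -(size_early tau) drop_size_cat // -(size_late tau) take_size_cat.
Qed.

Definition relabel rho x : {ffun 'I_n -> place} := [ffun e => x (rho e)].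

Lemma relabel_arrival rho tau x e :
  arrival (rho * tau)%g (relabel rho x) e = arrival tau x (rho e).
Proof. by rewrite /arrival /slot ffunE permM. Qed.

Lemma early_relabel rho tau x v :
  early (rho * tau)%g (relabel rho x) v = map (rho^-1)%g (early tau x v).
Proof.
have tr : transitive (fun e s => (arrival (rho * tau)%g (relabel rho x) e <
    arrival (rho * tau)%g (relabel rho x) s)%N) by move=> ? ? ?; exact: ltn_trans.
apply: (irr_sorted_eq tr) => [?|||e]; rewrite ?ltnn // ?sorted_pairwise //.
- exact: early_pairwise.
- rewrite pairwise_map; apply: sub_pairwise (early_pairwise tau x v) => e s /=.
  by rewrite !relabel_arrival !permKV.
rewrite mem_early -[X in X \in map _ _](permK rho) mem_map; last exact: perm_inj.
by rewrite mem_early /win /slot ffunE.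
Qed.

Lemma late_relabel rho tau x v :
  late (rho * tau)%g (relabel rho x) v = map (rho^-1)%g (late tau x v).
Proof.
have tr : transitive (fun e s => (arrival (rho * tau)%g (relabel rho x) e <
    arrival (rho * tau)%g (relabel rho x) s)%N) by move=> ? ? ?; exact: ltn_trans.
apply: (irr_sorted_eq tr) => [?|||e]; rewrite ?ltnn // ?sorted_pairwise //.
- exact: late_pairwise.
- rewrite pairwise_map; apply: sub_pairwise (late_pairwise tau x v) => e s /=.
  by rewrite !relabel_arrival !permKV.
rewrite mem_late -[X in X \in map _ _](permK rho) mem_map; last exact: perm_inj.
by rewrite mem_late /win /slot ffunE.
Qed.

Lemma arrange_relabel rho tau x :
  arrange (rho * tau)%g (relabel rho x) = (arrange tau x * rho^-1)%g.
Proof.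
apply/permP => h; have A t y : arrange t y h = nth h (order t y) h by rewrite permE.
rewrite permM !A.
have -> : order (rho * tau)%g (relabel rho x) = map (rho^-1)%g (order tau x).
  rewrite /order map_flatten -map_comp; congr flatten; apply: eq_map => v /=.
  by rewrite map_cat early_relabel late_relabel.
by rewrite (nth_map h) ?size_order ?ltn_ord.
Qed.

Lemma early_count_relabel rho x : early_count (relabel rho x) =1 early_count x.
Proof.
move=> v; rewrite -!(size_early 1%g) -(mulgV rho).
by rewrite early_relabel size_map !size_early.
Qed.

Lemma late_count_relabel rho x : late_count (relabel rho x) =1 late_count x.
Proof.
move=> v; rewrite -!(size_late 1%g) -(mulgV rho).
by rewrite late_relabel size_map !size_late.
Qed.

(** Renaming the items by [rho] keeps all counts and multiplies [arrange tau x] by [rho^-1].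
    Averaging over [rho] therefore makes the arrival order uniform and independent of the counts, as
    it is for a program that draws the counts by itself. *)
Lemma equidistribution (R : realType) (F : 'S_n -> (nat -> nat) -> (nat -> nat) -> R) :
  \sum_sigma \sum_x F sigma (early_count x) (late_count x) =
  \sum_tau \sum_x F (arrange tau x) (early_count x) (late_count x).
Proof.
pose G x sigma := F sigma (early_count x) (late_count x).
rewrite -[LHS]/(\sum_sigma \sum_x G x sigma) -[RHS]/(\sum_tau \sum_x G x (arrange tau x)).
have Grel rho x sigma : G (relabel rho x) sigma = G x sigma.
  rewrite /G; congr (F _ _ _); apply: boolp.funext; [exact: early_count_relabel | exact: late_count_relabel].
have key rho : \sum_tau \sum_x G x (arrange tau x) =
    \sum_tau \sum_x G x (arrange tau x * rho^-1)%g.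
  rewrite (reindex_inj (mulgI rho)) /=; apply: eq_bigr => tau _.
  have rK : cancel (relabel rho) (relabel (rho^-1)%g).
    by move=> x; apply/ffunP => e; rewrite !ffunE permKV.
  rewrite (reindex_inj (can_inj rK)) /=; apply: eq_bigr => x _.
  by rewrite Grel arrange_relabel.
have n0 : #|{perm 'I_n}|%:R != 0 :> R.
  by rewrite pnatr_eq0 -lt0n; apply/card_gt0P; exists 1%g.
apply: (mulfI n0); rewrite !mulr_natl -!sumr_const.
rewrite [RHS](eq_bigr _ (fun rho _ => key rho)).
rewrite [LHS](eq_bigr (fun tau => \sum_x \sum_sigma G x sigma)); last first.
  by move=> tau _; rewrite exchange_big.
rewrite [RHS]exchange_big /=; apply: eq_bigr => tau _.
rewrite [RHS]exchange_big /=; apply: eq_bigr => x _.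
rewrite [LHS](reindex_inj (mulgI (arrange tau x))) /= [LHS](reindex_inj invg_inj).
by [].
Qed.

End Equidistribution.

(** * The competitive ratio *)

Section Ratio.
Context {R : realType}.
Implicit Types (y d c : R).

(** This is 1 + t <= e^t at t = c y. It makes the cost of an error in the exponent uniform in [y],
    hence in [p]. *)
Lemma expRN_ge_mul c y : 0 < c -> y * expR (- (c * y)) <= c^-1.
Proof.
move=> c0; have e0 := expR_gt0 (c * y).
rewrite expRN ler_pdivrMr // -(ler_pM2l c0) mulrA mulrC divff ?gt_eqF // mul1r mulrC.
by have := expR_ge1Dx (c * y); lra.
Qed.

Lemma bernoulli_ge q k : 0 <= q <= 1 -> 1 - k%:R * q <= (1 - q) ^+ k :> R.
Proof.
case/andP=> q0 q1; elim: k => [|k IH]; first by rewrite mul0r subr0.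
have q1' : 0 <= 1 - q by rewrite subr_ge0.
rewrite exprS; apply: le_trans (ler_wpM2l q1' IH).
rewrite -[k.+1]addn1 natrD; have := mulr_ge0 (mulr_ge0 q0 q0) (ler0n R k); nra.
Qed.

(** Take [c] at its least value (1-d)^2. The exponential then grows by at most 4 d, as 1 - c <= 2 d
    and y e^(-c y) <= 1/c <= 2; the outer factor costs one more [d]. *)
Lemma perturbed_exponent d y c : 0 <= d -> d <= 28%:R^-1 -> 0 <= y -> (1 - d) ^+ 2 <= c ->
  1 - expR (- y) - 5%:R * d <= (1 - d) * (1 - expR (- (c * y))).
Proof.
move=> d0 d1 y0 dc; set c' := (1 - d) ^+ 2 in dc.
have c'E : c' = 1 - 2%:R * d + d * d by rewrite /c'; ring.
have dd : 0 <= d * d by rewrite mulr_ge0.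
have c'0 : 2%:R^-1 <= c' by rewrite c'E; lra.
have c'p : 0 < c' by apply: lt_le_trans c'0; rewrite invr_gt0 ltr0n.
have e1 : expR (- (c * y)) <= expR (- (c' * y)) by rewrite ler_expR lerN2 ler_wpM2r.
have e2 : expR (- (c' * y)) * (1 - (1 - c') * y) <= expR (- y).
  have -> : - y = - (c' * y) + - ((1 - c') * y) by ring.
  by rewrite expRD ler_wpM2l ?expR_ge0 // expR_ge1Dx.
have e3 := expRN_ge_mul y c'p.
have e4 : c'^-1 <= 2%:R by rewrite -[2%:R]invrK lef_pV2 ?posrE ?invr_gt0 ?ltr0n.
have e5 : (1 - c') * (y * expR (- (c' * y))) <= (2%:R * d) * 2%:R.
  apply: ler_pM; rewrite ?mulr_ge0 ?expR_ge0 ?(le_trans e3) //; rewrite c'E; nra.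
have e6 : expR (- (c' * y)) <= 1 by rewrite expR_le1 oppr_le0 mulr_ge0 // ltW.
have e7 := expR_ge0 (- (c' * y)).
have e8 := expR_ge0 (- (c * y)).
have e9 : d * expR (- (c * y)) <= d * 1 by apply: ler_wpM2l => //; exact: le_trans e1 e6.
have e10 : 0 <= d * expR (- (c * y)) by rewrite mulr_ge0.
rewrite mulrBl mul1r; move: e2 e5 e1 e9 e10.
set X := expR (- (c * y)); set Z := expR (- (c' * y)); set W := expR (- y); lra.
Qed.

(** The derivative in u has the sign of e^(-u) (1 + u) - (1 - d), and e^(-u) (1 + u) <= 3/4 for u >=
    2, because e^u >= (1 + u/2)^2. This is the origin of the bounds on [d] and [u]. *)
Lemma ratio_antimono d (u v : R) : d <= 4%:R^-1 -> 2%:R <= u -> u <= v ->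
  (1 - expR (- v) - d) / v <= (1 - expR (- u) - d) / u.
Proof.
move=> d1 u2 uv; have u0 : 0 < u by lra.
have v0 : 0 < v by lra.
rewrite ler_pdivrMr // mulrAC ler_pdivlMr //.
have e1 : expR (- u) * (1 - (v - u)) <= expR (- v).
  have -> : - v = - u + - (v - u) by ring.
  by rewrite expRD ler_wpM2l ?expR_ge0 // expR_ge1Dx.
have e2 : expR (- u) * (1 + u) <= 3%:R / 4%:R.
  have h : (1 + u / 2%:R) ^+ 2 <= expR u.
    have -> : u = u / 2%:R + u / 2%:R :> R by field.
    rewrite expRD -expr2; have -> : (u / 2%:R + u / 2%:R) / 2%:R = u / 2%:R by field.
    by apply: lerXn2r; rewrite ?nnegrE ?expR_ge0 ?expR_ge1Dx //; lra.
  rewrite expRN mulrC ler_pdivrMr ?expR_gt0 //; move: h; rewrite expr2; nra.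
have e3 : 0 <= (v - u) * (1 - d - expR (- u) * (1 + u)).
  by apply: mulr_ge0; lra.
have e4 := ler_wpM2l (ltW u0) e1.
move: e3 e4; set X := expR (- u); set Y := expR (- v); lra.
Qed.

(** The losses add up to 7 d: five from the perturbed exponent, and two from the overflow, since
    2^-m <= 1/m = d/k and y <= 2 k. The constant 28 is 4 times 7: it covers the losses by eps and
    also gives 7 d <= 1/4, as [ratio_antimono] requires when k < p. *)
Lemma final_ratio (p k N m : nat) (eps : R) (y : R := (minn p k).+1%:R)
  (d : R := N.+1%:R^-1) (coef : R := (1 - d) * (1 - m%:R^-1) ^+ k) : eps < 1 -> 28%:R / eps <= N.+1%:R -> 0 < eps ->
  (0 < k)%N -> m = (N.+1 * k)%N ->
  p.+1%:R^-1 * (1 - (expR 1 ^+ p.+1)^-1 - eps) + 2%:R^-1 ^+ m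
    <= (1 - d) * (1 - expR (- (coef * y))) / y.
Proof.
move=> e1 Ne e0 k0 mE.
have N0 : 0 < N.+1%:R :> R by rewrite ltr0n.
have kR : 0 < k%:R :> R by rewrite ltr0n.
have d0 : 0 <= d by rewrite invr_ge0 ler0n.
have dN : d * N.+1%:R = 1 by rewrite mulVf ?gt_eqF.
have de : 28%:R * d <= eps.
  by move: Ne; rewrite ler_pdivrMr // => h; have := ler_wpM2l d0 h; nra.
have y0 : 0 < y by rewrite ltr0n.
have mk : k%:R * m%:R^-1 = d.
  rewrite mE natrM invfM mulrCA mulfV ?mulr1 // gt_eqF //.
have m0 : (0 < m)%N by rewrite mE muln_gt0 k0.
have q01 : 0 <= (m%:R^-1 : R) <= 1 by rewrite invr_ge0 ler0n invf_le1 ?ltr0n // ler1n.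
have cd : (1 - d) ^+ 2 <= coef.
  rewrite expr2 ler_wpM2l //; first by lra.
  by have := bernoulli_ge k q01; rewrite mk.
have d28 : d <= 28%:R^-1 by lra.
have h1 := perturbed_exponent d0 d28 (ltW y0) cd.
have yk : y <= 2%:R * k%:R.
  rewrite -natrM ler_nat mul2n -addnn; apply: leq_trans (_ : k.+1 <= _)%N.
    by rewrite ltnS geq_minr.
  by rewrite -addn1 leq_add2l.
have h2 : 2%:R^-1 ^+ m <= 2%:R * d / y :> R.
  apply: le_trans (_ : m%:R^-1 <= _).
    rewrite exprVn lef_pV2 ?posrE ?exprn_gt0 ?ltr0n // -natrX ler_nat.
    by apply: ltnW; exact: ltn_expl.
  rewrite ler_pdivlMr // -mk; have := ler_wpM2l (proj1 (andP q01)) yk; lra.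
apply: le_trans (_ : (1 - expR (- y) - 7%:R * d) / y + 2%:R * d / y <= _); last first.
  rewrite -mulrDl; apply: ler_wpM2r; [by rewrite invr_ge0 ltW | lra].
apply: lerD => //.
have -> : (expR 1 ^+ p.+1)^-1 = expR (- p.+1%:R) :> R by rewrite expRN -expRM_natl mulr1.
rewrite mulrC; apply: le_trans (_ : (1 - expR (- p.+1%:R) - 7%:R * d) / p.+1%:R <= _).
  by rewrite ler_wpM2r ?invr_ge0 ?ler0n //; lra.
have [pk|kp] := leqP p k; first by rewrite /y (minn_idPl pk).
apply: ratio_antimono.
- lra.
- by rewrite /y ler_nat ltnS (minn_idPr (ltnW kp)).
- by rewrite /y ler_nat ltnS geq_minl.
Qed.

End Ratio.

(** * Expected value under the cap on the shortlist *)

Section Expectation.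
Context {R : realType} {n : nat}.
Variable I : instance R n.
Hypotheses (f0 : nonnegative (val_f I)) (fm : monotone (val_f I))
  (fs : submodular (val_f I)).
Variable p : nat.
Hypothesis mp : is_matchoid p I.

(* The value guaranteed when at most [cap] items fit on the shortlist. *)
Definition outcome m cap (sigma : 'S_n) (c0 c1 r : nat -> nat) : R :=
  let l0 := early_of sigma c0 c1 in let l1 := late_of sigma c0 c1 in
  if (\sum_(v < m) size (takes_at I l0 l1 r v) <= cap)%N
  then solval I (run I l0 l1 r m) else 0.

Lemma outcome_arrange m N cap (tau : 'S_n) (x : {ffun 'I_n -> 'I_m * 'I_N.+1}) r :
  outcome m cap (arrange tau x) (early_count x) (late_count x) r =
  if (ntakes tau I x r m <= cap)%N then solval I (xrun tau I x r m) else 0.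
Proof.
rewrite /outcome.
have E w : (w <= m)%N -> run I (early_of (arrange tau x) (early_count x) (late_count x))
    (late_of (arrange tau x) (early_count x) (late_count x)) r w = xrun tau I x r w.
  move=> wm; apply: eq_run => v vw; have vm := leq_trans vw wm.
  by rewrite early_of_arrange // late_of_arrange.
rewrite E //; congr (if (_ <= _)%N then _ else _); apply: eq_bigr => v _.
by rewrite /xtakes /takes_at E ?(ltnW (ltn_ord v)) // early_of_arrange // late_of_arrange.
Qed.

Lemma sum_outcome N L (k := max_feasible_size I) (m := (N.+1 * k)%N)
    (y : R := (minn p k).+1%:R) (d : R := N.+1%:R^-1)
    (coef := (1 - d) * (1 - m%:R^-1) ^+ k) :
  (0 < N)%N -> (0 < k)%N -> 2%:R * (4%:R / 3%:R * N.+1%:R) <= (4%:R / 3%:R) ^+ L :> R ->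
  (n`!)%:R * #|{ffun 'I_n -> 'I_m * 'I_N.+1}|%:R * #|{ffun 'I_m -> 'I_m}|%:R *
   (((1 - d) * (1 - expR (- (coef * y))) / y - 2%:R^-1 ^+ m) * OPT I) <=
  \sum_sigma \sum_(x : {ffun 'I_n -> 'I_m * 'I_N.+1}) \sum_(r : {ffun 'I_m -> 'I_m})
    outcome m (m * L) sigma (early_count x) (late_count x) (tape r).
Proof.
move=> N0 k0 zL; set z : R := 4%:R / 3%:R in zL.
have z0 : 0 < z by rewrite divr_gt0 ?ltr0n.
have z1 : 1 <= z by rewrite /z; lra.
have [O Of OE] := OPT_attained f0.
have Ok : (#|O| <= k)%N := feasible_card Of.
have km : (k < m)%N by rewrite /m mulSn -[ltnLHS]addn0 ltn_add2l muln_gt0 N0 k0.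
have opt0 : 0 <= OPT I by rewrite -OE f0.
rewrite (equidistribution (fun sigma c0 c1 => \sum_(r : {ffun 'I_m -> 'I_m}) outcome m (m * L) sigma c0 c1 (tape r))).
set X := #|{ffun 'I_n -> _}|%:R; set T := #|{ffun 'I_m -> _}|%:R.
have -> : (n`!)%:R = #|{perm 'I_n}|%:R :> R.
  by rewrite card_Sn.
set W := (_ - _) * OPT I.
rewrite -!mulrA mulr_natl -sumr_const; apply: ler_sum => tau _.
have tv := @total_value_ge R n m N tau I f0 fm O k Ok fs Of p mp km.
rewrite -/d -/coef -/y -/X -/T OE in tv.
have y0 : 0 < y by rewrite ltr0n.
(* The exponential Markov inequality, pointwise: on overflow the subtracted term is at least
   [OPT I]. *)
have out (x : {ffun 'I_n -> 'I_m * 'I_N.+1}) r : solval I (xrun tau I x (tape r) m) -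
    OPT I * (z ^- (m * L) * z ^+ ntakes tau I x (tape r) m) <=
    outcome m (m * L) (arrange tau x) (early_count x) (late_count x)
      (tape (r : {ffun 'I_m -> 'I_m})) :> R.
  rewrite outcome_arrange; case: leqP => h.
    by rewrite gerBl // mulr_ge0 // mulr_ge0 ?invr_ge0 ?exprn_ge0 ?ltW.
  have v := xrun_valid tau f0 fm x (tape r) m.
  have sO : solval I (xrun tau I x (tape r) m) <= OPT I.
    by apply: best_within_ge (valid_feas v); exact: subsetT.
  rewrite subr_le0; apply: le_trans sO _; rewrite ler_peMr //.
  rewrite ler_pdivlMl ?exprn_gt0 // mulr1 ler_weXn2l //; exact: ltnW.
apply: le_trans (ler_sum _ (fun x _ => ler_sum _ (fun r _ => out x r))).
rewrite exchange_big /=; under eq_bigr do rewrite sumrB -mulr_sumr -mulr_sumr.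
rewrite sumrB -!mulr_sumr -/(@total_value R n m N tau I m).
have nt : \sum_(r : {ffun 'I_m -> 'I_m}) \sum_(x : {ffun 'I_n -> 'I_m * 'I_N.+1}) z ^+ ntakes tau I x (tape r) m <=
    T * ((z * N.+1%:R) ^+ m * X).
  rewrite /T mulr_natl -sumr_const; apply: ler_sum => r _; exact: sum_ntakes.
(* The hypothesis on [L] makes the factor of each window at most 1/2. *)
have zz : z ^- (m * L) * (z * N.+1%:R) ^+ m <= 2%:R^-1 ^+ m.
  have zn : 0 <= z := ltW z0.
  rewrite mulnC exprM -exprVn -exprMn; apply: lerXn2r;
    rewrite ?nnegrE ?mulr_ge0 ?invr_ge0 ?exprn_ge0 ?ler0n //.
  by rewrite ler_pdivrMl ?exprn_gt0 // ler_pdivlMr ?ltr0n // mulrC.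
have B : OPT I * (z ^- (m * L) * \sum_(r : {ffun 'I_m -> 'I_m})
      \sum_(x : {ffun 'I_n -> 'I_m * 'I_N.+1}) z ^+ ntakes tau I x (tape r) m) <=
    X * T * (2%:R^-1 ^+ m * OPT I).
  apply: le_trans (_ : OPT I * (z ^- (m * L) * (T * ((z * N.+1%:R) ^+ m * X))) <= _).
    by rewrite ler_wpM2l // ler_wpM2l // invr_ge0 exprn_ge0 // ltW.
  have ac (o u t v x : R) : o * (u * (t * (v * x))) = x * t * ((u * v) * o) by ring.
  by rewrite ac ler_wpM2l ?mulr_ge0 ?ler0n // ler_wpM2r.
have A : X * T * ((1 - d) * (1 - expR (- (coef * y))) / y * OPT I) <= @total_value R n m N tau I m.
  rewrite -(ler_pM2l y0); apply: le_trans tv.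
  have ac (u x t g o : R) : u != 0 -> u * (x * t * (g / u * o)) = t * x * g * o.
    by move=> u0; field.
  by rewrite ac // gt_eqF.
by rewrite mulrA /W mulrBl mulrBr; apply: lerB.
Qed.

End Expectation.

(** * Reasoning about programs *)

Section Exec.
Context {R : realType} {n : nat}.
Variables (I : instance R n) (sigma : 'S_n).
Implicit Types (s : state R n) (c cs : seq cmd) (Q : state R n -> Prop) (t : nat).

(* Predicates on states never look at the field [todo]: the commands still to be
   executed are supplied by [conf]. *)
Definition conf cs s : state R n := State cs (nmem s) (rmem s) (seen s) (shortlist s).

Definition setn s b j v : state R n :=
  State [::] (put (nmem s) b j v) (rmem s) (seen s) (shortlist s).
Definition setr s b j v : state R n :=
  State [::] (nmem s) (put (rmem s) b j v) (seen s) (shortlist s).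

Lemma evaln_conf cs s e : evaln (conf cs s) e = evaln s e.
Proof. by elim: e => //= [a -> i ->|a -> i ->|a -> i ->]. Qed.

Lemma evalr_conf cs s e : evalr (conf cs s) e = evalr s e.
Proof. by elim: e => //= [e|a i|a -> i ->|a -> i ->] //; rewrite !evaln_conf. Qed.

Lemma evalt_conf cs s e : evalt (conf cs s) e = evalt s e.
Proof. by case: e => a b /=; rewrite ?evaln_conf ?evalr_conf. Qed.

Fixpoint reach t s s' : Prop :=
  if t is t'.+1 then exists2 s1, step I sigma s = [:: s1] & reach t' s1 s' else s = s'.

Lemma reach_trans t t' s s' s'' : reach t s s' -> reach t' s' s'' -> reach (t + t') s s''.
Proof.
by elim: t s => [|t IH] s /= => [->//|[s1 e r] r']; exists s1 => //; exact: IH r'.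
Qed.

(** A total correctness triple with a time bound for code without draws; it is quantified over the
    commands that follow so that triples compose. *)
Definition exec c t Q s := forall cs, exists t' s',
  [/\ (t' <= t)%N, reach t' (conf (c ++ cs) s) (conf cs s') & Q s'].

Lemma exec_nil t Q s : Q s -> exec [::] t Q s.
Proof. by move=> q cs; exists 0%N, s; split. Qed.

Lemma exec_le t t' c Q s : (t <= t')%N -> exec c t Q s -> exec c t' Q s.
Proof.
move=> le h cs; have [u [s' [ut r q]]] := h cs; exists u, s'; split=> //.
exact: leq_trans ut le.
Qed.

Lemma exec_imp c t Q Q' s : (forall s', Q s' -> Q' s') -> exec c t Q s -> exec c t Q' s.
Proof.
by move=> QQ' h cs; have [u [s' [ut r q]]] := h cs; exists u, s'; split=> //; exact: QQ'.
Qed.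

Lemma exec_cat c1 c2 t1 t2 Q s : exec c1 t1 (exec c2 t2 Q) s -> exec (c1 ++ c2) (t1 + t2) Q s.
Proof.
move=> h cs; have [u1 [s1 [l1 r1 h2]]] := h (c2 ++ cs); have [u2 [s2 [l2 r2 q]]] := h2 cs.
exists (u1 + u2)%N, s2; split; rewrite ?leq_add // -catA; exact: reach_trans r1 r2.
Qed.

Lemma exec_seq c1 c2 t1 t2 t Q s : exec c1 t1 (exec c2 t2 Q) s -> (t1 + t2 <= t)%N ->
  exec (c1 ++ c2) t Q s.
Proof. by move=> h le; exact: exec_le le (exec_cat h). Qed.

Lemma exec_step c a t Q s s' :
  (forall cs, step I sigma (conf (a :: cs) s) = [:: conf cs s']) ->
  exec c t Q s' -> exec (a :: c) t.+1 Q s.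
Proof.
move=> e h cs; have [u [s1 [l r q]]] := h cs.
by exists u.+1, s1; split=> //=; exists (conf (c ++ cs) s') => //; exact: e.
Qed.

Lemma exec_nset e b j c t Q s :
  exec c t Q (setn s (evaln s b) (evaln s j) (evaln s e)) -> exec (NSet e b j :: c) t.+1 Q s.
Proof. by apply: exec_step => cs; rewrite /step /= !evaln_conf. Qed.

Lemma exec_rset e b j c t Q s :
  exec c t Q (setr s (evaln s b) (evaln s j) (evalr s e)) -> exec (RSet e b j :: c) t.+1 Q s.
Proof. by apply: exec_step => cs; rewrite /step /= !evaln_conf evalr_conf. Qed.

Lemma exec_value a l b j c t Q s :
  exec c t Q (setr s (evaln s b) (evaln s j)
    (val_f I (denoted_set sigma s (evaln s a) (evaln s l)))) ->
  exec (Value a l b j :: c) t.+1 Q s.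
Proof. by apply: exec_step => cs; rewrite /step /= !evaln_conf. Qed.

Lemma exec_indep i a l b j c t Q s :
  exec c t Q (setn s (evaln s b) (evaln s j)
    (is_indep I (evaln s i) (denoted_set sigma s (evaln s a) (evaln s l)))) ->
  exec (Indep i a l b j :: c) t.+1 Q s.
Proof. by apply: exec_step => cs; rewrite /step /= !evaln_conf. Qed.

Lemma exec_incid h k b j c t Q s :
  exec c t Q (setn s (evaln s b) (evaln s j)
    (nth 0%N [seq (nat_of_ord i).+1 | i <- matroids_of I sigma s (evaln s h)] (evaln s k))) ->
  exec (Incid h k b j :: c) t.+1 Q s.
Proof. by apply: exec_step => cs; rewrite /step /= !evaln_conf. Qed.

Lemma exec_next c t Q s :
  exec c t Q (State [::] (nmem s) (rmem s) (minn (seen s).+1 n) (shortlist s)) ->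
  exec (Next :: c) t.+1 Q s.
Proof. exact: exec_step. Qed.

Lemma exec_accept c t Q s :
  exec c t Q (State [::] (nmem s) (rmem s) (seen s)
    (shortlist s :|: current_item sigma s)) ->
  exec (Accept :: c) t.+1 Q s.
Proof. exact: exec_step. Qed.

Lemma exec_if b c1 c2 c t1 t t2 Q s :
  exec (if evalt s b then c1 else c2) t1 (exec c t Q) s -> (t1 + t < t2)%N ->
  exec (If b c1 c2 :: c) t2 Q s.
Proof.
move=> /exec_cat h le; apply: (exec_le le) => cs; have [u [s' [l r q]]] := h cs.
exists u.+1, s'; split=> //=; eexists; first by [].
by rewrite /= evalt_conf catA.
Qed.

Definition var j := NCell (NLit 0) (NLit j).
Definition assign j e := NSet e (NLit 0) (NLit j).
Definition incr j := assign j (NAdd (var j) (NLit 1)).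
Definition for_to j bound body :=
  [:: assign j (NLit 0); While (NLt (var j) bound) (body ++ [:: incr j])].

(** Each round has two extra steps, the test and the increment; the other two are the initialisation
    and the failing test. *)
Lemma exec_for_sum j bound body (P : nat -> state R n -> Prop) m (t : nat -> nat) s :
  P 0%N (setn s 0 j 0) ->
  (forall i s, P i s -> nmem s 0 j = i /\ evaln s bound = m) ->
  (forall i s, (i < m)%N -> P i s ->
     exec body (t i) (fun s' => nmem s' 0 j = i /\ P i.+1 (setn s' 0 j i.+1)) s) ->
  exec (for_to j bound body) (2 + \sum_(i < m) (t i).+2) (P m) s.
Proof.
move=> P0 Pb Pstep; apply: exec_nset => /=.
suff loop d i s0 : (i + d)%N = m -> P i s0 ->
    exec [:: While (NLt (var j) bound) (body ++ [:: incr j])]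
      (\sum_(i <= u < m) (t u).+2).+1 (P m) s0.
  by rewrite -(big_mkord xpredT (fun u => (t u).+2)); exact: (loop m 0%N).
elim: d i s0 => [|d IH] i s0 => im Pi cs; have [ji bi] := Pb i s0 Pi.
  exists 1%N, s0; split=> //=; last by rewrite -im addn0.
  eexists; first by []. by rewrite /= !evaln_conf ji bi -im addn0 ltnn.
have lt : (i < m)%N by rewrite -im -addn1 leq_add2l.
have [t1 [s1 [l1 r1 [ji1 P1]]]] :=
  Pstep i s0 lt Pi (incr j :: While (NLt (var j) bound) (body ++ [:: incr j]) :: cs).
have [t2 [s2 [l2 r2 Q2]]] := IH i.+1 _ (etrans (addSnnS _ _) im) P1 cs.
exists (1 + (t1 + (1 + t2)))%N, s2; split=> //; first by rewrite big_ltn //; lia.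
apply: (@reach_trans 1 (t1 + (1 + t2)) _
  (conf ((body ++ [:: incr j]) ++ While (NLt (var j) bound) (body ++ [:: incr j]) :: cs) s0)).
  by eexists => //; rewrite /= !evaln_conf ji bi lt.
rewrite -catA; apply: reach_trans r1 _.
apply: (@reach_trans 1 t2 _ (conf (While (NLt (var j) bound) (body ++ [:: incr j]) :: cs)
  (setn s1 0 j i.+1))); last exact: r2.
by eexists => //; rewrite /= ji1 addn1.
Qed.

Lemma exec_for j bound body (P : nat -> state R n -> Prop) m t s :
  P 0%N (setn s 0 j 0) ->
  (forall i s, P i s -> nmem s 0 j = i /\ evaln s bound = m) ->
  (forall i s, (i < m)%N -> P i s ->
     exec body t (fun s' => nmem s' 0 j = i /\ P i.+1 (setn s' 0 j i.+1)) s) ->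
  exec (for_to j bound body) (2 + m * t.+2) (P m) s.
Proof.
move=> P0 Pb Ps; have := exec_for_sum P0 Pb Ps.
by rewrite sum_nat_const card_ord.
Qed.

(* [bs] lists the ranges of the draws and [Q] relates their outcomes to the final
   state. *)
Inductive drun : nat -> seq nat -> (seq nat -> state R n -> Prop) -> state R n -> Prop :=
| drun_halt T (Q : seq nat -> state R n -> Prop) s : nilp (todo s) -> Q [::] s -> drun T [::] Q s
| drun_det T bs (Q : seq nat -> state R n -> Prop) s s' : step I sigma s = [:: s'] -> drun T bs Q s' -> drun T.+1 bs Q s
| drun_draw T b bs (Q : seq nat -> state R n -> Prop) s (f : nat -> state R n) : (0 < b)%N ->
    step I sigma s = [seq f v | v <- iota 0 b] ->
    (forall v, (v < b)%N -> drun T bs (fun d => Q (v :: d)) (f v)) ->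
    drun T.+1 (b :: bs) Q s.

Fixpoint mean bs (H : seq nat -> R) : R :=
  if bs is b :: bs' then (\sum_(v < b) mean bs' (fun d => H (nat_of_ord v :: d))) / b%:R
  else H [::].

Lemma step_todo s : nilp (todo s) -> step I sigma s = [::].
Proof. by rewrite /step; case: (todo s). Qed.

Lemma drun_expect T bs (Q : seq nat -> state R n -> Prop) s (H : seq nat -> R) (F : state R n -> R) : drun T bs Q s ->
  (forall d s', Q d s' -> H d <= F s') -> mean bs H <= expect I sigma T F s.
Proof.
move=> dr; elim: dr H => {T bs Q s}.
- by move=> T Q s nt q H QF; case: T => [|T] /=; rewrite nt QF.
- move=> T bs Q s s' e dr IH H QF /=.
  case: ifP => nt; first by rewrite step_todo in e.
  by rewrite e /= big_seq1 divr1; exact: IH.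
- move=> T b bs Q s f b0 e dr IH H QF /=.
  case: ifP => nt.
    by move: e; rewrite step_todo //; case: b b0 {dr IH QF}.
  rewrite e size_map size_iota ler_wpM2r ?invr_ge0 ?ler0n // big_map.
  rewrite -[X in iota 0 X]subn0 -/(index_iota 0 b) big_mkord.
  by apply: ler_sum => v _; apply: IH => // d s' /QF.
Qed.

Lemma drun_surely T bs (Q : seq nat -> state R n -> Prop) s (P : pred (state R n)) : drun T bs Q s ->
  (forall d s', Q d s' -> P s') -> surely I sigma T P s.
Proof.
move=> dr; elim: dr => {T bs Q s}.
- by move=> T Q s nt q QP; case: T => [|T] /=; rewrite nt (QP _ _ q).
- move=> T bs Q s s' e dr IH QP /=.
  case: ifP => nt; first by rewrite step_todo in e.
  by rewrite e /= IH.
- move=> T b bs Q s f b0 e dr IH QP /=.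
  case: ifP => nt.
    by move: e; rewrite step_todo //; case: b b0 {dr IH QP}.
  rewrite e all_map; apply/allP => v; rewrite mem_iota add0n => /andP[_ vb] /=.
  by apply: IH => // d s' /QP.
Qed.

Lemma drun_le T T' bs (Q : seq nat -> state R n -> Prop) s : (T <= T')%N -> drun T bs Q s -> drun T' bs Q s.
Proof.
move=> le dr; elim: dr T' le => {T bs Q s}.
- by move=> T Q s nt q T' _; exact: drun_halt.
- move=> T bs Q s s' e dr IH [//|T'] le; apply: drun_det e _; exact: IH.
- move=> T b bs Q s f b0 e dr IH [//|T'] le; apply: drun_draw b0 e _ => v vb; exact: IH.
Qed.

Lemma drun_imp T bs (Q Q' : seq nat -> state R n -> Prop) s : (forall d s', Q d s' -> Q' d s') ->
  drun T bs Q s -> drun T bs Q' s.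
Proof.
move=> QQ' dr; elim: dr Q' QQ' => {T bs Q s}.
- by move=> T Q s nt q Q' QQ'; apply: drun_halt => //; exact: QQ'.
- by move=> T bs Q s s' e dr IH Q' QQ'; apply: drun_det e _; exact: IH.
- move=> T b bs Q s f b0 e dr IH Q' QQ'; apply: drun_draw b0 e _ => v vb.
  by apply: IH => // d s' /QQ'.
Qed.

Lemma drun_reach t T bs (Q : seq nat -> state R n -> Prop) s s' : reach t s s' -> drun T bs Q s' -> drun (t + T) bs Q s.
Proof.
by elim: t s => [|t IH] s /= => [->//|[s1 e r] dr]; apply: drun_det e _; exact: IH.
Qed.

(** The analogue of [exec] for code with draws, in continuation style. Every path has to draw from
    the same list of ranges, which lets [mean] average over outcomes without looking at the
    program. *)
Definition dexec c t bs (Q : seq nat -> state R n -> Prop) s := forall cs T bs' (Q' : seq nat -> state R n -> Prop),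
  (forall d s', Q d s' -> drun T bs' (fun d' => Q' (d ++ d')) (conf cs s')) ->
  drun (t + T) (bs ++ bs') Q' (conf (c ++ cs) s).

Lemma dexec_exec c t (Q : seq nat -> state R n -> Prop) s : exec c t (Q [::]) s -> dexec c t [::] Q s.
Proof.
move=> h cs T bs' Q' hQ; have [u [s' [l r q]]] := h cs.
apply: (@drun_le (u + T)); first by rewrite leq_add2r.
exact: drun_reach r (hQ _ _ q).
Qed.

Lemma dexec_cat c1 c2 t1 t2 bs1 bs2 (Q : seq nat -> state R n -> Prop) s :
  dexec c1 t1 bs1 (fun d => dexec c2 t2 bs2 (fun d' => Q (d ++ d'))) s ->
  dexec (c1 ++ c2) (t1 + t2) (bs1 ++ bs2) Q s.
Proof.
move=> h cs T bs' Q' hQ; rewrite -catA -addnA -catA; apply: h => d s' h2.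
apply: h2 => d' s'' /hQ dr; apply: drun_imp dr => e s0; by rewrite catA.
Qed.

Lemma dexec_draw m b j s (B := maxn 1 (evaln s m)) (Q : seq nat -> state R n -> Prop) :
  (forall v, (v < B)%N -> Q [:: v] (setn s (evaln s b) (evaln s j) v)) ->
  dexec [:: Draw m b j] 1 [:: B] Q s.
Proof.
move=> h cs T bs' Q' hQ.
apply: (@drun_draw _ _ _ _ _ (fun v => conf cs (setn s (evaln s b) (evaln s j) v))).
- by rewrite /B leq_max.
- by rewrite /step /= !evaln_conf.
- by move=> v vB; apply: (hQ [:: v]); exact: h.
Qed.

Lemma dexec_imp c t bs (Q Q' : seq nat -> state R n -> Prop) s : (forall d s', Q d s' -> Q' d s') ->
  dexec c t bs Q s -> dexec c t bs Q' s.
Proof. by move=> QQ' h cs T bs' Q0 hQ; apply: h => d s' /QQ'; exact: hQ. Qed.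

Lemma dexec_for j bound body (P : nat -> seq nat -> state R n -> Prop) m t bs s :
  P 0%N [::] (setn s 0 j 0) ->
  (forall i d s, P i d s -> nmem s 0 j = i /\ evaln s bound = m) ->
  (forall i d s, (i < m)%N -> P i d s ->
     dexec body t bs (fun d' s' => nmem s' 0 j = i /\ P i.+1 (d ++ d') (setn s' 0 j i.+1)) s) ->
  dexec (for_to j bound body) (2 + m * t.+2) (flatten (nseq m bs)) (P m) s.
Proof.
move=> P0 Pb Pstep.
set W := While (NLt (var j) bound) (body ++ [:: incr j]).
suff loop k i d s0 : (i + k)%N = m -> P i d s0 ->
    dexec [:: W] (k * t.+2).+1 (flatten (nseq k bs)) (fun d' => P m (d ++ d')) s0.
  move=> cs T bs' Q' hQ; apply: (drun_det (s' := conf (W :: cs) (setn s 0 j 0))).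
    by [].
  apply: (loop m 0%N [::]) => // d s'; exact: hQ.
elim: k i d s0 => [|k IH] i d s0 im Pi cs T bs' Q' hQ; have [ji bi] := Pb i d s0 Pi.
  apply: (drun_det (s' := conf cs s0)); first by rewrite /step /W /= !evaln_conf ji bi -im addn0 ltnn.
  apply: (hQ [::]); rewrite cats0; move: im; rewrite addn0 => <-; exact: Pi.
have lt : (i < m)%N by rewrite -im -addn1 leq_add2l.
have -> : ((k.+1 * t.+2).+1 + T = (t + ((k * t.+2).+1 + T).+1).+1)%N by lia.
apply: (drun_det (s' := conf (body ++ incr j :: W :: cs) s0)).
  by rewrite /step /W /= !evaln_conf ji bi lt -catA.
rewrite [flatten _]/= -catA.
apply: (Pstep i d s0 lt Pi) => d' s1 [ji1 P1].
apply: (drun_det (s' := conf (W :: cs) (setn s1 0 j i.+1))); first by rewrite /step /= ji1 addn1.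
apply: (IH i.+1 _ _ (etrans (addSnnS _ _) im) P1) => d'' s2.
by rewrite -catA => /hQ dr; apply: drun_imp dr => e s3; rewrite catA.
Qed.

Lemma dexec_drun c t bs (Q : seq nat -> state R n -> Prop) s : (forall d s' cs, Q d s' -> Q d (conf cs s')) ->
  dexec c t bs Q s -> drun t bs Q (conf c s).
Proof.
move=> Qc h; have := h [::] 0%N [::] Q; rewrite addn0 !cats0; apply=> d s' q.
by apply: drun_halt => //; rewrite cats0; exact: Qc.
Qed.

End Exec.

Global Opaque for_to.

(** * The program *)

(* Memory layout.  Scalars are in array 0: [n], [k], then the variables of
   the main loop in cells 2 to 10, with the item under consideration in cell 10,
   and scratch variables from cell 11 on.  Array 1 holds [h] at index [h] if the
   item arrived at time [h] is in the current solution and [n], a void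
   reference, otherwise.  Arrays 2 and 3 count the items of slot 0 and of the
   other slots for each window, array 4 lists the items ever selected, array 5
   is the tape of indices into array 4, array 6 lists the items to be removed,
   and array [8 + i], whose length is in cell [i] of array 7, lists the items of
   the ground set of matroid [i] in the solution, possibly with items that have
   left it. *)
Definition solution := NLit 1.
Definition item := var 10.
Definition ndel := var 11.
Definition del_cell e := NCell (NLit 6) e.
Definition len_i := NCell (NLit 7) (var 13).
Definition arr_i := NAdd (NLit 8) (var 13).
Definition nsucc e := NAdd e (NLit 1).

(** Removing an item from the solution leaves the arrays of the matroids alone; stale entries
    disappear only here, when a matroid is next consulted. *)
Definition purge_cmds : seq cmd :=
  assign 16 (NLit 0) ::
  for_to 15 len_i
    [:: assign 17 (NCell arr_i (var 15));
        NSet (var 17) arr_i (var 16);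
        If (NLt (NCell solution (var 17)) (var 0)) [:: incr 16] [::]] ++
  [:: NSet (var 16) (NLit 7) (var 13)].

(** The history is in order of arrival and array 1 is indexed by arrival time, so what precedes an
    item in the solution is a prefix of array 1, and two value queries give its weight. *)
Definition weigh_cmds : seq cmd :=
  [:: Value solution (nsucc (var 17)) (NLit 0) (NLit 3);
      Value solution (var 17) (NLit 0) (NLit 4);
      If (RLt (RSub (RCell (NLit 0) (NLit 3)) (RCell (NLit 0) (NLit 4)))
              (RCell (NLit 0) (NLit 5)))
         [:: RSet (RSub (RCell (NLit 0) (NLit 3)) (RCell (NLit 0) (NLit 4))) (NLit 0) (NLit 5);
             assign 19 (var 17)] [::]].

Definition lightest_cmds : seq cmd :=
  [:: RSet (RAdd (RCell (NLit 0) (NLit 2)) (ROfNat (NLit 1))) (NLit 0) (NLit 5);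
      assign 19 item] ++
  for_to 15 len_i
    [:: assign 17 (NCell arr_i (var 15));
        NSet (var 0) arr_i (var 15);
        Indep (var 13) arr_i (nsucc len_i) (NLit 0) (NLit 18);
        NSet (var 17) arr_i (var 15);
        If (NLt (NLit 0) (var 18)) weigh_cmds [::]] ++
  [:: NSet (var 19) (NLit 6) ndel; incr 11].

Definition conflict_cmds : seq cmd :=
  [:: Incid item (var 12) (NLit 0) (NLit 13);
      If (NLt (NLit 0) (var 13))
        ([:: assign 13 (NSub (var 13) (NLit 1))] ++ purge_cmds ++
         [:: NSet item arr_i len_i;
             Indep (var 13) arr_i (nsucc len_i) (NLit 0) (NLit 18);
             If (NLt (var 18) (NLit 1)) lightest_cmds [::]]) [::]].

Definition swap_cmds p : seq cmd :=
  [:: Value solution (var 0) (NLit 0) (NLit 2); assign 11 (NLit 0)] ++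
  for_to 12 (NLit p) conflict_cmds ++
  [:: assign 20 (NCell solution item); NSet item solution item] ++
  for_to 12 ndel [:: NSet (var 0) solution (del_cell (var 12))] ++
  [:: Value solution (var 0) (NLit 0) (NLit 3);
      RSet (RSub (RCell (NLit 0) (NLit 3)) (RCell (NLit 0) (NLit 2))) (NLit 0) (NLit 1)].

(** A gain is evaluated by performing the exchange and reverting it. Cell 20 keeps the former entry
    of the item, which may already have been in the solution. *)
Definition undo_cmds : seq cmd :=
  for_to 12 ndel [:: NSet (del_cell (var 12)) solution (del_cell (var 12))] ++
  [:: NSet (var 20) solution item].

Definition register_cmds p : seq cmd :=
  for_to 12 (NLit p)
    [:: Incid item (var 12) (NLit 0) (NLit 13);
        If (NLt (NLit 0) (var 13))
          [:: assign 13 (NSub (var 13) (NLit 1));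
              NSet item arr_i len_i;
              NSet (nsucc len_i) (NLit 7) (var 13)] [::]].

(** * Memory representation and correctness of the exchange *)

Section Memory.
Context {R : realType} {n : nat}.
Variables (I : instance R n) (sigma : 'S_n).
Implicit Types (s : state R n) (e d : 'I_n) (A D : {set 'I_n}) (l : seq 'I_n).

Definition time e : nat := (sigma^-1)%g e.

Lemma time_inj : injective time.
Proof. by move=> e d /val_inj /perm_inj. Qed.

Lemma time_lt e : (time e < n)%N. Proof. exact: ltn_ord. Qed.

(* [W] and [V] are the cells that may have changed. *)
Definition agree (W V : nat -> nat -> bool) s s' :=
  [/\ forall b j, ~~ W b j -> nmem s' b j = nmem s b j,
      forall b j, ~~ V b j -> rmem s' b j = rmem s b j,
      seen s' = seen s & shortlist s' = shortlist s].

Lemma agree_refl W V s : agree W V s s. Proof. by split. Qed.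

Lemma agree_trans W V s1 s2 s3 : agree W V s1 s2 -> agree W V s2 s3 -> agree W V s1 s3.
Proof.
move=> [a1 a2 a3 a4] [b1 b2 b3 b4]; split; rewrite ?b3 ?b4 //.
- by move=> b j h; rewrite b1 // a1.
- by move=> b j h; rewrite b2 // a2.
Qed.

Lemma agree_sub (W V W' V' : nat -> nat -> bool) s s' :
  (forall b j, W b j -> W' b j) -> (forall b j, V b j -> V' b j) ->
  agree W V s s' -> agree W' V' s s'.
Proof.
move=> WW VV [a1 a2 a3 a4]; split=> // b j h.
- by apply: a1; apply: contraNN h; exact: WW.
- by apply: a2; apply: contraNN h; exact: VV.
Qed.

Lemma agree_setn (W V : nat -> nat -> bool) s s' b j v :
  W b j -> agree W V s s' -> agree W V s (setn s' b j v).
Proof.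
move=> wbj [a1 a2 a3 a4]; split=> // b' j' h /=; rewrite /put.
by case: eqP => [eb|_] /=; [case: eqP => [ej|_] /=; last exact: a1|exact: a1];
   rewrite eb ej wbj in h.
Qed.

Lemma agree_setr (W V : nat -> nat -> bool) s s' b j v :
  V b j -> agree W V s s' -> agree W V s (setr s' b j v).
Proof.
move=> wbj [a1 a2 a3 a4]; split=> // b' j' h /=; rewrite /put.
by case: eqP => [eb|_] /=; [case: eqP => [ej|_] /=; last exact: a2|exact: a2];
   rewrite eb ej wbj in h.
Qed.

Definition sol_rep A s := forall e, nmem s 1 (time e) = if e \in A then time e else n.

Definition list_rep b l s := [seq nmem s b j | j <- iota 0 (size l)] = map time l.

Lemma list_repP b l s : list_rep b l s <->
  forall e0 j, (j < size l)%N -> nmem s b j = time (nth e0 l j).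
Proof.
split=> [h e0 j jl|h].
  have := congr1 (nth 0%N ^~ j) h; rewrite (nth_map 0%N) ?size_iota // nth_iota // add0n.
  by rewrite (nth_map e0).
case: l h => [//|e0 l] h; apply: (@eq_from_nth _ 0%N); rewrite ?size_map ?size_iota // => j jl.
by rewrite (nth_map 0%N) ?size_iota // nth_iota // add0n (h e0) // (nth_map e0).
Qed.

Lemma list_rep_nth b l s e0 j : list_rep b l s -> (j < size l)%N ->
  nmem s b j = time (nth e0 l j).
Proof. by move/list_repP => h; exact: h. Qed.

Lemma mem_denoted s a k e : (e \in denoted_set sigma s a k) =
  (time e < seen s)%N && (time e \in [seq nmem s a j | j <- iota 0 k]).
Proof.
apply/imsetP/idP => [[h]|h]; first by rewrite inE => hh ->; rewrite /time permK.
by exists ((sigma^-1)%g e); rewrite ?inE ?permKV.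
Qed.

Lemma denoted_prefix A s k : sol_rep A s -> (forall e, e \in A -> (time e < seen s)%N) ->
  (k <= n)%N -> denoted_set sigma s 1 k = [set e in A | (time e < k)%N].
Proof.
move=> rA sA kn; apply/setP => e; rewrite mem_denoted inE; apply/andP/andP.
  case=> _ /mapP[j]; rewrite mem_iota add0n => /andP[_ jk] te.
  have jn : (j < n)%N := leq_trans jk kn.
  pose d := sigma (Ordinal jn); have dj : time d = j by rewrite /time permK.
  move: te; rewrite -dj rA; case: ifP => dA; last first.
    by move=> te; have := time_lt e; rewrite te ltnn.
  by move/time_inj => ->; rewrite dA dj.
case=> eA tk; split; first exact: sA.
by apply/mapP; exists (time e); rewrite ?mem_iota // rA eA.
Qed.

Lemma denoted_all A s : sol_rep A s -> (forall e, e \in A -> (time e < seen s)%N) ->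
  denoted_set sigma s 1 n = A.
Proof.
move=> rA sA; rewrite (denoted_prefix rA sA) //; apply/setP => e.
by rewrite inE time_lt andbT.
Qed.

Lemma sol_rep_agree W V A s s' : (forall j, ~~ W 1%N j) -> agree W V s s' ->
  sol_rep A s -> sol_rep A s'.
Proof. by move=> W1 [a1 _ _ _] rA e; rewrite a1. Qed.

Lemma list_rep_agree W V b l s s' : (forall j, ~~ W b j) -> agree W V s s' ->
  list_rep b l s -> list_rep b l s'.
Proof.
move=> Wb [a1 _ _ _] rl; rewrite /list_rep -rl; apply: eq_map => j.
by rewrite a1.
Qed.

Lemma list_rep_setn b b' j v l s : b != b' -> list_rep b l s ->
  list_rep b l (setn s b' j v).
Proof.
move=> bb rl; rewrite /list_rep -rl; apply: eq_map => c /=.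
by rewrite /put (negPf bb).
Qed.

Lemma list_rep_setn_ge b j v l s : (size l <= j)%N -> list_rep b l s ->
  list_rep b l (setn s b j v).
Proof.
move=> lj rl; rewrite /list_rep -rl; apply/eq_in_map => c; rewrite mem_iota add0n.
by move=> /andP[_ cl]; rewrite /= /put eqxx ltn_eqF // (leq_trans cl).
Qed.

Lemma list_rep_rcons b j v l s e : list_rep b l s -> j = size l -> v = time e ->
  list_rep b (rcons l e) (setn s b j v).
Proof.
move=> rl -> ->; rewrite /list_rep size_rcons -addn1 iotaD !map_cat map_rcons -cats1 -rl.
congr (_ ++ _); last by rewrite /= /put !eqxx.
by apply/eq_in_map => c; rewrite mem_iota add0n => /andP[_ cl]; rewrite /= /put eqxx ltn_eqF.
Qed.

Lemma sol_rep_setn b j v A s : b != 1%N -> sol_rep A s -> sol_rep A (setn s b j v).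
Proof. by move=> b1 rA e; rewrite /= /put eq_sym (negPf b1) /= rA. Qed.

Lemma is_indepE (i : 'I_(nmat I)) A : is_indep I i A = (A \in indep (mat i)).
Proof.
apply/existsP/idP => [[i' /andP[/eqP ii]]|h]; last by exists i; rewrite eqxx.
by have -> : i' = i by exact: val_inj.
Qed.

Lemma matroids_ofE s e : (time e < seen s)%N ->
  matroids_of I sigma s (time e) = [seq i <- enum 'I_(nmat I) | e \in ground (mat i)].
Proof.
move=> ts; apply: eq_filter => i; apply/existsP/idP => [[h /and3P[/eqP hh _]]|ei].
  have -> : h = (sigma^-1)%g e by exact: val_inj.
  by rewrite permKV.
by exists ((sigma^-1)%g e); rewrite eqxx permKV ei andbT.
Qed.

Definition purge_cells (i : nat) b j := ((b == 0%N) && (15 <= j <= 17)%N) ||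
  (b == (8 + i)%N) || ((b == 7) && (j == i)).

Lemma exec_purge i A l s : nmem s 0 0 = n -> nmem s 0 13 = i -> nmem s 7 i = size l ->
  list_rep (8 + i) l s -> sol_rep A s ->
  exec I sigma purge_cmds (4 + size l * 7) (fun s' =>
    [/\ agree (purge_cells i) (fun _ _ => false) s s',
        nmem s' 7 i = size [seq e <- l | e \in A]
      & list_rep (8 + i) [seq e <- l | e \in A] s']) s.
Proof.
move=> hn hi hl rl rA.
pose pre j := [seq e <- take j l | e \in A].
pose P j s' := [/\ agree (fun b c => ((b == 0%N) && (15 <= c <= 17)%N) || (b == (8 + i)%N))
   (fun _ _ => false) s s', nmem s' 0 15 = j, nmem s' 0 16 = size (pre j),
   list_rep (8 + i) (pre j) s' & forall e0 c, (j <= c < size l)%N ->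
     nmem s' (8 + i) c = time (nth e0 l c)].
apply: exec_nset; rewrite /=.
apply: (exec_seq (t1 := 2 + size l * 7) (t2 := 1)); last by rewrite addn1.
apply: (exec_imp (Q := P (size l))).
  move=> s' [ag h15 h16 rl' _]; apply: exec_nset; apply: exec_nil => /=.
  have h13 : nmem s' 0 13 = i by case: ag => a1 _ _ _; rewrite a1.
  rewrite h13 h16 /pre take_size in rl' *.
  have ag' : agree (purge_cells i) (fun _ _ => false) s s'.
    by apply: agree_sub ag => // b j h; rewrite /purge_cells h.
  split.
  - by apply: agree_setn ag'; rewrite /purge_cells !eqxx orbT.
  - by rewrite /put !eqxx.
  - exact: list_rep_setn rl'.
have keep j s' : P j s' -> [/\ nmem s' 0 0 = n, nmem s' 0 13 = i, nmem s' 7 i = size l & sol_rep A s'].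
  case=> ag _ _ _ _; split; last exact: sol_rep_agree ag rA.
  - by case: ag => a1 _ _ _; rewrite a1.
  - by case: ag => a1 _ _ _; rewrite a1.
  - by case: ag => a1 _ _ _; rewrite a1.
apply: exec_for.
- split=> //.
  + by do 2 (apply: agree_setn => //); exact: agree_refl.
  + by rewrite /pre take0.
  + by rewrite /pre take0.
  + by move=> e0 c /andP[_ cl] /=; rewrite /put /= (list_rep_nth e0 rl).
- move=> j s' Pj; have [_ h13 h7 _] := keep j s' Pj; case: Pj => _ -> _ _ _.
  by split=> //=; rewrite h13.
move=> j s' jl Pj; have [h0 h13 h7 rA'] := keep j s' Pj; case: (Pj) => ag h15 h16 rl' rest.
have [e0 _] : exists e0 : 'I_n, True by case: (l) jl => // e0 *; exists e0.
have lj := rest e0 j; rewrite leqnn jl in lj; have {}lj := lj isT.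
apply: exec_nset => /=; rewrite h13 h15 lj.
apply: exec_nset => /=; rewrite /put /= h13 h16.
set s1 := setn _ _ _ _; have preS : pre j.+1 =
    if nth e0 l j \in A then rcons (pre j) (nth e0 l j) else pre j.
  by rewrite /pre (take_nth e0 jl) filter_rcons.
(* Each entry is written at the end of the kept part, which advances only for members of [A]. This
   end is at most [j], so no unread entry is overwritten. *)
have spre : (size (pre j) <= j)%N.
  by rewrite size_filter (leq_trans (count_size _ _)) // size_takel // ltnW.
have ag1 : agree (fun b c => ((b == 0%N) && (15 <= c <= 17)%N) || (b == (8 + i)%N))
    (fun _ _ => false) s s1.
  by rewrite /s1; do 2 (apply: agree_setn; rewrite ?eqxx ?orbT //).
have r1 : list_rep (8 + i) (pre j) s1.
  apply: list_rep_setn_ge => //; exact: list_rep_setn rl'.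
have rest1 e1 c : (j < c < size l)%N -> nmem s1 (8 + i) c = time (nth e1 l c).
  move=> /andP[jc cl]; rewrite /= /put eqxx /= gtn_eqF ?(leq_ltn_trans spre jc) //.
  by rewrite (rest e1) // (ltnW jc).
have next s2 : agree (fun b c => ((b == 0%N) && (15 <= c <= 17)%N) || (b == (8 + i)%N))
    (fun _ _ => false) s s2 -> nmem s2 0 15 = j -> nmem s2 0 16 = size (pre j.+1) ->
    list_rep (8 + i) (pre j.+1) s2 -> (forall c, nmem s2 (8 + i) c = nmem s1 (8 + i) c) ->
    nmem s2 0 15 = j /\ P j.+1 (setn s2 0 15 j.+1).
  move=> ag2 h15' h16' rl2 same; split=> //; split=> //.
  - by apply: agree_setn.
  - by move=> e1 c cl; rewrite -(rest1 e1) // -same.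
apply: (exec_if (t1 := 1) (t := 0)); last by [].
have -> : evalt s1 (NLt (NCell solution (var 17)) (var 0)) = (nth e0 l j \in A).
  rewrite /= /put /= h0 rA'; case: ifP => _; [exact: time_lt | exact: ltnn].
case: ifP preS => inA preS.
  apply: exec_nset; apply: exec_nil; apply: exec_nil; apply: next.
  - by apply: agree_setn.
  - by [].
  - by rewrite /= /put /= h16 addn1 preS size_rcons.
  - rewrite preS; apply: list_rep_setn => //; apply: list_rep_rcons => //.
  - by [].
by apply: exec_nil; apply: exec_nil; apply: next; rewrite // preS.
Qed.

Lemma agree_restore (W V : nat -> nat -> bool) s s' b j :
  agree (fun b' j' => W b' j' || ((b' == b) && (j' == j))) V s s' ->
  nmem s' b j = nmem s b j -> agree W V s s'.
Proof.
case=> a1 a2 a3 a4 e; split=> // b' j' h.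
by case: (boolP ((b' == b) && (j' == j))) => [/andP[/eqP-> /eqP->] //|nb];
   apply: a1; rewrite negb_or h.
Qed.

Variable st : seq 'I_n * seq 'I_n.
Hypothesis stv : valid I st.

Definition by_time l := pairwise (fun e d => time e < time d)%N l.

Lemma by_time_index l e d : by_time l -> e \in l -> d \in l ->
  (index e l < index d l)%N = (time e < time d)%N.
Proof.
elim: l => //= z l IH /andP[/allP hz /IH {}IH]; rewrite !inE.
case: (eqVneq e z) => [->|ez]; case: (eqVneq d z) => [->|dz] //=.
- by rewrite !ltnn.
- by move=> _ dl; rewrite hz.
- by move=> el _; rewrite ltn0; apply/esym/negbTE; rewrite -leqNgt ltnW // hz.
Qed.

Lemma by_time_weight s d : by_time st.1 -> sol_rep (sol st) s ->
  (forall e, e \in sol st -> (time e < seen s)%N) -> d \in sol st ->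
  val_f I (denoted_set sigma s 1 (time d).+1) - val_f I (denoted_set sigma s 1 (time d)) =
  wt I st d.
Proof.
move=> bt rS seenS dS; have sub e : e \in sol st -> e \in st.1.
  by rewrite inE; exact: (valid_sub stv).
rewrite (denoted_prefix rS seenS) ?time_lt // (denoted_prefix rS seenS) 1?ltnW ?time_lt //.
have dR := sub d dS.
rewrite /wt /weight; congr (val_f I _ - val_f I _); apply/setP => e.
  rewrite !in_set; case eS: (e \in st.2) => //=.
  have eR : e \in st.1 by apply: sub; rewrite inE.
  by rewrite ltnS [LHS]leqNgt [RHS]leqNgt (by_time_index bt dR eR).
rewrite !in_set; case eS: (e \in st.2) => //=.
have eR : e \in st.1 by apply: sub; rewrite inE.
by rewrite (by_time_index bt eR dR).
Qed.

Section Conflict.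
Variables (i : 'I_(nmat I)) (e : 'I_n).
Let li := [seq d <- st.2 | d \in ground (mat i)].

Record ready s : Prop := Ready {
  ready_n : nmem s 0 0 = n;
  ready_item : nmem s 0 10 = time e;
  ready_sol : sol_rep (sol st) s;
  ready_val : rmem s 0 2 = solval I st;
  ready_seen : forall d, d \in sol st -> (time d < seen s)%N;
  ready_seen_item : (time e < seen s)%N
}.

Lemma ready_agree (W V : nat -> nat -> bool) s s' :
  ~~ W 0%N 0%N -> ~~ W 0%N 10 -> (forall j, ~~ W 1%N j) -> ~~ V 0%N 2 ->
  agree W V s s' -> ready s -> ready s'.
Proof.
move=> w0 w10 w1 v2 ag [h1 h2 h3 h4 h5 h6]; have [a1 a2 a3 a4] := ag.
split; rewrite ?a3 ?a2 ?a1 //; exact: sol_rep_agree w1 ag h3.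
Qed.

Hypothesis bt : by_time st.1.

Lemma part_list : part (sol st) i = [set d in li].
Proof. by apply/setP => d; rewrite !inE mem_filter andbC. Qed.

Definition lightest_cells (dl : nat) b j :=
  ((b == 0%N) && ((15 <= j <= 19)%N || (j == 11))) || ((b == 6) && (j == dl)).

Lemma exec_lightest dl s : ready s -> nmem s 0 13 = i -> nmem s 7 i = size li ->
  list_rep (8 + i) (rcons li e) s -> nmem s 0 11 = dl ->
  exec I sigma lightest_cmds (6 + size li * 14) (fun s' =>
    [/\ agree (lightest_cells dl) (fun b j => (b == 0%N) && (3 <= j <= 5)%N) s s',
        nmem s' 0 11 = dl.+1 & nmem s' 6 dl = time (dmin st i e)]) s.
Proof.
move=> rd hi hl rl hd.
pose ex d := e |: (part (sol st) i :\ d) \in indep (mat i).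
pose best j := foldl (argmin_step (wt I st)) (e, solval I st + 1) [seq d <- take j li | ex d].
have candsE : cands st i e = [seq d <- li | ex d].
  by rewrite /cands /li -filter_predI; apply: eq_filter => d /=; rewrite andbC.
pose W b j := ((b == 0%N) && (15 <= j <= 19)%N) : bool.
pose V b j := ((b == 0%N) && (3 <= j <= 5)%N) : bool.
pose P j s' := [/\ agree W V s s', nmem s' 0 15 = j, nmem s' 0 19 = time (best j).1
  & rmem s' 0 5 = (best j).2].
apply: exec_rset; apply: exec_nset; rewrite /=.
set s1 := setn _ _ _ _.
have s1E : nmem s1 0 19 = time e /\ rmem s1 0 5 = solval I st + 1.
  by split; rewrite /s1 /= /put /= ?(ready_item rd) ?(ready_val rd).
have ag1 : agree W V s s1.
  by apply: agree_setn => //; apply: agree_setr => //; exact: agree_refl.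
apply: (exec_seq (t1 := 2 + size li * 14) (t2 := 2)); last by rewrite addnC.
apply: (exec_imp (Q := P (size li))).
  move=> s' [ag h15 h19 _]; have [a1 _ _ _] := ag.
  apply: exec_nset; apply: exec_nset; apply: exec_nil.
  rewrite /= a1 // hd; rewrite /put /=; split.
  - apply: agree_setn; first by rewrite /lightest_cells eqxx orbT.
    apply: agree_setn; first by rewrite /lightest_cells !eqxx orbT.
    by apply: agree_sub ag => // b j h; rewrite /lightest_cells; case/andP: h => -> ->.
  - by rewrite /put /= a1 // hd addn1.
  - by rewrite /put /= eqxx h19 /best take_size /dmin candsE.
have keep s' : agree W V s s' -> [/\ ready s', nmem s' 0 13 = i, nmem s' 7 i = size li &
    list_rep (8 + i) (rcons li e) s'].
  move=> ag; have [a1 _ _ _] := ag; split; rewrite ?a1 //.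
    exact: ready_agree ag rd.
  exact: list_rep_agree ag rl.
apply: exec_for.
- split; [exact: agree_setn|by []|by rewrite /best take0; case: s1E|].
  by rewrite /best take0 /=; case: s1E.
- by move=> j s' [ag h15 _ _]; have [_ h13 h7 _] := keep s' ag; rewrite /= h13.
move=> j s' jl [ag h15 h19 h5]; have [rd' h13 h7 rl'] := keep s' ag.
have [d0 _] : exists d0 : 'I_n, True by exists e.
set d := nth e li j.
have dl' : d \in li by exact: mem_nth.
have dS : d \in sol st by move: dl'; rewrite mem_filter inE => /andP[].
have Aj : nmem s' (8 + i) j = time d.
  by rewrite (list_rep_nth e rl') ?size_rcons 1?ltnW // nth_rcons jl.
apply: exec_nset => /=; rewrite h13 h15 Aj.
(* Overwriting the entry by the void reference [n] turns the query into one about the list with [e]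
   added and [d] removed; the entry is restored right after it. *)
apply: exec_nset => /=; rewrite /put /= h13 h15 (ready_n rd').
set s2 := setn _ _ _ _.
apply: exec_indep => /=; rewrite /put /= h13 h7 addn1.
have ul : uniq li by rewrite filter_uniq // (valid_sol stv).
have s2A c : (c < (size li).+1)%N -> nmem s2 (8 + i) c =
    if c == j then n else time (nth e (rcons li e) c).
  move=> cl; rewrite /= /put eqxx /=; case: eqP => // _.
  by rewrite (list_rep_nth e rl') ?size_rcons.
have -> : is_indep I i (denoted_set sigma s2 (8 + i) (size li).+1) = ex d.
  rewrite is_indepE /ex part_list; suff -> : denoted_set sigma s2 (8 + i) (size li).+1 =
      e |: [set d in li] :\ d by [].
  apply/setP => x; rewrite mem_denoted in_setU1 in_setD1 in_set.
  have seenx : x \in li -> (time x < seen s2)%N.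
    by rewrite mem_filter => /andP[_ xS]; apply: (ready_seen rd'); rewrite inE.
  apply/andP/orP.
    case=> _ /mapP[c]; rewrite mem_iota add0n => /andP[_ cl]; rewrite s2A //.
    case: eqVneq => [_ tx|cj /time_inj ->]; first by have := time_lt x; rewrite tx ltnn.
    move: cl; rewrite ltnS leq_eqVlt nth_rcons => /predU1P[->|cl].
      by left; rewrite ltnn eqxx.
    by right; rewrite cl mem_nth // andbT nth_uniq.
  case=> [/eqP ->|/andP[xd xl]]; split; try exact: (ready_seen_item rd'); try exact: seenx.
    apply/mapP; exists (size li); first by rewrite mem_iota /= add0n.
    rewrite s2A //; by rewrite gtn_eqF // nth_rcons ltnn eqxx.
  have xi : (index x li < size li)%N by rewrite index_mem.
  apply/mapP; exists (index x li); first by rewrite mem_iota /= add0n ltnS ltnW.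
  rewrite s2A ?ltnS 1?ltnW // nth_rcons xi nth_index // ifN //.
  by apply: contraNneq xd => xj; rewrite /d -xj nth_index.
set s3 := setn _ _ _ _.
apply: exec_nset => /=; rewrite /put /= h13 h15.
set s4 := setn _ _ _ _.
have s4A c : nmem s4 (8 + i) c = nmem s' (8 + i) c.
  rewrite /= /put eqxx /= /put /=; by case: eqP => [->|_].
have ag4 : agree W V s s4.
  apply: (agree_restore (b := (8 + i)%N) (j := j)); last first.
    by rewrite s4A; case: ag => a1 _ _ _; rewrite a1.
  have ag' := agree_sub (W' := fun b' j' => W b' j' || ((b' == (8 + i)%N) && (j' == j)))
    (V' := V) (fun b c h => introT orP (or_introl h)) (fun _ _ h => h) ag.
  by do 4 (apply: agree_setn; rewrite ?eqxx ?orbT //).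
have [rd4 _ _ _] := keep s4 ag4.
have s4E : [/\ nmem s4 0 15 = j, nmem s4 0 17 = time d, nmem s4 0 18 = ex d,
    nmem s4 0 19 = time (best j).1 & rmem s4 0 5 = (best j).2].
  by split; rewrite /= /put /=.
case: s4E => {}h15 h17 h18 {}h19 {}h5.
have bestS : best j.+1 = if ex d then argmin_step (wt I st) (best j) d else best j.
  rewrite /best (take_nth e jl) filter_rcons -/d; case: (ex d) => //.
  by rewrite foldl_rcons.
have done s5 : agree W V s s5 -> nmem s5 0 15 = j -> nmem s5 0 19 = time (best j.+1).1 ->
    rmem s5 0 5 = (best j.+1).2 -> nmem s5 0 15 = j /\ P j.+1 (setn s5 0 15 j.+1).
  by move=> ag5 *; split=> //; split=> //; exact: agree_setn.
clearbody s4.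
apply: (exec_if (t1 := 5) (t := 0)); last by [].
have -> : evalt s4 (NLt (NLit 0) (var 18)) = ex d by rewrite /= h18; case: (ex d).
case: (boolP (ex d)) => exd; last first.
  by do 2 apply: exec_nil; apply: done => //; rewrite bestS (negPf exd).
apply: exec_value => /=; rewrite h17 addn1.
apply: exec_value => /=; rewrite h17.
set s5 := setr _ _ _ _.
have ag5 : agree W V s s5 by do 2 (apply: agree_setr => //).
have w5 : rmem s5 0 3 - rmem s5 0 4 = wt I st d.
  have rS := ready_sol rd4; have seen4 := ready_seen rd4.
  exact: (by_time_weight bt rS seen4 dS).
apply: (exec_if (t1 := 2) (t := 0)); last by [].
have -> : evalt s5 (RLt (RSub (RCell (NLit 0) (NLit 3)) (RCell (NLit 0) (NLit 4)))
    (RCell (NLit 0) (NLit 5))) = (wt I st d < (best j).2) by rewrite -w5 -h5.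
rewrite exd /argmin_step in bestS; case: ifP bestS => lt bestS.
  apply: exec_rset; apply: exec_nset; do 3 apply: exec_nil; apply: done => //.
  - by apply: agree_setn => //; exact: agree_setr.
  - by rewrite /= /put /= bestS h17.
  - by rewrite bestS -w5.
by do 3 apply: exec_nil; apply: done; rewrite // bestS.
Qed.

Lemma size_part_list : (size li <= max_rank I)%N.
Proof.
have ul : uniq li by rewrite filter_uniq // (valid_sol stv).
have /card_uniqP <- := ul; have -> : #|li| = #|part (sol st) i|.
  by rewrite part_list; apply: eq_card => d; rewrite inE.
apply: leq_trans (_ : rk (mat i) <= _)%N; last by rewrite /max_rank; exact: leq_bigmax.
by rewrite /rk; apply: leq_bigmax_cond; exact: (forallP (valid_feas stv) i).
Qed.

(** The last clause bounds the cost of a purge. A list is extended, by one entry, only when it has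
    just been purged and is thus independent, so stale entries cannot pile up beyond one more than
    the rank. *)
Definition mat_rep s := exists l, [/\ nmem s 7 i = size l, list_rep (8 + i) l s,
  [seq d <- l | d \in sol st] = li, {subset l <= ground (mat i)}
  & (size l <= (max_rank I).+1)%N].

Definition mat_exact s := nmem s 7 i = size li /\ list_rep (8 + i) li s.

Lemma mat_exact_rep s : mat_exact s -> mat_rep s.
Proof.
case=> h1 h2; exists li; split=> //.
- apply/all_filterP/allP => d; rewrite mem_filter => /andP[_ dS].
  by rewrite inE.
- by move=> d; rewrite mem_filter => /andP[].
- exact: leq_trans size_part_list (leqnSn _).
Qed.

Lemma mat_rep_agree (W V : nat -> nat -> bool) s s' :
  ~~ W 7 i -> (forall j, ~~ W (8 + i)%N j) -> agree W V s s' -> mat_rep s -> mat_rep s'.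
Proof.
move=> w7 w8 ag [l [h1 h2 h3 h4 h5]]; exists l; split=> //.
  by case: ag => a1 _ _ _; rewrite a1.
exact: list_rep_agree ag h2.
Qed.

Lemma mat_exact_agree (W V : nat -> nat -> bool) s s' :
  ~~ W 7 i -> (forall j, ~~ W (8 + i)%N j) -> agree W V s s' -> mat_exact s -> mat_exact s'.
Proof.
move=> w7 w8 ag [h1 h2]; split; last exact: list_rep_agree ag h2.
by case: ag => a1 _ _ _; rewrite a1.
Qed.

Definition conflict_cells b j := ((b == 0%N) && (11 <= j)%N) || (b == 6) ||
  ((b == 7) && (j == i)) || (b == (8 + i)%N).
Definition trial_cells b j := (b == 0%N) && (3 <= j)%N.

Arguments purge_cmds : simpl never.
Arguments lightest_cmds : simpl never.

Definition victims : seq 'I_n :=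
  if e |: part (sol st) i \in indep (mat i) then [::] else [:: dmin st i e].

(** The cells protected here are the victims listed so far and the loop counter of the caller. *)
Lemma exec_conflict_some s dl : ready s -> mat_rep s -> nmem s 0 13 = i.+1 ->
  nmem s 0 11 = dl -> 
  exec I sigma ([:: assign 13 (NSub (var 13) (NLit 1))] ++ purge_cmds ++
         [:: NSet item arr_i len_i;
             Indep (var 13) arr_i (nsucc len_i) (NLit 0) (NLit 18);
             If (NLt (var 18) (NLit 1)) lightest_cmds [::]]) (21 + 21 * max_rank I)
    (fun s' => [/\ agree (fun b j => conflict_cells b j && ~~ ((b == 6) && (j < dl)%N) &&
         ~~ ((b == 0%N) && (j == 12))) trial_cells s s',
       mat_exact s', nmem s' 0 11 = (dl + size victims)%N &
       [seq nmem s' 6 j | j <- iota dl (size victims)] = map time victims]) s.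
Proof.
move=> rd [l [h7 rl fl _ sl]] h13 hd.
pose W b j := conflict_cells b j && ~~ ((b == 6) && (j < dl)%N) && ~~ ((b == 0%N) && (j == 12)).
apply: exec_nset => /=; rewrite h13 subn1 /=.
set s1 := setn _ _ _ _.
have ag1 : agree W trial_cells s s1 by apply: agree_setn => //; exact: agree_refl.
have rd1 : ready s1 by apply: ready_agree ag1 rd.
have rl1 : list_rep (8 + i) l s1 by exact: list_rep_setn rl.
apply: (exec_seq (c1 := purge_cmds) (t1 := 4 + size l * 7) (t2 := 9 + 14 * max_rank I)); last by lia.
have := exec_purge (ready_n rd1) (erefl : nmem s1 0 13 = i) h7 rl1 (ready_sol rd1).
apply: exec_imp => s2 [ag2 g7 g8]; rewrite fl in g7 g8.
have ag2' : agree W trial_cells s s2.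
  apply: agree_trans ag1 _; apply: agree_sub ag2 => // b j.
  rewrite /purge_cells /W /conflict_cells.
  case/orP => [/orP[/andP[/eqP-> /andP[h _]]|/eqP->]|/andP[/eqP-> /eqP->]] //=.
  + by rewrite (leq_trans _ h) //=; apply/eqP => j12; rewrite j12 in h.
  + by rewrite eqxx.
  + by rewrite eqxx.
have rd2 : ready s2 by apply: ready_agree ag2' rd.
have g13 : nmem s2 0 13 = i by case: ag2 => a1 _ _ _; rewrite a1.
have g11 : nmem s2 0 11 = dl by case: ag2 => a1 _ _ _; rewrite a1.
apply: exec_nset => /=; rewrite g13 g7 (ready_item rd2).
set s3 := setn _ _ _ _.
have ag3 : agree W trial_cells s s3.
  by apply: agree_setn ag2'; rewrite /W /conflict_cells eqxx !orbT.
have rl3 : list_rep (8 + i) (rcons li e) s3 by apply: list_rep_rcons.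
have rl3' : list_rep (8 + i) li s3 by apply: list_rep_setn_ge.
have rd3 : ready s3 by apply: ready_agree ag3 rd.
apply: exec_indep => /=; rewrite /put /= g13 g7 addn1.
have -> : is_indep I i (denoted_set sigma s3 (8 + i) (size li).+1) =
    (e |: part (sol st) i \in indep (mat i)).
  rewrite is_indepE; suff -> : denoted_set sigma s3 (8 + i) (size li).+1 =
    e |: part (sol st) i by [].
  apply/setP => x; rewrite mem_denoted -(size_rcons li e).
  rewrite [map _ _]rl3 (mem_map time_inj) mem_rcons in_cons in_setU1 part_list inE.
  case: (eqVneq x e) => [->|xe] /=; first by rewrite (ready_seen_item rd3).
  case xl : (x \in li); rewrite ?andbF // andbT.
  by apply: (ready_seen rd3); move: xl; rewrite mem_filter inE => /andP[].
set s4 := setn _ _ _ _.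
have ag4 : agree W trial_cells s s4 by exact: agree_setn.
have rd4 : ready s4 by apply: ready_agree ag4 rd.
have ex4 : mat_exact s4 by split; [rewrite /= /put /= g7 | exact: list_rep_setn rl3'].
apply: (exec_if (t1 := 6 + 14 * max_rank I) (t := 0)); last by lia.
have -> : evalt s4 (NLt (var 18) (NLit 1)) = (e |: part (sol st) i \notin indep (mat i)).
  by rewrite /= /put /=; case: (_ \in _).
rewrite /victims; case: ifP => [dep|/negbFE ind]; last first.
  by do 2 apply: exec_nil; rewrite ind /= addn0; split.
rewrite (negPf dep).
have rl4 : list_rep (8 + i) (rcons li e) s4 by exact: list_rep_setn rl3.
have ex := exec_lightest rd4 (g13 : nmem s4 0 13 = i) (g7 : nmem s4 7 i = size li)
  rl4 (g11 : nmem s4 0 11 = dl).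
apply: exec_imp (exec_le _ ex); last first.
  by rewrite mulnC leq_add2l leq_mul2l size_part_list orbT.
move=> s5 [ag5 k11 k6]; apply: exec_nil; split.
- apply: agree_trans ag4 _; apply: agree_sub ag5 => b j.
    rewrite /lightest_cells /W /conflict_cells.
    case/orP => /andP[/eqP-> h] /=.
      have jj : (11 <= j)%N && (j != 12).
        by case/orP: h => [/andP[h _]|/eqP->//]; rewrite (leq_trans _ h) //=; apply/eqP => j12; rewrite j12 in h.
      by case/andP: jj => -> ->.
    by rewrite (eqP h) ltnn.
  by rewrite /trial_cells => /and3P[-> -> _].
- apply: mat_exact_agree ag5 ex4; rewrite /lightest_cells //.
- by rewrite k11 /= addn1.
- by rewrite /= k6.
Qed.

End Conflict.

Section Swap.
Variables (p : nat) (e : 'I_n).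
Hypotheses (mp : is_matchoid p I) (bt : by_time st.1).
Let ms := [seq i <- enum 'I_(nmat I) | e \in ground (mat i)].

Lemma size_matroids_of : (size ms <= p)%N.
Proof.
have um : uniq ms by rewrite filter_uniq ?enum_uniq.
rewrite -(card_uniqP um) (leq_trans _ (mp e)) // subset_leq_card //.
by apply/subsetP => i; rewrite mem_filter inE => /andP[].
Qed.

Definition scratch b j := (b == 0%N) && (11 <= j)%N.
Definition loop_cells b j := scratch b j || (6 <= b)%N.

Lemma agree_scratch s s' : agree scratch trial_cells s s' -> agree loop_cells trial_cells s s'.
Proof. by apply: agree_sub => // b j h; rewrite /loop_cells h. Qed.

Lemma exec_conflicts s : ready e s -> (forall i, mat_rep i s) -> nmem s 0 11 = 0%N ->
  exec I sigma (for_to 12 (NLit p) conflict_cmds) (2 + p * (25 + 21 * max_rank I))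
    (fun s' => [/\ agree loop_cells trial_cells s s', forall i, mat_rep i s',
       forall i, e \in ground (mat i) -> mat_exact i s',
       nmem s' 0 11 = size (dels I st e) & list_rep 6 (dels I st e) s']) s.
Proof.
move=> rd mr h11; have um : uniq ms by rewrite filter_uniq ?enum_uniq.
pose D c := flatten [seq victims i e | i <- take c ms].
pose Q c s' := [/\ nmem s' 0 12 = c, agree loop_cells trial_cells s s',
  forall i, mat_rep i s', forall i, i \in take c ms -> mat_exact i s'
  & nmem s' 0 11 = size (D c) /\ list_rep 6 (D c) s'].
apply: (exec_imp (Q := Q p)).
  move=> s' [_ ag m1 m2 []]; rewrite /D take_oversize ?size_matroids_of // in m2 * => h l.
  by split=> // i ei; apply: m2; rewrite mem_filter ei mem_enum.
have rdQ c s' : Q c s' -> ready e s' by case=> _ ag _ _ _; apply: ready_agree ag rd.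
have -> : (25 + 21 * max_rank I = (23 + 21 * max_rank I).+2)%N by [].
apply: exec_for.
- have ag : agree scratch trial_cells s (setn s 0 12 0).
    by apply: agree_setn => //; exact: agree_refl.
  split=> //; first exact: agree_scratch.
    by rewrite take0.
  by rewrite /D take0 /=; split; rewrite /put /=.
- by move=> c s' [].
move=> c s' cp Qc; have rd' := rdQ c s' Qc; case: Qc => h12 ag m1 m2 [h11' ld].
apply: exec_incid => /=; rewrite (ready_item rd') h12 matroids_ofE; last first.
  exact: ready_seen_item rd'.
rewrite -/ms; set s1 := setn _ _ _ _.
have ag1 : agree scratch trial_cells s' s1 by apply: agree_setn => //; exact: agree_refl.
have [cm|mc] := ltnP c (size ms); last first.
  have h13 : nmem s1 0 13 = 0%N by rewrite /= /put /= nth_default // size_map.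
  apply: (exec_if (t1 := 0) (t := 0)); last by [].
  rewrite [evalt _ _]/= [put _ _ _ _ _ _]h13; do 2 apply: exec_nil.
  have ag2 : agree scratch trial_cells s' (setn s1 0 12 c.+1) by apply: agree_setn.
  have tk : take c.+1 ms = take c ms by rewrite !take_oversize // leqW.
  split=> //; split.
  - by rewrite /= /put.
  - exact: agree_trans ag (agree_scratch ag2).
  - by move=> i; apply: mat_rep_agree ag2 (m1 i).
  - by rewrite tk => i /m2 mi; apply: mat_exact_agree ag2 mi.
  - by rewrite /D tk -/(D c); split; rewrite /= /put.
have [i0 _] : exists i0 : 'I_(nmat I), True by case: (ms) cm => // i0 *; exists i0.
pose i := nth i0 ms c.
have h13 : nmem s1 0 13 = i.+1 by rewrite /= /put /= (nth_map i0).
apply: (exec_if (t1 := 21 + 21 * max_rank I) (t := 0)); last by lia.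
rewrite [evalt _ _]/= [put _ _ _ _ _ _]h13.
have rd1 : ready e s1 by apply: ready_agree ag1 rd'.
have mr1 : mat_rep i s1 by apply: mat_rep_agree ag1 (m1 i).
have := exec_conflict_some bt rd1 mr1 h13 (h11' : nmem s1 0 11 = size (D c)).
apply: exec_imp => s2 [ag2 ex2 k11 k6]; apply: exec_nil.
have kc : nmem s2 0 12 = c by case: ag2 => a1 _ _ _; rewrite a1 ?andbF.
split=> //.
have ag2' : agree (conflict_cells i) trial_cells s1 s2.
  by apply: agree_sub ag2 => // b j /andP[/andP[]].
have DS : D c.+1 = D c ++ victims i e.
  by rewrite /D (take_nth i0 cm) map_rcons flatten_rcons.
have ag3 : agree scratch trial_cells s2 (setn s2 0 12 c.+1).
  by apply: agree_setn => //; exact: agree_refl.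
have cl b j : conflict_cells i b j -> loop_cells b j.
  rewrite /conflict_cells /loop_cells /scratch.
  by case/orP => [/orP[/orP[->|/eqP->]|/andP[/eqP-> _]]|/eqP->]; rewrite ?orbT.
have ex3 : mat_exact i (setn s2 0 12 c.+1) by apply: mat_exact_agree ag3 ex2.
have other i' : i' != i -> ~~ conflict_cells i 7 i' /\ (forall j, ~~ conflict_cells i (8 + i')%N j).
  by move=> ne; split=> [|j]; rewrite /conflict_cells /= ?orbF ?eqn_add2l.
split.
- by rewrite /= /put.
- apply: agree_trans ag _; apply: agree_trans (agree_scratch ag1) _.
  apply: agree_trans (agree_scratch ag3).
  by apply: agree_sub ag2'.
- move=> i'; case: (eqVneq i' i) => [->|ne]; first exact: mat_exact_rep.
  have [o1 o2] := other i' ne.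
  apply: (mat_rep_agree _ _ ag3) => //; apply: (mat_rep_agree _ _ ag2') => //.
  exact: mat_rep_agree ag1 (m1 i').
- move=> i'; rewrite (take_nth i0 cm) mem_rcons in_cons => /predU1P[->//|i'c].
  have ne : i' != i.
    by apply: contraTneq i'c => ->; rewrite in_take_leq ?index_uniq ?ltnn // ltnW.
  have [o1 o2] := other i' ne.
  apply: (mat_exact_agree _ _ ag3) => //; apply: (mat_exact_agree _ _ ag2') => //.
  exact: mat_exact_agree ag1 (m2 i' i'c).
- rewrite DS size_cat; split; first by rewrite /= /put /= k11.
  rewrite /list_rep size_cat iotaD !map_cat add0n; congr (_ ++ _); last first.
    by rewrite -k6; apply: eq_map => j.
  rewrite -ld; apply/eq_in_map => j; rewrite mem_iota add0n => /andP[_ jd] /=.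
  by case: ag2 => a1 _ _ _; rewrite /put /= a1 ?jd ?andbF.
Qed.

Record holds s : Prop := Holds {
  holds_n : nmem s 0 0 = n;
  holds_sol : sol_rep (sol st) s;
  holds_seen : forall d, d \in sol st -> (time d < seen s)%N;
  holds_mat : forall i, mat_rep i s
}.

Definition swap_cells b j := scratch b j || (b == 1%N) || (6 <= b)%N.
Definition gain_cells b j := (b == 0%N) && (1 <= j)%N.

Record swapped s s' : Prop := Swapped {
  swapped_agree : agree swap_cells gain_cells s s';
  swapped_sol : sol_rep [set d in commit I st e] s';
  swapped_gain : rmem s' 0 1 = gain I st e;
  swapped_old : nmem s' 0 20 = nmem s 1 (time e);
  swapped_ndel : nmem s' 0 11 = size (dels I st e);
  swapped_dels : list_rep 6 (dels I st e) s';
  swapped_mat : forall i, mat_rep i s';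
  swapped_exact : forall i, e \in ground (mat i) -> mat_exact i s'
}.

Lemma sol_rep_add A s d : sol_rep A s -> sol_rep (d |: A) (setn s 1 (time d) (time d)).
Proof.
move=> rA d' /=; rewrite /put eqxx in_setU1 (inj_eq time_inj).
by case: eqVneq => [->|_] //=; rewrite rA.
Qed.

Lemma sol_rep_del A s d : sol_rep A s -> sol_rep (A :\ d) (setn s 1 (time d) n).
Proof.
move=> rA d' /=; rewrite /put eqxx in_setD1 (inj_eq time_inj).
by case: eqVneq => [->|_] //=; rewrite rA.
Qed.

Lemma size_dels : (size (dels I st e) <= p)%N.
Proof.
apply: leq_trans size_matroids_of; rewrite /dels -/ms.
elim: (ms) => //= i l IH; rewrite size_cat -add1n leq_add //.
by case: ifP.
Qed.

Lemma commit_set : [set d in commit I st e] = (e |: sol st) :\: [set d in dels I st e].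
Proof. by apply/setP => d; rewrite !inE mem_commit. Qed.

Lemma exec_swap s : holds s -> nmem s 0 10 = time e -> (time e < seen s)%N ->
  exec I sigma (swap_cmds p) (10 + p * (28 + 21 * max_rank I)) (swapped s) s.
Proof.
move=> [hn hS hseen hm] hE seenE.
apply: exec_value; apply: exec_nset => /=; rewrite hn (denoted_all hS hseen).
set s1 := setn _ _ _ _.
have ag1 : agree swap_cells gain_cells s s1.
  by apply: agree_setn => //; apply: agree_setr => //; exact: agree_refl.
have rd1 : ready e s1 by split.
have mr1 i : mat_rep i s1 by exact: (hm i).
apply: (exec_seq (t1 := 2 + p * (25 + 21 * max_rank I)) (t2 := 6 + p * 3)); last by lia.
apply: exec_imp (exec_conflicts rd1 mr1 (erefl : nmem s1 0 11 = 0%N)).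
move=> s2 [ag2 m2 ex2 h11 rD].
have ag2' : agree swap_cells gain_cells s s2.
  apply: agree_trans ag1 _; apply: agree_sub ag2 => b j.
    by rewrite /loop_cells /swap_cells => /orP[] ->; rewrite ?orbT.
  by rewrite /trial_cells /gain_cells => /andP[-> h]; rewrite (leq_trans _ h).
have rd2 : ready e s2 by apply: ready_agree ag2 rd1.
apply: exec_nset; apply: exec_nset => /=; rewrite (ready_item rd2) /put /= (ready_item rd2).
set s3 := setn (setn _ _ _ _) _ _ _.
have ag3 : agree swap_cells gain_cells s s3.
  by apply: agree_setn => //; apply: agree_setn.
have S1 : nmem s2 1 (time e) = nmem s 1 (time e).
  by case: ag2 => a1 _ _ _; rewrite a1.
pose D := dels I st e.
pose W (b j : nat) := ((b == 0%N) && (j == 12%N)) || (b == 1%N).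
pose P j s' := [/\ agree W (fun _ _ => false) s3 s', nmem s' 0 12 = j &
  sol_rep ((e |: sol st) :\: [set d in take j D]) s'].
apply: (exec_seq (t1 := 2 + size D * 3) (t2 := 2)); last first.
  by have := size_dels; rewrite -/D; lia.
apply: (exec_imp (Q := P (size D))).
  move=> s4 [ag4 h12 rS]; rewrite take_size -commit_set in rS.
  have ag4' : agree swap_cells gain_cells s s4.
    apply: agree_trans ag3 _; apply: agree_sub ag4 => // b j.
    by rewrite /W /swap_cells => /orP[/andP[/eqP-> /eqP->]|->]; rewrite ?orbT.
  have seen4 : seen s4 = seen s by case: ag4'.
  have n4 : nmem s4 0 0 = n by case: ag4' => a1 _ _ _; rewrite a1.
  have v4 : rmem s4 0 2 = solval I st.
    by case: ag4 => _ a2 _ _; rewrite a2 //= (ready_val rd2).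
  have sC d : d \in [set d in commit I st e] -> (time d < seen s4)%N.
    rewrite commit_set seen4 !inE => /andP[_ /predU1P[->//|dS]].
    by apply: hseen; rewrite inE.
  apply: exec_value; apply: exec_rset => /=; rewrite n4 (denoted_all rS sC).
  rewrite /put /= v4; apply: exec_nil; split=> //.
  - by do 2 apply: agree_setr => //.
  - case: ag4 => a1 _ _ _; rewrite /= a1 //= /put /=.
  - by case: ag4 => a1 _ _ _; rewrite /= a1.
  - exact: (list_rep_agree (W := W) _ ag4 (rD : list_rep 6 _ s3)).
  - move=> i; exact: (mat_rep_agree (W := W) _ _ ag4 (m2 i : mat_rep i s3)).
  - by move=> i ei; exact: (mat_exact_agree (W := W) _ _ ag4 (ex2 i ei : mat_exact i s3)).
apply: exec_for.
- split=> //; first by apply: agree_setn => //; exact: agree_refl.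
  rewrite take0; have -> : [set d in Nil 'I_n] = set0 by apply/setP => d; rewrite !inE.
  by rewrite setD0; apply: sol_rep_setn => //; apply: sol_rep_add; exact: (ready_sol rd2).
- by move=> j s' [[a1 _ _ _] h12 _]; split=> //=; rewrite a1.
move=> j s' jD [ag h12 rS]; have [a1 _ _ _] := ag.
have h0 : nmem s' 0 0 = n by rewrite a1 //; exact: (ready_n rd2).
have h6 : nmem s' 6 j = time (nth e D j).
  by rewrite a1 //; exact: (list_rep_nth e rD jD).
apply: exec_nset; apply: exec_nil; rewrite /= h12 h0 h6.
split; first by rewrite /put /=.
split; [|by []|].
  by do 2 apply: agree_setn => //.
apply: sol_rep_setn => //; have -> : (e |: sol st) :\: [set d in take j.+1 D] =
    (e |: sol st) :\: [set d in take j D] :\ nth e D j.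
  apply/setP => d; rewrite !inE (take_nth e jD) mem_rcons inE negb_or.
  by case: (d == nth e D j).
exact: sol_rep_del.
Qed.

(** For [exec_undo]: putting all deleted items back must yield the solution together with [e] and
    nothing else. *)
Lemma dels_subU : {subset dels I st e <= e |: sol st}.
Proof.
move=> d /mem_dels[i [_ _ ->]]; rewrite /dmin.
have [_ _ [->|[]]] := foldl_argmin (wt I st) (e, solval I st + 1) (cands st i e).
  by rewrite setU11.
by rewrite mem_filter => /andP[_ dS] _; rewrite !inE dS orbT.
Qed.

Lemma exec_undo s s' : holds s -> nmem s 0 10 = time e -> swapped s s' ->
  exec I sigma undo_cmds (3 + p * 3) (fun s2 =>
    [/\ agree swap_cells gain_cells s s2, holds s2 & rmem s2 0 1 = gain I st e]) s'.
Proof.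
move=> [hn hS hseen hm] hE [ag rS g old ndel rD m' _].
pose D := dels I st e; rewrite -/D in ndel rD.
have n' : nmem s' 0 0 = n by case: ag => a1 _ _ _; rewrite a1.
have E' : nmem s' 0 10 = time e by case: ag => a1 _ _ _; rewrite a1.
pose W (b j : nat) := ((b == 0%N) && (j == 12%N)) || (b == 1%N).
pose C := [set d in commit I st e].
pose P j s2 := [/\ agree W (fun _ _ => false) s' s2, nmem s2 0 12 = j &
  sol_rep (C :|: [set d in take j D]) s2].
apply: (exec_seq (t1 := 2 + size D * 3) (t2 := 1)); last first.
  by have := size_dels; rewrite -/D; lia.
apply: (exec_imp (Q := P (size D))).
  move=> s2 [ag2 _ rS2].
  have CD : C :|: [set d in take (size D) D] = e |: sol st.
    rewrite take_size /C commit_set -/D; apply/setP => d; rewrite !inE.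
    by case dD: (d \in D) => //=; rewrite ?orbF ?orbT //; have := dels_subU dD; rewrite !inE.
  rewrite CD in rS2; have [a1 _ _ _] := ag2.
  apply: exec_nset; apply: exec_nil; rewrite /= a1 // E' a1 // old.
  have ag3 : agree swap_cells gain_cells s (setn s2 1 (time e) (nmem s 1 (time e))).
    apply: agree_setn => //; apply: agree_trans ag _; apply: agree_sub ag2 => // b j.
    by rewrite /W /swap_cells => /orP[/andP[/eqP-> /eqP->]|->]; rewrite ?orbT.
  split=> //; last by case: ag2 => _ a2 _ _; rewrite /= a2.
  split.
  - exact: etrans (a1 0%N 0%N isT) n'.
  - rewrite hS; case: ifP => eS.
      have -> : sol st = e |: (e |: sol st).
        by rewrite setUA setUid; apply/esym/setUidPr; rewrite sub1set.
      exact: sol_rep_add.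
    have -> : sol st = (e |: sol st) :\ e.
      apply/setP => d; rewrite in_setD1 in_setU1.
      by case: eqVneq => [->|]; rewrite ?eS.
    exact: sol_rep_del.
  - by case: ag3 => _ _ -> _.
  - move=> i; exact: (mat_rep_agree (W := W) _ _ ag2 (m' i)).
apply: exec_for.
- split=> //; first by apply: agree_setn => //; exact: agree_refl.
  rewrite take0; have -> : [set d in Nil 'I_n] = set0 by apply/setP => d; rewrite !inE.
  by rewrite setU0; exact: sol_rep_setn.
- by move=> j s2 [[a1 _ _ _] h12 _]; split=> //=; rewrite a1.
move=> j s2 jD [ag2 h12 rS2]; have [a1 _ _ _] := ag2.
have h6 : nmem s2 6 j = time (nth e D j) by rewrite a1 //; exact: (list_rep_nth e rD jD).
apply: exec_nset; apply: exec_nil; rewrite /= h12 h6.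
split; first by rewrite /put /=.
split; [|by []|].
  by do 2 apply: agree_setn => //.
apply: sol_rep_setn => //; have -> : C :|: [set d in take j.+1 D] =
    nth e D j |: (C :|: [set d in take j D]).
  apply/setP => d; rewrite !inE (take_nth e jD) mem_rcons inE.
  by case: (d == nth e D j); rewrite ?orbT.
exact: sol_rep_add.
Qed.

Lemma exec_eval s : holds s -> nmem s 0 10 = time e -> (time e < seen s)%N ->
  exec I sigma (swap_cmds p ++ undo_cmds) (13 + p * (31 + 21 * max_rank I)) (fun s2 =>
    [/\ agree swap_cells gain_cells s s2, holds s2 & rmem s2 0 1 = gain I st e]) s.
Proof.
move=> hs hE seenE; apply: (exec_seq (t1 := 10 + p * (28 + 21 * max_rank I)) (t2 := 3 + p * 3)).
  by apply: exec_imp (exec_swap hs hE seenE) => s' sw; exact: exec_undo sw.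
by lia.
Qed.

Definition mat_list i l s := nmem s 7 i = size l /\ list_rep (8 + i) l s.

Lemma mat_list_agree (W V : nat -> nat -> bool) i l s s' :
  ~~ W 7 i -> (forall j, ~~ W (8 + i)%N j) -> agree W V s s' -> mat_list i l s -> mat_list i l s'.
Proof.
move=> w7 w8 ag [h1 h2]; split; last exact: list_rep_agree ag h2.
by case: ag => a1 _ _ _; rewrite a1.
Qed.

(** A plain append is enough, as the swap has just purged the arrays of all matroids containing
    [e]. *)
Lemma exec_register s : nmem s 0 10 = time e -> (time e < seen s)%N ->
  (forall i, mat_rep i s) -> (forall i, e \in ground (mat i) -> mat_exact i s) ->
  exec I sigma (register_cmds p) (2 + p * 7) (fun s' =>
    [/\ agree loop_cells (fun _ _ => false) s s',
       forall i : 'I_(nmat I), e \in ground (mat i) ->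
         mat_list i (rcons [seq d <- st.2 | d \in ground (mat i)] e) s'
     & forall i, e \notin ground (mat i) -> mat_rep i s']) s.
Proof.
move=> hE seenE m ex; have um : uniq ms by rewrite filter_uniq ?enum_uniq.
pose V0 (b j : nat) := false.
pose ml (i : 'I_(nmat I)) := rcons [seq d <- st.2 | d \in ground (mat i)] e.
pose Q c s' := [/\ nmem s' 0 12 = c, agree loop_cells V0 s s',
  forall i : 'I_(nmat I), i \in take c ms -> mat_list i (ml i) s' &
  forall i : 'I_(nmat I), i \notin take c ms -> mat_rep i s' /\ (e \in ground (mat i) -> mat_exact i s')].
apply: (exec_imp (Q := Q p)).
  move=> s' [_ ag m1 m2]; rewrite take_oversize ?size_matroids_of // in m1 m2; split=> // i ei.
    by apply: m1; rewrite mem_filter ei mem_enum.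
  by apply: (m2 i _).1; rewrite mem_filter (negPf ei).
apply: exec_for.
- split=> //; last by move=> i _; split=> [|ei]; [exact: (m i)|exact: (ex i ei)].
  by apply: agree_setn => //; exact: agree_refl.
  by rewrite take0.
- by move=> c s' [].
move=> c s' cp [h12 ag m1 m2].
have E' : nmem s' 0 10 = time e by case: ag => a1 _ _ _; rewrite a1.
have seen' : (time e < seen s')%N by case: ag => _ _ -> _.
apply: exec_incid => /=; rewrite E' h12 matroids_ofE // -/ms; set s1 := setn _ _ _ _.
have ag1 : agree scratch V0 s' s1 by apply: agree_setn => //; exact: agree_refl.
have sl (s2 s3 : state R n) : agree scratch V0 s2 s3 -> agree loop_cells V0 s2 s3.
  by apply: agree_sub => // b j h; rewrite /loop_cells h.
have [cm|mc] := ltnP c (size ms); last first.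
  have h13 : nmem s1 0 13 = 0%N by rewrite /= /put /= nth_default // size_map.
  apply: (exec_if (t1 := 0) (t := 0)); last by [].
  rewrite [evalt _ _]/= [put _ _ _ _ _ _]h13; do 2 apply: exec_nil.
  have ag2 : agree scratch V0 s' (setn s1 0 12 c.+1) by apply: agree_setn.
  have tk : take c.+1 ms = take c ms by rewrite !take_oversize // leqW.
  split=> //; split=> //; rewrite ?tk //.
  exact: agree_trans ag (sl _ _ ag2).
have [i0 _] : exists i0 : 'I_(nmat I), True by case: (ms) cm => // i0 *; exists i0.
pose i := nth i0 ms c.
have h13 : nmem s1 0 13 = i.+1 by rewrite /= /put /= (nth_map i0).
have ei : e \in ground (mat i).
  by have := mem_nth i0 cm; rewrite mem_filter => /andP[].
have itk : i \notin take c ms by rewrite in_take_leq ?index_uniq ?ltnn // ltnW.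
have [_ /(_ ei) [k7 k8]] := m2 i itk.
apply: (exec_if (t1 := 3) (t := 0)); last by [].
rewrite [evalt _ _]/= [put _ _ _ _ _ _]h13.
apply: exec_nset => /=; rewrite [put _ _ _ _ _ _]h13 subn1 /=.
set s2 := setn s1 _ _ _.
apply: exec_nset => /=; rewrite /put /= k7 E'.
set s3 := setn s2 _ _ _.
apply: exec_nset => /=; rewrite /put /= k7.
set s4 := setn s3 _ _ _; do 2 apply: exec_nil; split; first by [].
pose W b j := [|| scratch b j, (b == 7) && (j == i) | b == (8 + i)%N].
have ag5 : agree W V0 s' (setn s4 0 12 c.+1).
  have ag1' : agree W V0 s' s1 by apply: agree_sub ag1 => // b j h; rewrite /W h.
  by do 4 (apply: agree_setn; rewrite /W ?eqxx ?orbT //).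
have other i' : i' != i -> ~~ W 7 i' /\ (forall j, ~~ W (8 + i')%N j).
  by move=> ne; split=> [|j]; rewrite /W /= ?orbF ?eqn_add2l.
split=> //.
- apply: agree_trans ag _; apply: agree_sub ag5 => // b j; rewrite /W /loop_cells.
  by case/or3P => [->|/andP[/eqP-> _]|/eqP->]; rewrite ?orbT.
- move=> i'; rewrite (take_nth i0 cm) mem_rcons in_cons => /predU1P[->|i'c].
    rewrite -/i /mat_list /ml size_rcons; split; first by rewrite /= /put /= eqxx addn1.
    do 2 apply: list_rep_setn => //; apply: list_rep_rcons => //; exact: list_rep_setn.
  have ne : i' != i by apply: contraTneq i'c => ->.
  have [o1 o2] := other i' ne; exact: mat_list_agree ag5 (m1 i' i'c).
- move=> i'; rewrite (take_nth i0 cm) mem_rcons in_cons negb_or => /andP[ne i'c].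
  have [o1 o2] := other i' ne; have [r1 r2] := m2 i' i'c; split.
    exact: mat_rep_agree ag5 r1.
  by move=> ei'; exact: mat_exact_agree ag5 (r2 ei').
Qed.

End Swap.

End Memory.

Section Commit.
Context {R : realType} {n : nat}.
Variables (I : instance R n) (sigma : 'S_n) (st : seq 'I_n * seq 'I_n).
Variables (p : nat) (e : 'I_n).
Hypotheses (stv : valid I st) (mp : is_matchoid p I) (bt : by_time sigma st.1).
Implicit Types (s : state R n).

(** [h] is left free because the new history contains [e] as a further entry when [e] comes from the
    window, and is the old one when [e] was drawn from it. *)
Lemma exec_commit h s : holds I sigma st s -> e \notin st.2 -> nmem s 0 10 = time sigma e ->
  (time sigma e < seen s)%N ->
  exec I sigma (swap_cmds p ++ register_cmds p) (12 + p * (35 + 21 * max_rank I)) (fun s' =>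
    agree swap_cells gain_cells s s' /\ holds I sigma (h, commit I st e) s') s.
Proof.
move=> hs eS hE seenE.
apply: (exec_seq (t1 := 10 + p * (28 + 21 * max_rank I)) (t2 := 2 + p * 7)); last by lia.
apply: exec_imp (exec_swap stv mp bt hs hE seenE) => s1 [ag rS g old ndel rD m ex].
have E1 : nmem s1 0 10 = time sigma e by case: ag => a1 _ _ _; rewrite a1.
have seen1 : (time sigma e < seen s1)%N by case: ag => _ _ -> _.
apply: exec_imp (exec_register mp E1 seen1 m ex) => s2 [ag2 m2 m2'].
have ag3 : agree swap_cells gain_cells s s2.
  apply: agree_trans ag _; apply: agree_sub ag2 => // b j.
  by rewrite /loop_cells /swap_cells => /orP[] ->; rewrite ?orbT.
split=> //; have [hn hS hseen _] := hs; split.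
- by case: ag3 => a1 _ _ _; rewrite a1.
- exact: sol_rep_agree ag2 rS.
- move=> d; rewrite inE mem_commit; case: ag3 => _ _ -> _ /andP[_ /predU1P[->//|dS]].
  by apply: hseen; rewrite inE.
move=> i; pose li := [seq d <- st.2 | d \in ground (mat i)].
have liE : [seq d <- commit I st e | d \in ground (mat i)] =
    [seq d <- if e \in ground (mat i) then rcons li e else li | d \notin dels I st e].
  by rewrite /li -filter_rcons /commit -!filter_predI; apply: eq_filter => d /=; rewrite andbC.
have [ei|ei] := boolP (e \in ground (mat i)).
  have [k7 k8] := m2 i ei; exists (rcons li e); split=> //.
  - rewrite liE ei; apply: eq_in_filter => d; rewrite mem_rcons in_cons inE mem_commit.
    by case/predU1P => [->|]; rewrite ?eqxx ?andbT // mem_filter => /andP[_ ->]; rewrite orbT andbT.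
  - by move=> d; rewrite mem_rcons in_cons mem_filter => /predU1P[->|/andP[]].
  - by rewrite size_rcons ltnS (size_part_list stv).
have [l [k7 k8 fl lg sl]] := m2' i ei; exists l; split=> //.
rewrite liE (negPf ei) /li -fl -filter_predI; apply: eq_in_filter => d dl.
rewrite /= !inE mem_commit; case: eqVneq => [de|//].
by move: ei; rewrite -de lg.
Qed.

End Commit.

Lemma ohead_mem (T : eqType) (l : seq T) e : ohead l = Some e -> e \in l.
Proof. by case: l => //= d l [->]; rewrite inE eqxx. Qed.

(** * Windows as consecutive blocks of arrivals *)

Section Windows.
Context {R : realType} {n : nat}.
Variables (I : instance R n) (sigma : 'S_n) (m : nat) (c0 c1 r : nat -> nat).
Hypotheses (f0 : nonnegative (val_f I)) (fm : monotone (val_f I)).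
Let ws := window_start c0 c1.
Let l0 := early_of sigma c0 c1.
Let l1 := late_of sigma c0 c1.
Hypothesis ws_le : (ws m <= n)%N.

Lemma window_startS v : ws v.+1 = (ws v + c0 v + c1 v)%N.
Proof. by rewrite /ws /window_start big_ord_recr /= addnA. Qed.

Lemma window_end w : (w < m)%N -> (ws w + c0 w + c1 w <= n)%N.
Proof.
move=> wm; apply: leq_trans ws_le; rewrite -window_startS.
rewrite /ws /window_start -(subnKC wm) big_split_ord /=; exact: leq_addr.
Qed.

Lemma slice_arrivals (a b : nat) : (a + b <= n)%N ->
  let l := take b (drop a (arrivals sigma)) in
  size l = b /\ forall e0 c, (c < b)%N -> time sigma (nth e0 l c) = (a + c)%N.
Proof.
move=> abn l; have sa : size (arrivals sigma) = n by rewrite size_map size_enum_ord.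
split=> [|e0 c cb]; first by rewrite size_takel // size_drop sa leq_subRL // (leq_trans _ abn) ?leq_addr.
have acn : (a + c < n)%N by apply: leq_trans abn; rewrite ltn_add2l.
have h0 : 'I_n by exact: Ordinal acn.
by rewrite nth_take // nth_drop (nth_map h0) ?size_enum_ord // /time permK nth_enum_ord.
Qed.

Lemma size_early_of w : (w < m)%N -> size (l0 w) = c0 w.
Proof. by move/window_end => h; have [] := slice_arrivals (leq_trans (leq_addr _ _) h). Qed.

Lemma time_early_of w e0 c : (w < m)%N -> (c < c0 w)%N -> time sigma (nth e0 (l0 w) c) = (ws w + c)%N.
Proof. by move/window_end => h; have [_] := slice_arrivals (leq_trans (leq_addr _ _) h); exact. Qed.

Lemma size_late_of w : (w < m)%N -> size (l1 w) = c1 w.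
Proof. by move/window_end => h; have [] := slice_arrivals h. Qed.

Lemma time_late_of w e0 c : (w < m)%N -> (c < c1 w)%N ->
  time sigma (nth e0 (l1 w) c) = (ws w + c0 w + c)%N.
Proof. by move/window_end => h; have [_] := slice_arrivals h; exact. Qed.

Lemma by_time_late w : (w < m)%N -> by_time sigma (l1 w).
Proof.
move=> wm; case E : (l1 w) => [//|e0 l]; rewrite -E.
apply/(pairwiseP e0) => i j; rewrite !inE (size_late_of wm) => il jl ij.
by rewrite !time_late_of // ltn_add2l.
Qed.

Lemma time_mem_late w e : (w < m)%N -> e \in l1 w -> (ws w <= time sigma e < ws w.+1)%N.
Proof.
move=> wm el; have il : (index e (l1 w) < c1 w)%N by rewrite -(size_late_of wm) index_mem.
have := time_late_of e wm il; rewrite nth_index // => ->.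
by rewrite window_startS; lia.
Qed.

Lemma takes_sub st j w : (w < m)%N -> {subset takes I st j (l0 w) (l1 w) <= l1 w}.
Proof. by move=> wm; have [] := scanP (gain I st) (base I st j) (l0 w) (by_time_late wm). Qed.

(** Each window adds at most one item to the history, taken from its own block of arrivals. *)
Lemma run_history w : (w <= m)%N -> let st := run I l0 l1 r w in
  [/\ valid I st, by_time sigma st.1 & forall e, e \in st.1 -> (time sigma e < ws w)%N].
Proof.
elim: w => [|w IH] wm /=; first by split=> //; exact: valid0.
have [v bt lt] := IH (ltnW wm).
have tk e : ohead (takes I (run I l0 l1 r w) (r w) (l0 w) (l1 w)) = Some e ->
    (ws w <= time sigma e < ws w.+1)%N.
  by move=> /ohead_mem te; apply: time_mem_late => //; exact: takes_sub te.
split.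
- apply: valid_next => // e /tk /andP[le _]; apply/negP => /lt.
  by rewrite ltnNge le.
- rewrite mem_hist_next; case E: (ohead _) => [e|//].
  rewrite /by_time pairwise_rcons -/(by_time _ _) bt andbT; apply/allP => d /lt dw.
  by have /andP[le _] := tk e E; exact: leq_trans dw le.
have le1 : (ws w <= ws w.+1)%N by rewrite window_startS; lia.
rewrite mem_hist_next; case E: (ohead _) => [e|] d; last by move/lt => h; exact: leq_trans h le1.
rewrite mem_rcons inE => /predU1P[->|/lt h]; first by have /andP[] := tk e E.
exact: leq_trans h le1.
Qed.

Lemma late_not_hist w e : (w < m)%N -> e \in l1 w -> e \notin (run I l0 l1 r w).1.
Proof.
move=> wm el; apply/negP => eh; have [_ _ /(_ e eh)] := run_history (ltnW wm).
by rewrite ltnNge; have /andP[->] := time_mem_late wm el.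
Qed.

End Windows.

Section Program.
Variables (p N L : nat).

(** A product by a constant is spelled out as a sum, the machine having no multiplication. *)
Fixpoint times c e := if c is c'.+1 then NAdd e (times c' e) else NLit 0.
Definition windows := times N.+1 (var 1).
Definition capacity := times (N.+1 * L) (var 1).
Definition thr := RCell (NLit 0) (NLit 0).
Definition gain_e := RCell (NLit 0) (NLit 1).
Definition set_thr := RSet gain_e (NLit 0) (NLit 0).
Definition eval_cmds := swap_cmds p ++ undo_cmds.
Definition visit_cmds := [:: Next; assign 10 (var 5)] ++ eval_cmds.

(** Executed once per item before anything arrives. It also fills the solution array with the void
    reference. *)
Definition prepare_cmds : seq cmd :=
  [:: NSet (var 0) (NLit 1) (var 2);
      Draw windows (NLit 0) (NLit 18); Draw (NLit N.+1) (NLit 0) (NLit 19);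
      If (NLt (var 19) (NLit 1))
        [:: NSet (NAdd (NCell (NLit 2) (var 18)) (NLit 1)) (NLit 2) (var 18)]
        [:: NSet (NAdd (NCell (NLit 3) (var 18)) (NLit 1)) (NLit 3) (var 18)]].

(** Cell 7 will hold one plus the arrival time of the item to commit, 0 meaning none; the window
    starts from the drawn item if its gain is positive. *)
Definition recall_cmds : seq cmd :=
  [:: assign 7 (NLit 0); RSet (ROfNat (NLit 0)) (NLit 0) (NLit 0);
      If (NLt (NCell (NLit 5) (var 2)) (var 9))
        ([:: assign 10 (NCell (NLit 4) (NCell (NLit 5) (var 2)))] ++ eval_cmds ++
         [:: If (RLt thr gain_e) [:: set_thr; assign 7 (nsucc (var 10))] [::]]) [::]].

Definition early_cmds : seq cmd :=
  visit_cmds ++ [:: If (RLt thr gain_e) [:: set_thr] [::]; incr 5].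

(** Once the capacity in cell 8 is used up, selection continues as before and only the shortlisting
    stops. *)
Definition take_cmds : seq cmd :=
  [:: set_thr; assign 6 (NLit 1); assign 7 (nsucc (var 10));
      If (NLt (NLit 0) (var 8)) [:: Accept; assign 8 (NSub (var 8) (NLit 1))] [::]].

Definition late_cmds : seq cmd :=
  visit_cmds ++
  [:: If (RLt thr gain_e) take_cmds
        [:: If (NLt (var 6) (NLit 1)) [:: If (RLt gain_e thr) [::] take_cmds] [::]];
      incr 5].

Definition finish_cmds : seq cmd :=
  [:: If (NLt (NLit 0) (var 7))
        ([:: assign 10 (NSub (var 7) (NLit 1))] ++ (swap_cmds p ++ register_cmds p) ++
         [:: If (NLt (NLit 0) (var 6)) [:: NSet (var 10) (NLit 4) (var 9); incr 9] [::]]) [::]].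

Definition window_cmds : seq cmd :=
  recall_cmds ++ for_to 4 (NCell (NLit 2) (var 2)) early_cmds ++
  [:: assign 6 (NLit 0)] ++ for_to 4 (NCell (NLit 3) (var 2)) late_cmds ++ finish_cmds.

Definition main_program : program :=
  for_to 2 (var 0) prepare_cmds ++
  for_to 2 windows [:: Draw windows (NLit 5) (var 2)] ++
  [:: assign 8 capacity] ++ for_to 2 windows window_cmds.

End Program.

Arguments swap_cmds : simpl never.
Arguments undo_cmds : simpl never.
Arguments register_cmds : simpl never.
Arguments eval_cmds : simpl never.
Arguments visit_cmds : simpl never.
Arguments recall_cmds : simpl never.
Arguments early_cmds : simpl never.
Arguments late_cmds : simpl never.
Arguments take_cmds : simpl never.
Arguments finish_cmds : simpl never.
Arguments windows : simpl never.

Lemma evaln_times (R : realType) (n : nat) (s : state R n) c e :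
  evaln s (times c e) = (c * evaln s e)%N.
Proof. by elim: c => //= c ->; rewrite mulSn. Qed.

(** * The main loop simulates the run *)

Section MainLoop.
Context {R : realType} {n : nat}.
Variables (I : instance R n) (sigma : 'S_n) (p N L : nat) (c0 c1 r : nat -> nat) (k : nat).
Let m := (N.+1 * k)%N.
Let cap := (m * L)%N.
Hypotheses (f0 : nonnegative (val_f I)) (fm : monotone (val_f I)) (mp : is_matchoid p I).
Hypothesis ws_le : (window_start c0 c1 m <= n)%N.
Implicit Types (s : state R n) (st : seq 'I_n * seq 'I_n).
Notation time := (time sigma).

Lemma holds_setn st b j v s : (b == 0%N) && (j != 0%N) || (2 <= b <= 5)%N ->
  holds I sigma st s -> holds I sigma st (setn s b j v).
Proof.
move=> bj [h1 h2 h3 h4]; split=> //.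
- by rewrite /= /put; case: b bj => [|b] //=; rewrite orbF [0%N == j]eq_sym => /negPf->.
- by apply: sol_rep_setn => //; apply: contraTneq bj => ->.
move=> i; have [l [k1 k2 k3 k4 k5]] := h4 i; exists l; split=> //.
- by rewrite /= /put; case: b bj => [|[|[|[|[|[|b]]]]]].
- by apply: list_rep_setn => //; apply: contraTneq bj => <-.
Qed.

(* What the commands of window [w] preserve, apart from the arrivals: [t] is the
   cell counting them. *)
Record common st w t s : Prop := Common {
  co_holds : holds I sigma st s;
  co_k : nmem s 0 1 = k;
  co_w : nmem s 0 2 = w;
  co_t : nmem s 0 5 = t;
  co_c0 : forall v, (v < m)%N -> nmem s 2 v = c0 v;
  co_c1 : forall v, (v < m)%N -> nmem s 3 v = c1 v;
  co_tape : forall v, (v < m)%N -> nmem s 5 v = r v;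
  co_hist : list_rep sigma 4 st.1 s;
  co_size : nmem s 0 9 = size st.1;
  co_cap : (#|shortlist s| + nmem s 0 8 <= cap)%N
}.

Lemma common_tmp st w t s (j : nat) v : (j \in [:: 3; 4; 6; 7; 10])%N -> common st w t s ->
  common st w t (setn s 0 j v).
Proof.
move=> jt [h1 h2 h3 h4 h5 h6 h7 h8 h9 h10].
have ne (a : nat) : (a \in [:: 0; 1; 2; 5; 8; 9])%N -> nmem (setn s 0 j v) 0 a = nmem s 0 a.
  move=> aa; rewrite /= /put /=; case: eqP => // aj; move: jt aa; rewrite aj !inE.
  by do 4 (case/orP => [/eqP->//|]); move/eqP->.
split; rewrite ?ne //; apply: holds_setn => //=.
by rewrite orbF; apply: contraTneq jt => ->.
Qed.

Lemma common_setr st w t s b j v : common st w t s -> common st w t (setr s b j v).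
Proof. by case=> [[h1a h1b h1c h1d] h2 h3 h4 h5 h6 h7 h8 h9 h10]; split. Qed.

Lemma common_agree st w t s s' : agree swap_cells gain_cells s s' -> holds I sigma st s' ->
  common st w t s -> common st w t s'.
Proof.
move=> ag h [_ h2 h3 h4 h5 h6 h7 h8 h9 h10]; have [a1 a2 a3 a4] := ag.
split; rewrite ?a1 ?a4 //.
- by move=> v vm; rewrite a1 // h5.
- by move=> v vm; rewrite a1 // h6.
- by move=> v vm; rewrite a1 // h7.
- exact: list_rep_agree ag h8.
Qed.

Definition eval_time := (13 + p * (31 + 21 * max_rank I))%N.

Lemma exec_visit st w t s e : valid I st -> by_time sigma st.1 -> common st w t s ->
  seen s = t -> time e = t ->
  exec I sigma (visit_cmds p) (2 + eval_time) (fun s' =>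
    [/\ common st w t s', seen s' = t.+1, nmem s' 0 10 = t & rmem s' 0 1 = gain I st e] /\
    [/\ forall j, (j < 10)%N -> nmem s' 0 j = nmem s 0 j, rmem s' 0 0 = rmem s 0 0
      & shortlist s' = shortlist s]) s.
Proof.
move=> stv bt co st_t te; have tn : (t < n)%N by rewrite -te; exact: time_lt.
apply: exec_next; apply: exec_nset => /=; rewrite (co_t co).
set s1 := setn _ _ _ _.
have seen1 : seen s1 = t.+1 by rewrite /= st_t; apply/minn_idPl.
have co1 : common st w t s1.
  apply: common_tmp => //; case: co => [[h1a h1b h1c h1d] h2 h3 h4 h5 h6 h7 h8 h9 h10].
  by split=> //; split=> // d /h1c; rewrite seen1 st_t => /ltnW; rewrite ltnS.
have := exec_eval stv mp bt (co_holds co1) (e := e).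
move=> ev; apply: exec_imp (ev _ _); rewrite ?seen1 ?te //.
move=> s2 [ag h2 g]; have [a1 a2 a3 a4] := ag; split.
  by split; [exact: common_agree co1|rewrite a3|rewrite a1|].
split; [|by rewrite a2|by rewrite a4].
move=> j j10; rewrite a1 /=; first by rewrite /put /= ltn_eqF.
by rewrite /swap_cells /scratch /= !orbF -leqNgt ltnW.
Qed.

Definition code (o : option 'I_n) := if o is Some e then (time e).+1 else 0%N.

(* [X] items were taken before the current window and [tk] lists those taken in it. *)
Definition ledger st X (tk : seq 'I_n) s :=
  (cap <= X + size tk + nmem s 0 8)%N /\
  ((X + size tk <= cap)%N -> {subset st.1 ++ tk <= shortlist s}).

Lemma exec_recall st w t X s : (w < m)%N -> valid I st -> by_time sigma st.1 ->
  (forall e, e \in st.1 -> (time e < seen s)%N) ->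
  common st w t s -> ledger st X [::] s ->
  exec I sigma (recall_cmds p) (8 + eval_time) (fun s' =>
    [/\ common st w t s', seen s' = seen s, ledger st X [::] s',
      nmem s' 0 7 = code (rpick I st (r w)) & rmem s' 0 0 = base I st (r w)]) s.
Proof.
move=> wm stv bt lt co le; apply: exec_nset; apply: exec_rset => /=.
set s1 := setr _ _ _ _; have co1 : common st w t s1 by apply: common_setr; apply: common_tmp.
have le1 : ledger st X [::] s1 by [].
apply: (exec_if (t1 := 4 + eval_time) (t := 0)); last by rewrite /eval_time; lia.
have -> : evalt s1 (NLt (NCell (NLit 5) (var 2)) (var 9)) = (r w < size st.1)%N.
  by rewrite /= /put /= (co_w co) (co_tape co wm) (co_size co).
case: ltnP => [rw|wr]; last first.
  do 2 apply: exec_nil; split=> //.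
  - by rewrite /= /put /= /rpick onth_default.
  - by rewrite /= /put /= /base /rpick onth_default.
have [e0 _] : exists e0 : 'I_n, True by case: (st.1) rw => // e0 *; exists e0.
pose e := nth e0 st.1 (r w); have eh : e \in st.1 by exact: mem_nth.
have on : onth st.1 (r w) = Some e by rewrite onthE (nth_map e0).
have ev1 : evaln s1 (NCell (NLit 4) (NCell (NLit 5) (var 2))) = time e.
  by rewrite /= /put /= (co_w co) (co_tape co wm) (list_rep_nth e0 (co_hist co) rw).
apply: exec_nset; rewrite ev1; set s2 := setn s1 _ _ _; have co2 : common st w t s2 by apply: common_tmp.
have := exec_eval stv mp bt (co_holds co2) (erefl : nmem s2 0 10 = time e) (lt _ eh).
move=> ev; apply: (exec_seq (c1 := eval_cmds p) (t1 := eval_time) (t2 := 3)); last by rewrite addnC.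
apply: exec_imp ev => s3 [ag h3 g]; have [a1 a2 a3 a4] := ag.
have co3 : common st w t s3 by exact: common_agree co2.
have le3 : ledger st X [::] s3 by rewrite /ledger a1 // a4.
apply: (exec_if (t1 := 2) (t := 0)); last by [].
have -> : evalt s3 (RLt thr gain_e) = (0 < gain I st e) by rewrite /= g a2 //= /put /=.
rewrite /rpick /base /rpick on; case: ifP => g0.
  apply: exec_rset; apply: exec_nset; do 3 apply: exec_nil; split=> //.
  - by apply: common_tmp => //; apply: common_setr.
  - by rewrite /= /put /= a1 //= /put /= addn1.
do 3 apply: exec_nil; split=> //.
- by rewrite a1.
- by rewrite a2.
Qed.

Lemma exec_early st w X s : (w < m)%N -> valid I st -> by_time sigma st.1 ->
  common st w (window_start c0 c1 w) s -> seen s = window_start c0 c1 w ->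
  ledger st X [::] s -> nmem s 0 7 = code (rpick I st (r w)) -> rmem s 0 0 = base I st (r w) ->
  exec I sigma (for_to 4 (NCell (NLit 2) (var 2)) (early_cmds p)) (2 + c0 w * (8 + eval_time))
    (fun s' => [/\ common st w (window_start c0 c1 w + c0 w) s',
        seen s' = (window_start c0 c1 w + c0 w)%N, ledger st X [::] s',
        nmem s' 0 7 = code (rpick I st (r w)) &
        rmem s' 0 0 = (foldl (scan_step (gain I st) false) (base I st (r w), [::])
           (early_of sigma c0 c1 w)).1]) s.
Proof.
move=> wm stv bt co sn le h7 h0; set ws := window_start c0 c1 w in co sn *.
pose l := early_of sigma c0 c1 w; pose a c := foldl (scan_step (gain I st) false)
  (base I st (r w), [::]) (take c l).
pose P c s' := [/\ common st w (ws + c) s', seen s' = (ws + c)%N, ledger st X [::] s',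
  nmem s' 0 7 = code (rpick I st (r w)) & rmem s' 0 0 = (a c).1] /\ nmem s' 0 4 = c.
have sl : size l = c0 w by exact: (size_early_of sigma ws_le wm).
apply: (exec_imp (Q := P (c0 w))).
  by move=> s' [[q1 q2 q3 q4 q5] _]; split=> //; rewrite q5 /a -sl take_size.
have -> : (8 + eval_time = (6 + eval_time).+2)%N by [].
apply: exec_for.
- by split=> //; split; rewrite ?addn0 //; [exact: common_tmp | rewrite /a take0].
- by move=> c s' [[q1 _ _ _ _] q6]; rewrite /= (co_w q1) (co_c0 q1).
move=> c s' cl [[q1 q2 q3 q4 q5] q6].
have [e0 _] : exists e0 : 'I_n, True by move: cl; rewrite -sl; case: (l) => // e0 *; exists e0.
have te := time_early_of sigma ws_le e0 wm cl; set e := nth e0 _ c in te.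
apply: (exec_seq (t1 := 2 + eval_time) (t2 := 3)); last by rewrite /eval_time; lia.
apply: exec_imp (exec_visit stv bt q1 q2 te) => s1 [[k1 k2 k3 k4] [k5 k6 k7]].
have le1 : ledger st X [::] s1 by rewrite /ledger k5 // k7.
have aS : (a c.+1).1 = if (a c).1 < gain I st e then gain I st e else (a c).1.
  have cl' : (c < size l)%N by rewrite sl.
  by rewrite /a (take_nth e0 cl') foldl_rcons -/e /scan_step /=; case: ifP.
have fin s2 : common st w (ws + c) s2 -> seen s2 = seen s1 -> ledger st X [::] s2 ->
    nmem s2 0 7 = nmem s1 0 7 -> nmem s2 0 4 = c -> rmem s2 0 0 = (a c.+1).1 ->
    exec I sigma [:: incr 5] 1 (fun s3 => nmem s3 0 4 = c /\ P c.+1 (setn s3 0 4 c.+1)) s2.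
  move=> co2 sn2 le2 h72 h42 h02; apply: exec_nset; apply: exec_nil => /=.
  rewrite /put /= (co_t co2); split=> //; split=> //; rewrite addnS addn1; split=> //.
  - by apply: common_tmp => //; case: co2 => *; split=> //; exact: holds_setn.
  - by rewrite /= sn2.
  - by rewrite /= /put /= h72 k5.
apply: (exec_if (t1 := 1) (t := 1)); last by [].
have -> : evalt s1 (RLt thr gain_e) = ((a c).1 < gain I st e) by rewrite /= k4 k6 q5.
case: ifP aS => _ aS.
  apply: exec_rset; apply: exec_nil; apply: fin => //; rewrite /= ?k5 //.
    exact: common_setr.
  by rewrite /put /= k4 aS.
by apply: exec_nil; apply: fin => //; rewrite ?k5 // k6 aS.
Qed.

Lemma exec_take st w t X tk s e g c Q T : common st w t s -> ledger st X tk s ->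
  nmem s 0 10 = time e -> seen s = (time e).+1 -> rmem s 0 1 = g -> nmem s 0 4 = c ->
  (forall s', [/\ common st w t s', seen s' = seen s, ledger st X (e :: tk) s',
     nmem s' 0 7 = (time e).+1 & rmem s' 0 0 = g] -> nmem s' 0 6 = 1%N -> nmem s' 0 4 = c ->
     exec I sigma [::] T Q s') ->
  exec I sigma take_cmds (6 + T) Q s.
Proof.
move=> co [le1 le2] hE sn hg h4 hQ; rewrite /take_cmds -[X in exec _ _ X]cats0.
apply: (exec_seq (t1 := 6) (t2 := T)); last by [].
apply: exec_rset; apply: exec_nset; apply: exec_nset.
set s1 := setn _ _ _ _.
have co1 : common st w t s1 by do 2 apply: common_tmp => //; exact: common_setr.
have s1E : [/\ nmem s1 0 7 = (time e).+1, rmem s1 0 0 = g, nmem s1 0 6 = 1%N & nmem s1 0 4 = c].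
  by split; rewrite /= /put //= ?hE ?addn1.
case: s1E => k7 k0 k6 k4.
have ledger1 : nmem s1 0 8 = nmem s 0 8 by [].
apply: (exec_if (t1 := 2) (t := 0)); last by [].
rewrite [evalt _ _]/= -[put _ _ _ _ _ _]/(nmem s1 0 8).
have sh1 : shortlist s1 = shortlist s /\ seen s1 = (time e).+1 by [].
clearbody s1; case: sh1 => sh1 sn1; case: ltnP => b0.
  have cur : current_item sigma s1 = [set e].
    apply/setP => d; rewrite inE; apply/imsetP/eqP => [[h]|->].
      by rewrite inE sn1 eqSS => /eqP hh ->; rewrite -[e](permKV sigma); congr (sigma _); exact: val_inj.
    by exists ((sigma^-1)%g e); rewrite ?permKV // inE sn1.
  apply: exec_accept; rewrite cur; apply: exec_nset; do 2 apply: exec_nil.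
  apply: hQ => //.
  split=> //; [|by rewrite sn -sn1|].
  - case: co1 => [[h1a h1b h1c h1d] h2 h3 hh4 h5 h6 h7 h8 h9 h10].
    split=> //.
    rewrite [nmem _ 0 8]/= /put /= ledger1 subn1.
    rewrite ledger1 in h10 b0; apply: leq_trans h10; rewrite -(prednK b0) addnS -addSn leq_add2r.
    by have [+ _] := leq_card_setU (shortlist s1) [set e]; rewrite cards1 addn1.
  - split; first by rewrite [nmem _ 0 8]/= /put /= ledger1 subn1 /=; lia.
    rewrite /= addnS => le3 d; rewrite mem_cat !inE => dd.
    have : d \in st.1 ++ tk -> d \in shortlist s1 by rewrite sh1; apply: le2; exact: ltnW.
    rewrite mem_cat; case/or3P: dd => [->|/eqP->|->]; rewrite ?eqxx ?orbT //= => -> //.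
(* With no capacity left, the first clause of [ledger] pushes the new count beyond [cap], and the
   second clause becomes vacuous. *)
do 2 apply: exec_nil; apply: hQ => //; split; rewrite ?sn ?sn1 //.
rewrite /ledger ledger1 sh1; split=> /=; first by lia.
by move: le1 b0; rewrite leqn0 => le1 /eqP b0; lia.
Qed.

Lemma exec_late st w X s (a0 := foldl (scan_step (gain I st) false) (base I st (r w), [::])
    (early_of sigma c0 c1 w)) :
  (w < m)%N -> valid I st -> by_time sigma st.1 ->
  common st w (window_start c0 c1 w + c0 w) s -> seen s = (window_start c0 c1 w + c0 w)%N ->
  ledger st X [::] s -> nmem s 0 7 = code (rpick I st (r w)) -> rmem s 0 0 = a0.1 ->
  nmem s 0 6 = 0%N ->
  let tk := takes I st (r w) (early_of sigma c0 c1 w) (late_of sigma c0 c1 w) in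
  exec I sigma (for_to 4 (NCell (NLit 3) (var 2)) (late_cmds p)) (2 + c1 w * (15 + eval_time))
    (fun s' => [/\ common st w (window_start c0 c1 w.+1) s',
        seen s' = (window_start c0 c1 w.+1)%N, ledger st X tk s',
        nmem s' 0 7 = code (if ohead tk is Some e then Some e else rpick I st (r w)) &
        nmem s' 0 6 = ~~ nilp tk]) s.
Proof.
move=> wm stv bt co sn le h7 h0 h6 tk; rewrite window_startS.
set ws := (window_start c0 c1 w + c0 w)%N in co sn *.
have a02 : a0 = (a0.1, [::]) by have [e2 _ _ _] := scan_initP (gain I st) (base I st (r w))
  (early_of sigma c0 c1 w); rewrite [LHS]surjective_pairing e2.
pose l := late_of sigma c0 c1 w; pose a c := foldl (scan_step (gain I st) true) a0 (take c l).
pose P c s' := [/\ common st w (ws + c) s', seen s' = (ws + c)%N, ledger st X (a c).2 s',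
  nmem s' 0 7 = code (if ohead (a c).2 is Some e then Some e else rpick I st (r w)) &
  rmem s' 0 0 = (a c).1] /\ (nmem s' 0 4 = c /\ nmem s' 0 6 = ~~ nilp (a c).2).
have sl : size l = c1 w by exact: (size_late_of sigma ws_le wm).
have atk : (a (c1 w)).2 = tk by rewrite /a -sl take_size.
apply: (exec_imp (Q := P (c1 w))).
  by move=> s' [[q1 q2 q3 q4 q5] [_ q6]]; rewrite atk in q3 q4 q6.
have -> : (15 + eval_time = (13 + eval_time).+2)%N by [].
apply: exec_for.
- split; last by rewrite /a take0 a02.
  by split; rewrite ?addn0 //; [exact: common_tmp | rewrite /a take0 a02 | rewrite /a take0 a02 | rewrite /a take0].
- by move=> c s' [[q1 _ _ _ _] [q6 _]]; rewrite /= (co_w q1) (co_c1 q1).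
move=> c s' cl [[q1 q2 q3 q4 q5] [q6 q7]].
have [e0 _] : exists e0 : 'I_n, True by move: cl; rewrite -sl; case: (l) => // e0 *; exists e0.
have te := time_late_of sigma ws_le e0 wm cl; set e := nth e0 _ c in te.
apply: (exec_seq (t1 := 2 + eval_time) (t2 := 11)); last by rewrite /eval_time; lia.
apply: exec_imp (exec_visit stv bt q1 q2 te) => s1 [[k1 k2 k3 k4] [k5 k6 k7]].
have le1 : ledger st X (a c).2 s1 by rewrite /ledger k5 // k7.
have aS : a c.+1 = scan_step (gain I st) true (a c) e.
  have cl' : (c < size l)%N by rewrite sl.
  by rewrite /a (take_nth e0 cl') foldl_rcons.
have fin s2 t2 : common st w (ws + c) s2 -> seen s2 = seen s1 -> ledger st X (a c.+1).2 s2 ->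
    nmem s2 0 7 = code (if ohead (a c.+1).2 is Some e then Some e else rpick I st (r w)) ->
    nmem s2 0 4 = c -> rmem s2 0 0 = (a c.+1).1 -> nmem s2 0 6 = ~~ nilp (a c.+1).2 ->
    exec I sigma [:: incr 5] t2.+1 (fun s3 => nmem s3 0 4 = c /\ P c.+1 (setn s3 0 4 c.+1)) s2.
  move=> co2 sn2 le2 h72 h42 h02 h62; apply: exec_nset; apply: exec_nil => /=.
  rewrite /put /= (co_t co2); split=> //; split=> //; rewrite addnS addn1; split=> //.
  - by apply: common_tmp => //; case: co2 => *; split=> //; exact: holds_setn.
  - by rewrite /= sn2.
have tE : nmem s1 0 10 = time e by rewrite k3 te.
have sE : seen s1 = (time e).+1 by rewrite k2 te.
have h4 : nmem s1 0 4 = c by rewrite k5.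
have taken : a c.+1 = (gain I st e, e :: (a c).2) -> exec I sigma take_cmds 6
    (exec I sigma [:: incr 5] 1 (fun s3 => nmem s3 0 4 = c /\ P c.+1 (setn s3 0 4 c.+1))) s1.
  move=> aE; apply: (exec_take (T := 0) k1 le1 tE sE k4 h4) => s2 [u1 u2 u3 u4 u5] u6 u7.
  by apply: exec_nil; apply: fin; rewrite ?aE.
have kept : a c.+1 = a c -> exec I sigma [:: incr 5] 1
    (fun s3 => nmem s3 0 4 = c /\ P c.+1 (setn s3 0 4 c.+1)) s1.
  by move=> aE; apply: fin; rewrite ?aE ?k5 ?k6.
apply: (exec_if (t1 := 9) (t := 1)); last by [].
have -> : evalt s1 (RLt thr gain_e) = ((a c).1 < gain I st e) by rewrite /= k4 k6 q5.
rewrite /scan_step in aS; case: ifP aS => [_|_] aS.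
  by apply: exec_le (taken aS).
apply: (exec_if (t1 := 7) (t := 0)); last by [].
have -> : evalt s1 (NLt (var 6) (NLit 1)) = nilp (a c).2.
  by rewrite /= k5 // q7; case: nilp.
case: (nilp (a c).2) aS => /= aS; last by do 2 apply: exec_nil; exact: kept.
apply: (exec_if (t1 := 6) (t := 0)); last by [].
have -> : evalt s1 (RLt gain_e thr) = (gain I st e < (a c).1) by rewrite /= k4 k6 q5.
rewrite ltNge; case: ifP aS => /= _ aS; last by do 3 apply: exec_nil; exact: kept.
apply: exec_imp (taken aS) => s2 h; by do 2 apply: exec_nil.
Qed.

Definition commit_time := (12 + p * (35 + 21 * max_rank I))%N.

Lemma exec_finish st w t X tk j s : valid I st -> by_time sigma st.1 ->
  (forall e, e \in st.1 -> (time e < seen s)%N) ->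
  (forall e, e \in tk -> (time e < seen s)%N /\ e \notin st.1) ->
  common st w t s -> ledger st X tk s ->
  nmem s 0 7 = code (if ohead tk is Some e then Some e else rpick I st j) ->
  nmem s 0 6 = ~~ nilp tk ->
  let st' := next_state I st j (ohead tk) in
  exec I sigma (finish_cmds p) (6 + commit_time) (fun s' =>
    [/\ common st' w t s', seen s' = seen s & ledger st' (X + size tk) [::] s']) s.
Proof.
move=> stv bt ltS ltT co [le1 le2] h7 h6 st'.
have led s' : nmem s' 0 8 = nmem s 0 8 -> shortlist s' = shortlist s ->
    ledger st' (X + size tk) [::] s'.
  move=> e8 esh; rewrite /ledger e8 esh addn0; split=> // /le2 sub d.
  rewrite cats0 /st' mem_hist_next => dh; apply: sub; rewrite mem_cat.
  case E: (ohead tk) dh => [e|]; last by move->.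
  by rewrite mem_rcons inE => /predU1P[->|->//]; rewrite (ohead_mem E) orbT.
apply: (exec_if (t1 := 5 + commit_time) (t := 0)); last by rewrite addn0.
have -> : evalt s (NLt (NLit 0) (var 7)) = (0 < nmem s 0 7)%N by [].
rewrite h7; case sel: (if ohead tk is Some e then Some e else rpick I st j) => [e|] /=; last first.
  do 2 apply: exec_nil; split=> //; last exact: led.
  suff -> : st' = st by [].
  by rewrite /st' /next_state; case: (ohead tk) sel => // ->.
have eS : e \notin st.2.
  case E: (ohead tk) sel => [e'|].
    move=> [<-]; have [_] := ltT _ (ohead_mem E); apply: contraNN; exact: (valid_sub stv).
  move=> /rpickP[_ g0]; apply/negP => eS; by rewrite (gain_eq0 stv eS) ltxx in g0.
have eseen : (time e < seen s)%N.
  case E: (ohead tk) sel => [e'|]; first by move=> [<-]; have [] := ltT _ (ohead_mem E).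
  by move=> /rpickP[eR _]; exact: ltS.
have st'E : st' = (if ohead tk is Some _ then rcons st.1 e else st.1, commit I st e).
  by rewrite /st' /next_state; case: (ohead tk) sel => [e' [->]|->].
apply: exec_nset; rewrite [evaln s (NSub _ _)]/= h7 sel /= subn1 /=.
set s1 := setn s _ _ _; have co1 : common st w t s1 by exact: common_tmp.
apply: (exec_seq (c1 := swap_cmds p ++ register_cmds p) (t1 := commit_time) (t2 := 4)); last first.
  by rewrite addnC.
have := exec_commit stv mp bt st'.1 (co_holds co1) eS (erefl : nmem s1 0 10 = time e) eseen.
apply: exec_imp => s2 [ag h2]; have [a1 a2 a3 a4] := ag.
have {}h2 : holds I sigma st' s2 by move: h2; rewrite st'E.
have k6 : nmem s2 0 6 = ~~ nilp tk by rewrite a1 //= /put /= h6.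
have k10 : nmem s2 0 10 = time e by rewrite a1 //.
have k9 : nmem s2 0 9 = size st.1 by rewrite a1 //; exact: (co_size co).
have h4 : list_rep sigma 4 st.1 s2 by exact: list_rep_agree ag (co_hist co1).
have k8 : nmem s2 0 8 = nmem s 0 8 by rewrite a1.
have [q1 q2 q3] : [/\ nmem s2 0 1 = k, nmem s2 0 2 = w & nmem s2 0 5 = t].
  by case: co => _ ? ? ? _ _ _ _ _ _; rewrite !a1.
have [q4 q5 q6] : [/\ forall v, (v < m)%N -> nmem s2 2 v = c0 v,
   forall v, (v < m)%N -> nmem s2 3 v = c1 v & forall v, (v < m)%N -> nmem s2 5 v = r v].
  case: co1 => _ _ _ _ C0 C1 Tp _ _ _; split=> v vm.
  - by rewrite a1 // C0.
  - by rewrite a1 // C1.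
  - by rewrite a1 // Tp.
have cp : (#|shortlist s2| + nmem s2 0 8 <= cap)%N by rewrite a4 k8 (co_cap co).
have led2 : ledger st' (X + size tk) [::] s2 by apply: led; rewrite ?a4.
have sn2 : seen s2 = seen s by rewrite a3.
have E1 : st'.1 = if ohead tk is Some _ then rcons st.1 e else st.1 by rewrite st'E.
clearbody st'; apply: (exec_if (t1 := 2) (t := 0)); last by [].
have -> : evalt s2 (NLt (NLit 0) (var 6)) = ~~ nilp tk by rewrite /= k6; case: nilp.
case: (tk) E1 led2 => [|e' tk'] E1 led2 /=.
  by do 3 apply: exec_nil; split=> //; split; rewrite ?E1.
apply: exec_nset; apply: exec_nset; do 3 apply: exec_nil.
rewrite [evaln s2 (var 9)]/= k9 [evaln s2 (var 10)]/= k10.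
split=> //; split=> //.
- by do 2 apply: holds_setn => //.
- by rewrite E1; apply: list_rep_setn => //; apply: list_rep_rcons.
- by rewrite E1 size_rcons /= /put /= k9 addn1.
Qed.

Definition window_time c := (24 + commit_time + eval_time + c * (15 + eval_time))%N.

Lemma exec_window w X s (st := run I (early_of sigma c0 c1) (late_of sigma c0 c1) r w) :
  (w < m)%N -> common st w (window_start c0 c1 w) s -> seen s = window_start c0 c1 w ->
  ledger st X [::] s ->
  let st' := run I (early_of sigma c0 c1) (late_of sigma c0 c1) r w.+1 in
  let tk := takes_at I (early_of sigma c0 c1) (late_of sigma c0 c1) r w in
  exec I sigma (window_cmds p) (window_time (c0 w + c1 w)) (fun s' =>
    [/\ common st' w (window_start c0 c1 w.+1) s', seen s' = window_start c0 c1 w.+1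
      & ledger st' (X + size tk) [::] s']) s.
Proof.
move=> wm co sn le st' tk; have [stv bt lt] := run_history sigma r f0 fm ws_le (ltnW wm).
apply: (exec_seq (c1 := recall_cmds p) (t1 := 8 + eval_time)
  (t2 := 16 + commit_time + (c0 w + c1 w) * (15 + eval_time))); last first.
  by rewrite /window_time; lia.
have ltS e : e \in st.1 -> (time e < seen s)%N by rewrite sn; exact: lt.
apply: exec_imp (exec_recall wm stv bt ltS co le) => s1 [co1 sn1 le1 h71 h01].
apply: (exec_seq (t1 := 2 + c0 w * (8 + eval_time))
  (t2 := (13 + commit_time + c1 w * (15 + eval_time)).+1)); last by lia.
apply: exec_imp (exec_early wm stv bt co1 (etrans sn1 sn) le1 h71 h01) => s2 [co2 sn2 le2 h72 h02].
apply: exec_nset; rewrite [evaln _ _]/= [evaln _ _]/=.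
set s3 := setn _ _ _ _; have co3 : common st w (window_start c0 c1 w + c0 w) s3.
  exact: common_tmp.
apply: (exec_seq (t1 := 2 + c1 w * (15 + eval_time)) (t2 := 6 + commit_time)); last by lia.
have h73 : nmem s3 0 7 = code (rpick I st (r w)) by rewrite -h72.
have := exec_late wm stv bt co3 sn2 (le2 : ledger st X [::] s3) h73 h02 (erefl : nmem s3 0 6 = 0%N).
apply: exec_imp => s4 [co4 sn4 le4 h74 h64].
apply: exec_imp (exec_finish stv bt _ _ co4 le4 h74 h64).
- by move=> s5 [u1 u2 u3]; split=> //; rewrite u2.
- move=> e /lt le5; rewrite sn4 window_startS; lia.
- move=> e /(takes_sub ws_le wm) el; split; last exact: (late_not_hist r f0 fm ws_le wm el).
  by rewrite sn4; have /andP[] := time_mem_late ws_le wm el.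
Qed.

Lemma exec_main_loop s : holds I sigma ([::], [::]) s -> nmem s 0 1 = k -> nmem s 0 5 = 0%N ->
  nmem s 0 9 = 0%N -> seen s = 0%N -> shortlist s = set0 ->
  (forall v, (v < m)%N -> [/\ nmem s 2 v = c0 v, nmem s 3 v = c1 v & nmem s 5 v = r v]) ->
  exec I sigma ([:: assign 8 (capacity N L)] ++ for_to 2 (windows N) (window_cmds p))
    (3 + (m * (26 + commit_time + eval_time) + n * (15 + eval_time)))
    (fun s' => (#|shortlist s'| <= cap)%N /\
       outcome I m cap sigma c0 c1 r <= best_within I (shortlist s')) s.
Proof.
move=> hs h1 h5 h9 sn sh tab.
have capE : evaln s (capacity N L) = cap.
  by rewrite /capacity evaln_times /= h1 /cap /m mulnAC.
apply: exec_nset; rewrite [evaln s (NLit 0)]/= [evaln s (NLit 8)]/= capE.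
set s0 := setn _ _ _ _.
pose l0 := early_of sigma c0 c1; pose l1 := late_of sigma c0 c1.
pose X w := (\sum_(v < w) size (takes_at I l0 l1 r v))%N.
pose P w s' := [/\ common (run I l0 l1 r w) w (window_start c0 c1 w) s',
  seen s' = window_start c0 c1 w & ledger (run I l0 l1 r w) (X w) [::] s'].
(* The time of a window is affine in its number of items, and all windows together contain at most
   [n] items. *)
apply: (exec_le (t := 2 + \sum_(w < m) (window_time (c0 w + c1 w)).+2)).
  have wt c : (window_time c).+2 = (26 + commit_time + eval_time + c * (15 + eval_time))%N.
    by rewrite /window_time; lia.
  rewrite -[X in (_ <= X)%N]add2n leq_add2l; under eq_bigr do rewrite wt.
  rewrite big_split /= sum_nat_const card_ord leq_add2l -big_distrl /= leq_mul2r.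
  by rewrite ws_le orbT.
apply: (exec_imp (Q := P m)).
  move=> s' [co _ [_ sub]]; rewrite addn0 in sub; split.
    by apply: leq_trans (co_cap co); exact: leq_addr.
  rewrite /outcome -/l0 -/l1 -/(X m); case: ifP => [/sub hist|_]; last exact: best_within_ge0.
  have [v _ _] := run_history sigma r f0 fm ws_le (leqnn m).
  apply: best_within_ge (valid_feas v); apply/subsetP => d; rewrite inE => /(valid_sub v) dh.
  by apply: hist; rewrite cats0.
have tab' v : (v < m)%N -> [/\ nmem s0 2 v = c0 v, nmem s0 3 v = c1 v & nmem s0 5 v = r v].
  by move/tab.
apply: (exec_for_sum (t := fun w => window_time (c0 w + c1 w))).
- split; rewrite /window_start ?big_ord0 //.
    split=> //; try by move=> v /tab'[].
    + by do 2 apply: holds_setn => //.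
    + by rewrite /= sh cards0.
  by split; rewrite /X big_ord0 // => d.
- by move=> w s' [co _ _]; rewrite (co_w co) evaln_times /= (co_k co).
move=> w s' wm [co sn' le].
apply: exec_imp (exec_window wm co sn' le) => s2 [co2 sn2 le2]; split; first exact: (co_w co2).
have XS : X w.+1 = (X w + size (takes_at I l0 l1 r w))%N by rewrite /X big_ord_recr.
split=> //; last by rewrite XS.
by case: co2 => *; split=> //; exact: holds_setn.
Qed.

End MainLoop.

(** * Averaging over the draws *)

Section Draws.
Implicit Types (d : seq nat).

(* The first draws are the windows and slots of the items in turn; the tape follows. *)
Definition early_drawn d c v :=
  count (fun u => (nth 0%N d u.*2 == v) && (nth 0%N d u.*2.+1 == 0%N)) (iota 0 c).
Definition late_drawn d c v :=
  count (fun u => (nth 0%N d u.*2 == v) && (0 < nth 0%N d u.*2.+1)%N) (iota 0 c).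

Lemma early_drawnS d c v : early_drawn d c.+1 v =
  (early_drawn d c v + ((nth 0%N d c.*2 == v) && (nth 0%N d c.*2.+1 == 0%N)))%N.
Proof. by rewrite /early_drawn -(addn1 c) iotaD count_cat /= add0n addn0. Qed.

Lemma late_drawnS d c v : late_drawn d c.+1 v =
  (late_drawn d c v + ((nth 0%N d c.*2 == v) && (0 < nth 0%N d c.*2.+1)%N))%N.
Proof. by rewrite /late_drawn -(addn1 c) iotaD count_cat /= add0n addn0. Qed.

Lemma nth_pair_cat d d' c u : (c.*2 <= size d)%N -> (u < c)%N ->
  nth 0%N (d ++ d') u.*2 = nth 0%N d u.*2 /\ nth 0%N (d ++ d') u.*2.+1 = nth 0%N d u.*2.+1.
Proof.
move=> cd uc; have u2 : (u.*2.+1 < size d)%N by apply: leq_trans cd; rewrite -doubleS leq_double.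
by rewrite !nth_cat u2 (ltn_trans _ u2).
Qed.

Lemma early_drawn_cat d d' c v : (c.*2 <= size d)%N ->
  early_drawn (d ++ d') c v = early_drawn d c v.
Proof.
move=> cd; apply: eq_in_count => u; rewrite mem_iota add0n => /andP[_ uc].
by have [-> ->] := nth_pair_cat d' cd uc.
Qed.

Lemma late_drawn_cat d d' c v : (c.*2 <= size d)%N ->
  late_drawn (d ++ d') c v = late_drawn d c v.
Proof.
move=> cd; apply: eq_in_count => u; rewrite mem_iota add0n => /andP[_ uc].
by have [-> ->] := nth_pair_cat d' cd uc.
Qed.

Lemma sum_drawn_le d c m : (window_start (early_drawn d c) (late_drawn d c) m <= c)%N.
Proof.
rewrite /window_start; elim: c => [|c IH]; first by rewrite big1.
under eq_bigr => v _ do rewrite early_drawnS late_drawnS addnACA.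
rewrite big_split /= -[in X in (_ <= X)%N]addn1 leq_add //.
apply: (@leq_trans (\sum_(v < m) (nth 0%N d c.*2 == v))%N).
  apply: leq_sum => v _; rewrite lt0n.
  by case: (_ == _ :> nat) => //; case: (_ == _).
elim: m {IH} => [|m IH]; first by rewrite big_ord0.
rewrite big_ord_recr /=; case: eqP => [->|_]; last by rewrite addn0.
by rewrite big1 // => v _; rewrite gtn_eqF.
Qed.

End Draws.

Arguments prepare_cmds : simpl never.

(** * From the draws to a run of the program *)

Section Machine.
Context {R : realType} {n : nat}.
Variables (I : instance R n) (sigma : 'S_n) (p N L : nat).
Let k := max_feasible_size I.
Let m := (N.+1 * k)%N.
Let cap := (m * L)%N.
Hypotheses (f0 : nonnegative (val_f I)) (fm : monotone (val_f I)) (mp : is_matchoid p I).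
Implicit Types (s : state R n) (d : seq nat).

Definition drawn_outcome d : R :=
  outcome I m cap sigma (early_drawn d n) (late_drawn d n) (fun v => nth 0%N d (n.*2 + v)).

Record prepared c d s : Prop := Prepared {
  pr_n : nmem s 0 0 = n;
  pr_k : nmem s 0 1 = k;
  pr_t : nmem s 0 5 = 0%N;
  pr_hist : nmem s 0 9 = 0%N;
  pr_seen : seen s = 0%N;
  pr_short : shortlist s = set0;
  pr_sol : forall j, (j < c)%N -> nmem s 1 j = n;
  pr_early : forall v, nmem s 2 v = early_drawn d c v;
  pr_late : forall v, nmem s 3 v = late_drawn d c v;
  pr_len : forall j, nmem s 7 j = 0%N;
  pr_size : size d = c.*2
}.

Lemma prepared_setn c d s j v : (2 <= j)%N -> j != 5 -> j != 9 -> prepared c d s ->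
  prepared c d (setn s 0 j v).
Proof.
move=> j2 j5 j9 [h1 h2 h3 h4 h5 h6 h7 h8 h9 h10 h11]; split; rewrite //= /put /=.
- by case: j j2 {j5 j9} => [|[]].
- by case: j j2 {j5 j9} => [|[]].
- by rewrite eq_sym (negPf j5).
- by rewrite eq_sym (negPf j9).
Qed.

Lemma dexec_prepare c d s : prepared c d s -> nmem s 0 2 = c ->
  dexec I sigma (prepare_cmds N) 5 [:: maxn 1 m; maxn 1 N.+1]
    (fun d' s' => nmem s' 0 2 = c /\ prepared c.+1 (d ++ d') (setn s' 0 2 c.+1)) s.
Proof.
move=> pr h2; have mE (s' : state R n) : nmem s' 0 1 = k -> evaln s' (windows N) = m.
  by move=> h; rewrite /windows evaln_times /= h.
pose c1 := [:: NSet (var 0) (NLit 1) (var 2)].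
pose c2 := [:: Draw (windows N) (NLit 0) (NLit 18)].
pose c3 := [:: Draw (NLit N.+1) (NLit 0) (NLit 19)].
apply: (@dexec_cat _ _ _ _ c1 _ 1 4 [::] [:: maxn 1 m; maxn 1 N.+1]).
apply: dexec_exec; apply: exec_nset; apply: exec_nil; rewrite /= (pr_n pr) h2.
set s1 := setn _ _ _ _; have k1 : nmem s1 0 1 = k by exact: (pr_k pr).
rewrite -(mE s1 k1); apply: (@dexec_cat _ _ _ _ c2 _ 1 3 [:: _] [:: maxn 1 N.+1]).
apply: dexec_draw => x _;
apply: (@dexec_cat _ _ _ _ c3 _ 1 2 [:: _] [::]).
apply: dexec_draw => y _; apply: dexec_exec.
rewrite /=; set s3 := setn _ _ _ _.
have h11 := pr_size pr.
have nx : nth 0%N (d ++ [:: x; y]) c.*2 = x by rewrite nth_cat h11 ltnn subnn.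
have ny : nth 0%N (d ++ [:: x; y]) c.*2.+1 = y by rewrite nth_cat h11 ltnNge leqnSn subSnn.
have dE v : early_drawn (d ++ [:: x; y]) c v = early_drawn d c v.
  by rewrite early_drawn_cat // h11.
have dL v : late_drawn (d ++ [:: x; y]) c v = late_drawn d c v.
  by rewrite late_drawn_cat // h11.
have fin s' : (forall j, (j < 18)%N -> nmem s' 0 j = nmem s 0 j) ->
    (forall j, nmem s' 1 j = nmem s1 1 j) -> (forall j, nmem s' 7 j = nmem s 7 j) ->
    seen s' = seen s -> shortlist s' = shortlist s ->
    (forall v, nmem s' 2 v = nmem s 2 v + ((x == v) && (y == 0%N)))%N ->
    (forall v, nmem s' 3 v = nmem s 3 v + ((x == v) && (0 < y)%N))%N ->
    nmem s' 0 2 = c /\ prepared c.+1 (d ++ [:: x; y]) (setn s' 0 2 c.+1).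
  move=> e0 e1 e7 es esh u2 u3; split; first by rewrite e0.
  split; rewrite ?[nmem _ 0 _]/= ?[seen _]/= ?[shortlist _]/= /put /= ?e0 ?es ?esh //; try by case: pr.
  - move=> j; rewrite ltnS leq_eqVlt /put /= e1 /= /put /= => /predU1P[->|jc]; first by rewrite eqxx.
    by rewrite ltn_eqF //; exact: (pr_sol pr).
  - by move=> v; rewrite /put /= u2 early_drawnS nx ny dE (pr_early pr).
  - by move=> v; rewrite /put /= u3 late_drawnS nx ny dL (pr_late pr).
  - by move=> j; rewrite /put /= e7; exact: (pr_len pr).
  - by rewrite size_cat h11 addn2.
apply: (exec_if (t1 := 1) (t := 0)); last by [].
have -> : evalt s3 (NLt (var 19) (NLit 1)) = (y == 0%N) by rewrite /= /put /=; case: (y).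
case: (eqVneq y 0%N) => y0; apply: exec_nset; do 2 apply: exec_nil; apply: fin => //.
- by move=> j j18; rewrite /= /put /= !ltn_eqF // ltnW.
- move=> v; rewrite /= /put /= [in RHS]eq_sym.
  by case: (eqVneq v x) => [->|]; rewrite y0 ?addn0.
- by move=> v; rewrite y0 /= andbF addn0.
- by move=> j j18; rewrite /= /put /= !ltn_eqF // ltnW.
- by move=> v; rewrite (negPf y0) andbF addn0.
- move=> v; rewrite /= /put /= [in RHS]eq_sym lt0n y0 andbT.
  by case: (eqVneq v x) => [->|] //; rewrite ?addn0.
Qed.

Definition main_time := ((2 + n * 7) + ((2 + m * 3) +
  (3 + (m * (26 + commit_time I p + eval_time I p) + n * (15 + eval_time I p)))))%N.

(** [maxn 1] follows the convention of [Draw] for an empty range, met here when [k] is 0. *)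
Definition main_draws :=
  flatten (nseq n [:: maxn 1 m; maxn 1 N.+1]) ++ (flatten (nseq m [:: maxn 1 m]) ++ [::]).

Lemma drun_main : drun I sigma main_time main_draws
  (fun d s => (#|shortlist s| <= cap)%N /\ drawn_outcome d <= best_within I (shortlist s))
  (start (main_program p N L) k).
Proof.
rewrite -[start _ _]/(conf (main_program p N L) (start [::] k)).
apply: dexec_drun => //; set s0 := start [::] k.
have mE c d (s' : state R n) : prepared c d s' -> evaln s' (windows N) = m.
  by move=> pr; rewrite /windows evaln_times /= (pr_k pr).
pose P c d s := prepared c d s /\ nmem s 0 2 = c.
apply: dexec_cat; apply: (dexec_imp (Q := P n)); last first.
  apply: (dexec_for (t := 5)).
  - split=> //; apply: prepared_setn => //; split.
  - by move=> c d s [pr h2]; rewrite /= (pr_n pr).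
  - move=> c d s cn [pr h2]; apply: dexec_imp (dexec_prepare pr h2) => d' s' [h2' pr'].
    by [].
move=> d1 s1 [pr1 _].
pose P2 i d s := [/\ prepared n d1 s, nmem s 0 2 = i, size d = i &
  forall v, (v < i)%N -> nmem s 5 v = nth 0%N d v].
apply: dexec_cat; apply: (dexec_imp (Q := P2 m)); last first.
  apply: (dexec_for (t := 1)).
  - by split=> //; exact: prepared_setn.
  - by move=> i d s [pr h2 _ _]; rewrite (mE _ _ _ pr).
  - move=> i d s im [pr h2 sd h5]; rewrite -(mE _ _ _ pr).
    apply: dexec_draw => v _; rewrite [evaln _ _]/= [evaln _ _]/= h2; split=> //; split=> //.
    + by apply: prepared_setn => //; case: pr => *; split.
    + by rewrite size_cat sd addn1.
    + move=> u; rewrite ltnS leq_eqVlt /= /put /= => /predU1P[->|ui].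
        by rewrite eqxx nth_cat sd ltnn subnn.
      by rewrite ltn_eqF // nth_cat sd ui h5.
move=> d2 s2 [pr2 h2 sd h5].
apply: dexec_exec; pose d := d1 ++ d2.
have sE : early_drawn d1 n =1 early_drawn d n.
  by move=> v; rewrite early_drawn_cat // (pr_size pr2).
have sL : late_drawn d1 n =1 late_drawn d n.
  by move=> v; rewrite late_drawn_cat // (pr_size pr2).
have ws_le := sum_drawn_le d n m.
have := @exec_main_loop _ _ I sigma p N L (early_drawn d n) (late_drawn d n)
  (fun v => nth 0%N d (n.*2 + v)) k f0 fm mp ws_le s2.
move=> ex; rewrite cats0; apply: ex.
- split; first exact: (pr_n pr2).
  + move=> e; rewrite (pr_sol pr2 (time_lt _ _)) inE; by [].
  + by move=> e; rewrite inE.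
  move=> i; exists [::]; split=> //; first exact: (pr_len pr2).
- exact: (pr_k pr2).
- exact: (pr_t pr2).
- exact: (pr_hist pr2).
- exact: (pr_seen pr2).
- exact: (pr_short pr2).
- move=> v vm; rewrite (pr_early pr2) (pr_late pr2) sE sL h5 //; split=> //.
  by rewrite nth_cat (pr_size pr2) ltnNge leq_addr /= addKn.
Qed.

End Machine.

(** * Averages over draws as averages over finite functions *)

Section Averages.
Context {R : realType}.
Implicit Types (bs : seq nat) (H : seq nat -> R).

Lemma mean_cat bs bs' H : mean (bs ++ bs') H = mean bs (fun d => mean bs' (fun d' => H (d ++ d'))).
Proof.
elim: bs H => //= b bs IH H.
by congr (_ / _); apply: eq_bigr => v _; rewrite IH.
Qed.

(** Independent blocks, each coded by a uniform element of [T], amount to a uniform tuple over [T]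
    and so to a uniform function. *)
Lemma mean_blocks (T : finType) bs (c : T -> seq nat) j :
  (forall H, mean bs H = (\sum_z H (c z)) / #|T|%:R) ->
  forall H, mean (flatten (nseq j bs)) H =
    (\sum_(x : {ffun 'I_j -> T}) H (flatten [seq c (x i) | i <- enum 'I_j])) /
    #|{ffun 'I_j -> T}|%:R.
Proof.
move=> base; have tup H : mean (flatten (nseq j bs)) H =
    (\sum_(t : j.-tuple T) H (flatten (map c t))) / #|T|%:R ^+ j.
  elim: j H => [|j IH] H /=.
    rewrite expr0 divr1 (big_pred1 [tuple]) // => t.
    by apply/esym/eqP; rewrite [t]tuple0.
  rewrite mean_cat base /=; under eq_bigr => z _ do rewrite IH.
  rewrite -mulr_suml -mulrA exprSr invfM; congr (_ * _).
  rewrite pair_big /= (reindex (fun q : T * j.-tuple T => [tuple of q.1 :: q.2])) /=.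
    by apply: eq_bigr => -[z t] _.
  exists (fun t : j.+1.-tuple T => (thead t, [tuple of behead t])) => [[z t] _|t _] /=.
    by rewrite theadE; congr pair; apply: val_inj.
  by rewrite [RHS]tuple_eta.
move=> H; rewrite tup card_ffun card_ord natrX; congr (_ / _).
rewrite (reindex (fun t : j.-tuple T => [ffun i => tnth t i])) /=.
  apply: eq_bigr => t _; congr (H (flatten _)).
  rewrite -[in LHS](map_tnth_enum t) -map_comp; apply: eq_map => i.
  by rewrite /= ffunE.
exists (fun x : {ffun 'I_j -> T} => [tuple x i | i < j]) => [t _|x _].
  by apply: eq_from_tnth => i; rewrite tnth_mktuple ffunE.
by apply/ffunP => i; rewrite ffunE tnth_mktuple.
Qed.

Lemma mean_pair M B H : mean [:: M; B] H =
  (\sum_(z : 'I_M * 'I_B) H [:: nat_of_ord z.1; nat_of_ord z.2]) / #|{: 'I_M * 'I_B}|%:R.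
Proof.
rewrite card_prod !card_ord natrM invfM mulrA mulrAC /= -mulr_suml.
by congr (_ / _ / _); rewrite pair_big.
Qed.

Lemma mean_one M H : mean [:: M] H = (\sum_(z : 'I_M) H [:: nat_of_ord z]) / #|'I_M|%:R.
Proof. by rewrite card_ord. Qed.

Lemma nth_pairs (T : Type) (a b : T -> nat) z0 zs d u : (u < size zs)%N ->
  nth 0%N (flatten [seq [:: a z; b z] | z <- zs] ++ d) u.*2 = a (nth z0 zs u) /\
  nth 0%N (flatten [seq [:: a z; b z] | z <- zs] ++ d) u.*2.+1 = b (nth z0 zs u).
Proof. by elim: zs u => //= z zs IH [|u] //; exact: IH. Qed.

Lemma mean_main_draws n (I : instance R n) (sigma : 'S_n) N L
    (m := (N.+1 * max_feasible_size I)%N) : (0 < m)%N ->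
  mean (main_draws I N) (drawn_outcome I sigma N L) =
  (\sum_(x : {ffun 'I_n -> 'I_m * 'I_N.+1}) \sum_(r : {ffun 'I_m -> 'I_m})
     outcome I m (m * L) sigma (early_count x) (late_count x) (tape r)) /
  (#|{ffun 'I_n -> 'I_m * 'I_N.+1}|%:R * #|{ffun 'I_m -> 'I_m}|%:R).
Proof.
move=> m0; rewrite /main_draws -/m (maxn_idPr m0) (maxn_idPr (ltn0Sn N)) mean_cat.
rewrite (mean_blocks _ (@mean_pair m N.+1)) invfM mulrA [RHS]mulrAC; congr (_ / _).
rewrite mulr_suml; apply: eq_bigr => x _; rewrite mean_cat (mean_blocks _ (@mean_one m)) /=.
congr (_ / _); apply: eq_bigr => r _; rewrite cats0.
set dx := flatten _; set dr := flatten _.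
have drE : dr = [seq nat_of_ord (r i) | i <- enum 'I_m].
  by rewrite /dr; elim: (enum _) => //= i l ->.
have sdx : size dx = n.*2.
  rewrite /dx -[n in RHS](size_enum_ord n); elim: (enum 'I_n) => //= i l ->.
  by [].
have nx (e : 'I_n) : nth 0%N (dx ++ dr) e.*2 = win x e /\ nth 0%N (dx ++ dr) e.*2.+1 = slot x e.
  have en : (e < size (enum 'I_n))%N by rewrite size_enum_ord.
  have := nth_pairs (fun i => nat_of_ord (x i).1) (fun i => nat_of_ord (x i).2) e dr en.
  by rewrite nth_ord_enum.
have cnt (P : nat -> nat -> bool) (Q : 'I_n -> bool) : (forall e : 'I_n,
    P (nth 0%N (dx ++ dr) e.*2) (nth 0%N (dx ++ dr) e.*2.+1) = Q e) ->
    count (fun u => P (nth 0%N (dx ++ dr) u.*2) (nth 0%N (dx ++ dr) u.*2.+1)) (iota 0 n) =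
    #|[set e | Q e]|.
  move=> PQ; rewrite -val_enum_ord count_map -size_filter.
  rewrite -(card_uniqP (filter_uniq _ (enum_uniq _))); apply: eq_card => e.
  by rewrite in_set mem_filter mem_enum andbT /= PQ.
have E0 : early_drawn (dx ++ dr) n = early_count x.
  apply/funext => v; apply: (cnt (fun a b => (a == v) && (b == 0%N))) => e.
  by have [-> ->] := nx e.
have E1 : late_drawn (dx ++ dr) n = late_count x.
  apply/funext => v; apply: (cnt (fun a b => (a == v) && (0 < b)%N)) => e.
  by have [-> ->] := nx e.
have E2 : (fun v => nth 0%N (dx ++ dr) (n.*2 + v)) = tape r.
  apply/funext => v; rewrite nth_cat sdx ltnNge leq_addr /= addKn drE /tape.
  case: insubP => [i _ <-|]; last first.
    by rewrite -leqNgt => mv; rewrite nth_default // size_map size_enum_ord.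
  have im : (i < size (enum 'I_m))%N by rewrite size_enum_ord ltn_ord.
  by rewrite (nth_map i _ _ im) nth_ord_enum.
by rewrite /drawn_outcome E0 E1 E2.
Qed.

End Averages.

Lemma mean_const (R : realType) bs (a : R) : all (leq 1) bs -> mean bs (fun _ => a) = a.
Proof.
elim: bs => //= b bs IH /andP[b0 /IH ->].
by rewrite sumr_const card_ord -[X in X / _]mulr_natr mulfK // pnatr_eq0 -lt0n.
Qed.

Lemma main_draws_pos (R : realType) n (I : instance R n) N : all (leq 1) (main_draws I N).
Proof.
rewrite /main_draws cats0 all_cat; apply/andP; split; apply/allP => b /flattenP[l].
  by move/nseqP => [-> _]; rewrite !inE => /orP[] /eqP->; rewrite leq_max.
by move/nseqP => [-> _]; rewrite !inE => /eqP->; rewrite leq_max.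
Qed.

(** * Running time and competitive ratio of the program *)

Section Bounds.
Context {R : realType} {n : nat}.
Variables (I : instance R n) (p N : nat).
Hypotheses (f0 : nonnegative (val_f I)) (fm : monotone (val_f I)) (mp : is_matchoid p I).
Let k := max_feasible_size I.
Let m := (N.+1 * k)%N.

Definition time_factor := (42 + 52 * p + N.+1 * (54 + 108 * p))%N.

Lemma main_time_le : (0 < n)%N ->
  (main_time I p N <= time_factor * (n * maxn 1 (max_rank I) ^ p))%N.
Proof.
move=> n0; set W := (maxn 1 (max_rank I) ^ p)%N.
have W1 : (1 <= W)%N by rewrite expn_gt0 leq_max.
have kn : (k <= n)%N.
  by apply/bigmax_leqP => S _; rewrite -[n in (_ <= n)%N]card_ord max_card.
(* The time per item involves the product of [p] and the rank. It vanishes for p = 0; otherwise the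
   rank is at most its power [W]. *)
have pW : (p * max_rank I <= p * W)%N.
  rewrite leq_mul2l /W; case: (p) => //= q; apply: (leq_trans (leq_maxr 1 _)).
  by rewrite expnS leq_pmulr // expn_gt0 leq_max.
have cW : (commit_time I p <= (12 + 56 * p) * W)%N by rewrite /commit_time; nia.
have eW : (eval_time I p <= (13 + 52 * p) * W)%N by rewrite /eval_time; nia.
have mn : (m <= N.+1 * n)%N by rewrite leq_mul2l kn orbT.
have h1 : (m * (29 + commit_time I p + eval_time I p) <= N.+1 * n * ((54 + 108 * p) * W))%N.
  by apply: leq_mul => //; lia.
have h2 : (n * (22 + eval_time I p) <= n * ((35 + 52 * p) * W))%N.
  by rewrite leq_mul2l; apply/orP; right; lia.
have h3 : (7 <= 7 * (n * W))%N by rewrite leq_pmulr // muln_gt0 n0.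
have -> : (time_factor * (n * W) = 7 * (n * W) + (N.+1 * n * ((54 + 108 * p) * W) +
    n * ((35 + 52 * p) * W)))%N by rewrite /time_factor; ring.
rewrite /main_time -/k -/m; move: h1 h2 h3; lia.
Qed.

Lemma ALG_ge0 P T : 0 <= ALG P I T.
Proof.
apply: divr_ge0 => //; apply: sumr_ge0 => sigma _.
have bw s : 0 <= best_within I (shortlist s) := best_within_ge0 I _.
elim: T (start P _) => [|T IH] s /=; first by case: ifP => _; exact: bw.
case: ifP => _; first exact: bw.
by apply: divr_ge0 => //; apply: sumr_ge0.
Qed.

Lemma ALG_ge_mean L T : (main_time I p N <= T)%N ->
  (\sum_sigma mean (main_draws I N) (drawn_outcome I sigma N L)) / (n`!)%:R <=
  ALG (main_program p N L) I T.
Proof.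
move=> mT; apply: ler_wpM2r; first by rewrite invr_ge0.
apply: ler_sum => sigma _.
apply: drun_expect (drun_le mT (drun_main sigma N L f0 fm mp)) _.
by move=> d s [].
Qed.

(** For the case [k = 0], in which there are no windows and the optimum is the value of the empty
    set. *)
Lemma ALG_ge_empty L T : (main_time I p N <= T)%N ->
  val_f I set0 <= ALG (main_program p N L) I T.
Proof.
move=> mT; have n0 : 0 < (n`!)%:R :> R by rewrite ltr0n fact_gt0.
rewrite /ALG ler_pdivlMr // -[X in _ * X%:R](card_Sn n) mulr_natr -sumr_const.
apply: ler_sum => sigma _; rewrite -[leLHS](mean_const _ (main_draws_pos I N)).
apply: drun_expect (drun_le mT (drun_main sigma N L f0 fm mp)) _.
by move=> d s _; apply: best_within_ge; [exact: sub0set|exact: feasible0].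
Qed.

Lemma ALG_ge_OPT L T eps : submodular (val_f I) -> eps < 1 -> 28%:R / eps <= N.+1%:R -> 0 < eps ->
  (0 < N)%N -> 2%:R * (4%:R / 3%:R * N.+1%:R) <= (4%:R / 3%:R) ^+ L :> R ->
  (main_time I p N <= T)%N ->
  p.+1%:R^-1 * (1 - (expR 1 ^+ p.+1)^-1 - eps) * OPT I <= ALG (main_program p N L) I T.
Proof.
move=> fs e1 Ne e0 N0 zL mT; have opt0 : 0 <= OPT I by exact: best_within_ge0.
have [k0|k0] := posnP k.
  have [O Of OE] := OPT_attained f0.
  have O0 : O = set0 by apply: cards0_eq; apply/eqP; rewrite -leqn0 -k0; exact: feasible_card.
  apply: le_trans (ALG_ge_empty L mT); rewrite -O0 OE ler_piMl //.
  have ep : 0 <= (expR 1 ^+ p.+1)^-1 :> R by rewrite invr_ge0 exprn_ge0 // expR_ge0.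
  rewrite mulrC ler_pdivrMr ?ltr0n // mul1r.
  by apply: (@le_trans _ _ 1); rewrite ?ler1n //; lra.
have m0 : (0 < m)%N by rewrite muln_gt0.
apply: le_trans (ALG_ge_mean L mT).
under eq_bigr => sigma _ do rewrite mean_main_draws //.
rewrite -mulr_suml ler_pdivlMr ?ltr0n ?fact_gt0 // ler_pdivlMr; last first.
  by rewrite -natrM ltr0n muln_gt0 !card_ffun !card_prod !card_ord !expn_gt0 -/k -/m (muln_gt0 m) m0.
have := sum_outcome f0 fm fs mp N0 k0 zL; apply: le_trans.
have fr := final_ratio p e1 Ne e0 k0 (erefl m).
have ac (x b c d : R) : x * b * (c * d) = b * c * d * x by ring.
rewrite ac; apply: ler_wpM2l; first by rewrite !mulr_ge0.
by apply: ler_wpM2r => //; rewrite lerBrDr.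
Qed.

End Bounds.

(** * Choice of the parameters, and the theorem *)

Lemma ln2_ge (R : realType) : 2%:R^-1 <= ln 2%:R :> R.
Proof.
have h : ln (1 + - 2%:R^-1) <= - 2%:R^-1 :> R by apply: le_ln1Dx; lra.
have e : 1 + - 2%:R^-1 = 2%:R^-1 :> R by field.
by move: h; rewrite e lnV ?posrE ?ltr0n // lerN2.
Qed.

(** Since (4/3)^3 >= 2, the choice L = 3 (u + 3) gives (4/3)^L >= 8 (N+1). For the size, 28/eps + 1
    <= 29/eps bounds N + 1. From 2^(u-1) < N + 1 and ln 2 >= 1/2 one gets u - 1 <= 2 (ln 29 + l)
    with ln 29 <= 28, hence u <= 57 + 2 l and L <= 180 + 6 l <= 180 (1 + l). *)
Lemma parameters_exist (R : realType) (eps : R) : 0 < eps -> eps < 1 -> exists N L,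
  [/\ (0 < N)%N, 28%:R / eps <= N.+1%:R, 2%:R * (4%:R / 3%:R * N.+1%:R) <= (4%:R / 3%:R) ^+ L :> R
    & (N.+1 * L)%:R <= (29%:R * 180%:R) / eps * (1 + ln (1 + eps^-1))].
Proof.
move=> e0 e1; have ei : 1 < eps^-1 by rewrite invf_gt1.
pose N := Num.truncn (28%:R / eps); pose u := up_log 2 N.+1.
have x28 : 28%:R <= 28%:R / eps by rewrite ler_peMr // ltW.
have /andP[Nle Ngt] : N%:R <= 28%:R / eps < N.+1%:R by apply: truncn_itv; exact: le_trans x28.
have N0 : (0 < N)%N by rewrite truncn_gt0; apply: le_trans x28; rewrite ler1n.
exists N, (3 * (u + 3))%N; split=> //; first exact: ltW.
  rewrite exprM; apply: (@le_trans _ _ (2%:R ^+ (u + 3))); last first.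
    by apply: lerXn2r; rewrite ?nnegrE //; lra.
  rewrite exprD; have : N.+1%:R <= 2%:R ^+ u :> R by rewrite -natrX ler_nat up_logP.
  move: (_ ^+ u) => z; lra.
set l := ln (1 + eps^-1); have l0 : 0 <= l by apply: ln_ge0; lra.
have NS : N.+1%:R <= 29%:R / eps by rewrite -natr1; move: Nle ei; rewrite ![_ / eps]mulrC; lra.
have ul : u%:R <= 57%:R + 2%:R * l.
  have N1 : (1 < N.+1)%N by rewrite ltnS.
  have u0 : (0 < u)%N by rewrite up_log_gt0.
  have := up_log_gtn (ltnSn 1) N1; rewrite -/u => lt.
  have : ln (2%:R ^+ u.-1) <= ln (29%:R * (1 + eps^-1)) :> R.
    rewrite ler_ln ?posrE ?exprn_gt0 //; last by lra.
    apply: (@le_trans _ _ N.+1%:R); first by rewrite -natrX ler_nat ltnW.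
    by apply: le_trans NS _; rewrite mulrDr mulr1; lra.
  rewrite lnXn // lnM ?posrE; [|lra|lra]; rewrite -/l -[ln 2%:R *+ _]mulr_natr => h.
  have h29 : ln 29%:R <= 28%:R :> R.
    by have := @le_ln1Dx R 28%:R; rewrite (_ : 1 + 28%:R = 29%:R); [apply; lra|ring].
  have h2 : 2%:R^-1 * u.-1%:R <= ln 2%:R * u.-1%:R :> R by rewrite ler_wpM2r // ln2_ge.
  have -> : u%:R = u.-1%:R + 1 :> R by rewrite natr1 prednK.
  by lra.
rewrite natrM; apply: (@le_trans _ _ (29%:R / eps * (180%:R * (1 + l)))).
  apply: ler_pM => //; rewrite natrM natrD; lra.
by rewrite le_eqVlt; apply/orP; left; apply/eqP; field; rewrite gt_eqF.
Qed.

Theorem theorem3 (R : realType) :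
  exists (C : R) (d : nat),
  forall (p : nat) (eps : R), 0 < eps ->
  exists (P : program) (K : nat),
  forall (n : nat) (I : instance R n),
    (0 < n)%N ->
    is_matchoid p I ->
    nonnegative (val_f I) -> monotone (val_f I) -> submodular (val_f I) ->
    let k := max_feasible_size I in
    let T := (K * (n * maxn 1 (max_rank I) ^ p))%N in
    [/\ runs_within P I T,
        shortlist_within P I T
          (C * (k%:R / eps) * (1 + ln (1 + eps^-1)) ^+ d)
      & (p.+1)%:R^-1 * (1 - (expR 1 ^+ p.+1)^-1 - eps) * OPT I <= ALG P I T].
Proof.
(* The constant comes from [parameters_exist]; a single logarithmic factor suffices. *)
exists (29%:R * 180%:R), 1%N => p eps e0; have l0 : 0 <= ln (1 + eps^-1).
  by apply: ln_ge0; rewrite lerDl invr_ge0 ltW.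
(* For [eps >= 1] the claimed ratio is at most 0, and the empty program will do. *)
have [e1|e1] := ltP eps 1; last first.
  exists [::], 0%N => n I n0 mp f0 fm fs k T; split.
  - by move=> sigma; case: T.
  - move=> sigma; have b0 : 0 <= (29%:R * 180%:R) * (k%:R / eps) * (1 + ln (1 + eps^-1)) ^+ 1.
      by apply: mulr_ge0; [rewrite !mulr_ge0 ?invr_ge0 // ltW|rewrite expr1 addr_ge0].
    by case: T => [|T]; rewrite /= cards0.
  apply: le_trans (ALG_ge0 I _ _); rewrite mulr_le0_ge0 ?best_within_ge0 //.
  apply: mulr_ge0_le0; rewrite ?invr_ge0 // subr_le0; apply: le_trans e1; rewrite gerBl.
  by rewrite invr_ge0 exprn_ge0 // expR_ge0.
have [N [L [N0 Ne zL NL]]] := parameters_exist e0 e1.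
exists (main_program p N L), (time_factor p N) => n I n0 mp f0 fm fs k T.
have mT : (main_time I p N <= T)%N := main_time_le I p N n0.
have dr sigma := drun_le mT (drun_main sigma N L f0 fm mp).
split; last exact: ALG_ge_OPT.
- by move=> sigma; apply: drun_surely (dr sigma) _.
move=> sigma; apply: drun_surely (dr sigma) _ => d s [cap _].
apply: (@le_trans _ _ (N.+1 * k * L)%:R); first by rewrite ler_nat.
rewrite expr1 mulnAC natrM; apply: (@le_trans _ _ ((29%:R * 180%:R) / eps * (1 + ln (1 + eps^-1)) * k%:R)).
  exact: ler_wpM2r.
by rewrite le_eqVlt; apply/orP; left; apply/eqP; field; rewrite gt_eqF.
Qed.
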